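(* For every real $t>0$, let $$\mathcal I(t) := \frac{e^{-t}}{2\pi i}\int_{c-\infty i}^{c+\infty i} \frac{e^{wt}\, e^{w\sqrt{w^2-1}-w^2+1}}{w+\sqrt{w^2-1}}\, dw ,$$ where $c>1$ is a fixed real number (the value of the integral does not depend on the choice of $c>1$). Then $\mathcal I(t)$ has the following representation as a difference of two convergent series: $$\mathcal I(t) = \frac{2te^{-t}}{\sqrt{\pi}}\left(\sum_{n\geq0}\frac{(-2)^n}{(2n)!} \sum_{r\geq0} b_r(n) \left(\frac{1}{t}\frac{d}{dt}\right)^{n} \left[t^{-r-2} I_{2n+r+1}(t)\right] - \sum_{n\geq0}\frac{(-2)^n}{(2n+1)!} \sum_{r\geq0} b_r(n) \left(\frac{1}{t}\frac{d}{dt}\right)^{n+1} \left[t^{-r-1} I_{2n+r+2}(t)\right]\right),$$ where $b_r(n) := 2^r\,\Gamma(n+r+\tfrac32)/r!$ for integers $n\ge 0$, $r\geq 0$.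
   Context: $I_\nu$ denotes the modified Bessel function of the first kind of order $\nu$, $I_\nu(t) := \sum_{k=0}^{\infty} \frac{(t/2)^{2k+\nu}}{k!\,\Gamma(k+1+\nu)}$. The integral is an inverse Laplace transform along the vertical line $\Re w=c$, understood as $\lim_{T\to\infty}\int_{c-iT}^{c+iT}$. The function $\sqrt{w^2-1}$ is the branch that is analytic in the $w$-plane cut along $[-1,1]$ and positive for real $w>1$. The operator $\left(\frac1t\frac{d}{dt}\right)^n$ is the $n$-fold iterate of the operator $h(t)\mapsto \frac1t h'(t)$, applied to the function of $t$ in square brackets. The double sums are iterated sums (inner sum over $r$, outer sum over $n$). *)

(* Defs.v *)
(* Stdlib reals with Coquelicot. *)
From Stdlib Require Import Arith Reals Lra Psatz.
From Coquelicot Require Import Coquelicot.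

Open Scope R_scope.

(** Euler's integral; meaningful for [x > 0]. *)
Definition Gamma (x : R) : R :=
  RInt_gen (fun u => Rpower u (x - 1) * exp (- u))
    (at_right 0) (Rbar_locally p_infty).

(** Meaningful for [t > 0] and [nu > -1]: [Rpower] is the real power only on
    positive bases, and every [Gamma] argument must be positive. *)
Definition BesselI (nu t : R) : R :=
  Series (fun k => Rpower (t / 2) (2 * INR k + nu)
                   / (INR (fact k) * Gamma (INR k + 1 + nu))).

Definition tinv_deriv_iter (n : nat) (h : R -> R) : R -> R :=
  Nat.iter n (fun g t => / t * Derive g t) h.

Definition bcoef (n r : nat) : R :=
  2 ^ r * Gamma (INR n + INR r + 3 / 2) / INR (fact r).

Definition inner1 (t : R) (n r : nat) : R :=
  bcoef n r
  * tinv_deriv_iter n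
      (fun s => / s ^ (r + 2) * BesselI (INR (2 * n + r + 1)) s) t.

Definition inner2 (t : R) (n r : nat) : R :=
  bcoef n r
  * tinv_deriv_iter (n + 1)
      (fun s => / s ^ (r + 1) * BesselI (INR (2 * n + r + 2)) s) t.

Definition outer1 (t : R) (n : nat) : R :=
  (-2) ^ n / INR (fact (2 * n)) * Series (inner1 t n).

Definition outer2 (t : R) (n : nat) : R :=
  (-2) ^ n / INR (fact (2 * n + 1)) * Series (inner2 t n).

Definition Cexp (z : C) : C :=
  (exp (Re z) * cos (Im z), exp (Re z) * sin (Im z)).

Definition on_cut (w : C) : Prop := Im w = 0 /\ -1 <= Re w <= 1.

(** [S] is the branch of [sqrt (w^2 - 1)] analytic off [[-1,1]] and positive on
    the reals above 1.  [ex_derive] is complex differentiability here; the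
    values of [S] on the cut are irrelevant.  A branch exists: see
    [sqrt_w2m1_branch_exists] below. *)
Definition is_sqrt_w2m1_branch (S : C -> C) : Prop :=
  (forall w : C, ~ on_cut w -> @ex_derive C_AbsRing C_NormedModule S w) /\
  (forall w : C, ~ on_cut w -> (S w * S w = w * w - 1)%C) /\
  (forall x : R, 1 < x -> Im (S (RtoC x)) = 0 /\ 0 < Re (S (RtoC x))).

Definition integrand (S : C -> C) (t : R) (w : C) : C :=
  (Cexp (w * RtoC t) * Cexp (w * S w - w * w + 1) / (w + S w))%C.

(** [J] is the limit, as [T] tends to infinity, of the integral of [f] along the
    segment from [c - i T] to [c + i T], parametrized by [w = c + i y]. *)
Definition is_vertical_integral (f : C -> C) (c : R) (J : C) : Prop :=
  exists F : R -> C,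
    (forall T : R,
       @is_RInt C_R_NormedModule (fun y : R => (Ci * f (c, y))%C) (- T) T (F T)) /\
    filterlim F (Rbar_locally p_infty) (locally J).

Definition is_scriptI (S : C -> C) (c t : R) (v : C) : Prop :=
  exists J : C, is_vertical_integral (integrand S t) c J /\
    v = (RtoC (exp (- t)) / (2 * RtoC PI * Ci) * J)%C.

(** Existence of the branch: [w * csqrt (1 - 1/w^2)] with the principal root. *)

Definition csqrt (z : C) : C :=
  (sqrt ((Cmod z + Re z) / 2),
   (if Rle_dec 0 (Im z) then 1 else -1) * sqrt ((Cmod z - Re z) / 2)).

Lemma csqrt_sq (z : C) : (csqrt z * csqrt z = z)%C.
Proof.
destruct z as [x y]; unfold csqrt, Cmult; simpl.
pose proof (Cmod_ge_0 (x, y)) as H0.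
assert (Hm : Cmod (x, y) * Cmod (x, y) = x * x + y * y).
{ unfold Cmod; simpl; rewrite sqrt_sqrt; nra. }
set (m := Cmod (x, y)) in *.
assert (Hx : - m <= x <= m) by (split; nra).
pose proof (sqrt_sqrt ((m + x) / 2) ltac:(lra)) as Hp.
pose proof (sqrt_sqrt ((m - x) / 2) ltac:(lra)) as Hq.
assert (Hpq : sqrt ((m + x) / 2) * sqrt ((m - x) / 2) = Rabs y / 2).
{ rewrite <- sqrt_mult by lra.
  replace ((m + x) / 2 * ((m - x) / 2)) with (Rsqr (Rabs y / 2)).
  - apply sqrt_Rsqr. pose proof (Rabs_pos y). lra.
  - unfold Rsqr. pose proof (Rsqr_abs y) as Ha. unfold Rsqr in Ha. nra. }
destruct (Rle_dec 0 y) as [Hy | Hy].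
- rewrite Rabs_pos_eq in Hpq by lra. f_equal; nra.
- rewrite Rabs_left in Hpq by lra. f_equal; nra.
Qed.

Lemma csqrt_Re_ge0 (z : C) : 0 <= Re (csqrt z).
Proof. apply sqrt_pos. Qed.

Lemma csqrt_Re_gt0 (z : C) : ~ (Im z = 0 /\ Re z <= 0) -> 0 < Re (csqrt z).
Proof.
intros H; destruct z as [x y]; simpl in *; apply sqrt_lt_R0.
pose proof (Cmod_ge_0 (x, y)) as H0.
assert (Hm : Cmod (x, y) * Cmod (x, y) = x * x + y * y).
{ unfold Cmod; simpl; rewrite sqrt_sqrt; nra. }
destruct (Rle_lt_dec (Cmod (x, y) + x) 0) as [Hle | Hlt]; [exfalso | lra].
apply H; split; nra.
Qed.

Definition sqrt_w2m1 (w : C) : C := (w * csqrt (1 - / (w * w)))%C.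

Lemma off_cut_neq0 (w : C) : ~ on_cut w -> w <> 0%C.
Proof. intros H ->; apply H; split; simpl; lra. Qed.

Lemma sqrt_w2m1_sq (w : C) :
  w <> 0%C -> (sqrt_w2m1 w * sqrt_w2m1 w = w * w - 1)%C.
Proof.
intros Hw; unfold sqrt_w2m1.
transitivity (w * w * (csqrt (1 - / (w * w)) * csqrt (1 - / (w * w))))%C.
- ring.
- rewrite csqrt_sq; field; exact Hw.
Qed.

Lemma off_cut_Re (a : C) :
  ~ on_cut a -> 0 < Re (csqrt (1 - / (a * a))).
Proof.
intros Ha; apply csqrt_Re_gt0; intros [Hi Hr].
pose proof (off_cut_neq0 a Ha) as Ha0.
destruct (/ (a * a))%C as [u v] eqn:E.
simpl in Hi, Hr.
assert (Hv : v = 0) by lra; subst v.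
assert (E1 : (a * a * (u, 0) = 1)%C).
{ rewrite <- E; field; exact Ha0. }
destruct a as [p q]; unfold Cmult, RtoC in E1; simpl in E1.
injection E1 as E2 E3.
apply Ha; unfold on_cut; simpl.
assert (Hu : 1 <= u) by lra.
assert (Hpq : p * q = 0).
{ destruct (Rmult_integral (p * q) u) as [K | K]; nra. }
assert (Hq : q = 0).
{ destruct (Rmult_integral p q Hpq) as [K | K]; [subst p; exfalso; nra | exact K]. }
subst q; split; [reflexivity | split; nra].
Qed.

Lemma is_derive_of_quadratic (f : C -> C) (a d : C) (delta M : R) :
  0 < delta -> 0 <= M ->
  (forall z : C, Cmod (z - a) < delta ->
     Cmod (f z - f a - (z - a) * d) <= M * (Cmod (z - a) * Cmod (z - a))) ->
  @is_derive C_AbsRing C_NormedModule f a d.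
Proof.
intros Hd HM H; split.
- apply (is_linear_scal_l (K := C_AbsRing) (V := C_NormedModule)).
- intros x Hx.
  assert (Ex : a = x) by exact (is_filter_lim_locally_unique _ _ Hx).
  subst x; intros eps.
  assert (Hm : 0 < Rmin delta (eps / (M + 1))).
  { apply Rmin_pos; [exact Hd | apply Rdiv_lt_0_compat; [apply cond_pos | lra]]. }
  exists (mkposreal _ Hm); intros z Hz.
  assert (Hz' : Cmod (z - a) < Rmin delta (eps / (M + 1))) by exact Hz.
  pose proof (Rmin_l delta (eps / (M + 1))).
  pose proof (Rmin_r delta (eps / (M + 1))).
  change (Cmod (f z - f a - (z - a) * d) <= eps * Cmod (z - a)).
  refine (Rle_trans _ _ _ (H z ltac:(lra)) _).
  pose proof (Cmod_ge_0 (z - a)).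
  assert (Hk : (M + 1) * Cmod (z - a) <= eps).
  { apply Rle_trans with ((M + 1) * (eps / (M + 1))).
    - apply Rmult_le_compat_l; lra.
    - right; field; lra. }
  nra.
Qed.

Lemma sqrt_w2m1_derivable (a : C) :
  ~ on_cut a -> @ex_derive C_AbsRing C_NormedModule sqrt_w2m1 a.
Proof.
intros Ha; pose proof (off_cut_neq0 a Ha) as Ha0.
pose proof (off_cut_Re a Ha) as Hu.
set (u := csqrt (1 - / (a * a))%C) in *.
assert (ESa : sqrt_w2m1 a = (a * u)%C) by reflexivity.
assert (Hu0 : u <> 0%C) by (intros K; rewrite K in Hu; simpl in Hu; lra).
assert (Hrho : Re u <= Cmod u).
{ apply Rle_trans with (Rabs (Re u)); [apply Rle_abs |].
  apply Rle_trans with (Rmax (Rabs (fst u)) (Rabs (snd u)));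
    [apply Rmax_l | apply Rmax_Cmod]. }
pose proof (Cmod_gt_0 a) as [HA _]; specialize (HA Ha0).
set (A := Cmod a) in *; set (U := Cmod u) in *; set (rho := Re u) in *.
set (m := A * rho / 4).
assert (Hm : 0 < m) by (unfold m; nra).
set (delta := Rmin 1 (Rmin (A / 2) (A * rho / (4 * U)))).
assert (Hd : 0 < delta).
{ repeat apply Rmin_pos; try lra; apply Rdiv_lt_0_compat; nra. }
set (L := (2 * A + 1) / m).
assert (HL : 0 < L) by (apply Rdiv_lt_0_compat; lra).
assert (HAU : 0 < 2 * (A * U)) by nra.
apply (ex_intro _ (a / sqrt_w2m1 a)%C).
apply is_derive_of_quadratic with delta ((1 + L * L) / (2 * (A * U)));
  [exact Hd | apply Rlt_le, Rdiv_lt_0_compat; nra |].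
intros z Hz.
pose proof (Rmin_l 1 (Rmin (A / 2) (A * rho / (4 * U)))) as D1.
pose proof (Rmin_r 1 (Rmin (A / 2) (A * rho / (4 * U)))) as D2.
pose proof (Rmin_l (A / 2) (A * rho / (4 * U))) as D3.
pose proof (Rmin_r (A / 2) (A * rho / (4 * U))) as D4.
fold delta in D1, D2.
set (h := Cmod (z - a)) in *.
assert (Hh0 : 0 <= h) by apply Cmod_ge_0.
assert (HhU : h * U <= m).
{ apply Rle_trans with (A * rho / (4 * U) * U);
    [apply Rmult_le_compat_r; lra | right; unfold m; field; lra]. }
assert (HzA : A / 2 <= Cmod z).
{ pose proof (Cmod_triangle z (a - z)) as K.
  replace (z + (a - z))%C with a in K by ring.
  replace (a - z)%C with (- (z - a))%C in K by ring.
  rewrite Cmod_opp in K; fold h A in K; lra. }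
assert (Hz0 : z <> 0%C) by (intros ->; rewrite Cmod_0 in HzA; lra).
pose proof (sqrt_w2m1_sq a Ha0) as Sa2.
pose proof (sqrt_w2m1_sq z Hz0) as Sz2.
assert (Hlow : m <= Cmod (sqrt_w2m1 z + sqrt_w2m1 a)).
{ set (v := csqrt (1 - / (z * z))%C).
  assert (Hv : rho <= Cmod (v + u)).
  { apply Rle_trans with (Rabs (Re (v + u))).
    - pose proof (csqrt_Re_ge0 (1 - / (z * z))%C) as K; fold v in K.
      replace (Re (v + u)) with (Re v + Re u) by reflexivity.
      fold rho; rewrite Rabs_pos_eq; lra.
    - apply Rle_trans with (2 := Rmax_Cmod (v + u)%C); apply Rmax_l. }
  pose proof (Cmod_triangle (sqrt_w2m1 z + sqrt_w2m1 a) ((z - a) * u)) as K.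
  replace (sqrt_w2m1 z + sqrt_w2m1 a + (z - a) * u)%C with (z * (v + u))%C in K
    by (rewrite ESa; unfold sqrt_w2m1; fold v; ring).
  rewrite !Cmod_mult in K; fold h U in K.
  assert (A / 2 * rho <= Cmod z * Cmod (v + u))
    by (apply Rmult_le_compat; lra).
  unfold m in *; lra. }
assert (Hlip : Cmod (sqrt_w2m1 z - sqrt_w2m1 a) <= L * h).
{ assert (K : (Cmod (sqrt_w2m1 z - sqrt_w2m1 a)
               * Cmod (sqrt_w2m1 z + sqrt_w2m1 a) <= h * (2 * A + 1))%R).
  { rewrite <- Cmod_mult.
    replace ((sqrt_w2m1 z - sqrt_w2m1 a) * (sqrt_w2m1 z + sqrt_w2m1 a))%C
      with ((z - a) * (z + a))%C.
    - rewrite Cmod_mult; fold h; apply Rmult_le_compat_l; [exact Hh0 |].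
      replace (z + a)%C with ((z - a) + (a + a))%C by ring.
      pose proof (Cmod_triangle (z - a) (a + a)) as K1.
      pose proof (Cmod_triangle a a) as K2; fold A in K2; fold h in K1; lra.
    - transitivity ((z * z - 1) - (a * a - 1))%C; [ring |].
      rewrite <- Sz2, <- Sa2; ring. }
  pose proof (Cmod_ge_0 (sqrt_w2m1 z - sqrt_w2m1 a)) as K0.
  apply Rmult_le_reg_r with m; [exact Hm |].
  replace (L * h * m) with (h * (2 * A + 1)) by (unfold L; field; lra).
  nra. }
assert (HSa0 : sqrt_w2m1 a <> 0%C) by (rewrite ESa; apply Cmult_neq_0; assumption).
assert (HmodSa : Cmod (2 * sqrt_w2m1 a) = 2 * (A * U)).
{ rewrite ESa, !Cmod_mult, Cmod_R, Rabs_pos_eq; [reflexivity | lra]. }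
assert (H20 : (2 * sqrt_w2m1 a <> 0)%C).
{ intros K; rewrite K, Cmod_0 in HmodSa; lra. }
replace (sqrt_w2m1 z - sqrt_w2m1 a - (z - a) * (a / sqrt_w2m1 a))%C
  with (((z - a) * (z - a)
         - (sqrt_w2m1 z - sqrt_w2m1 a) * (sqrt_w2m1 z - sqrt_w2m1 a))
        / (2 * sqrt_w2m1 a))%C.
- rewrite Cmod_div by exact H20; rewrite HmodSa.
  replace ((1 + L * L) / (2 * (A * U)) * (h * h))
    with ((1 + L * L) * (h * h) / (2 * (A * U))) by (unfold Rdiv; ring).
  apply Rmult_le_compat_r; [apply Rlt_le, Rinv_0_lt_compat; lra |].
  refine (Rle_trans _ _ _ (Cmod_triangle _ _) _).
  rewrite Cmod_opp, !Cmod_mult; fold h.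
  pose proof (Cmod_ge_0 (sqrt_w2m1 z - sqrt_w2m1 a)).
  nra.
- assert (K : ((sqrt_w2m1 z - sqrt_w2m1 a) * (sqrt_w2m1 z - sqrt_w2m1 a)
               = (z * z - 1) + (a * a - 1) - 2 * sqrt_w2m1 a * sqrt_w2m1 z)%C).
  { rewrite <- Sz2, <- Sa2; ring. }
  rewrite K.
  transitivity ((2 * sqrt_w2m1 a * sqrt_w2m1 z - 2 * (a * a - 1)
                 - 2 * (z - a) * a) / (2 * sqrt_w2m1 a))%C.
  + f_equal; ring.
  + rewrite <- Sa2; field; exact HSa0.
Qed.

Lemma sqrt_w2m1_branch_exists : exists S : C -> C, is_sqrt_w2m1_branch S.
Proof.
exists sqrt_w2m1; split; [exact sqrt_w2m1_derivable | split].
- intros w Hw; exact (sqrt_w2m1_sq w (off_cut_neq0 w Hw)).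
- intros x Hx.
  assert (E : (1 - / (RtoC x * RtoC x))%C = RtoC (1 - / (x * x))).
  { rewrite <- RtoC_mult, <- RtoC_inv by nra; rewrite <- RtoC_minus; reflexivity. }
  assert (Hy : 0 < 1 - / (x * x)).
  { assert (/ (x * x) < 1) by (rewrite <- Rinv_1; apply Rinv_lt_contravar; nra). lra. }
  assert (Hs : csqrt (RtoC (1 - / (x * x))) = RtoC (sqrt (1 - / (x * x)))).
  { unfold csqrt; rewrite Cmod_R, Rabs_pos_eq by lra.
    unfold RtoC at 1 2 3 4 5; simpl.
    apply injective_projections; simpl.
    - f_equal; lra.
    - replace ((1 - / (x * x) - (1 - / (x * x))) / 2) with 0 by lra.
      rewrite sqrt_0; ring. }
  unfold sqrt_w2m1; rewrite E, Hs, <- RtoC_mult; simpl; split; [reflexivity |].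
  apply Rmult_lt_0_compat; [lra | apply sqrt_lt_R0; exact Hy].
Qed.

(* Main.v *)
Require Import Defs.
From Stdlib Require Import Arith Reals Lra Psatz.
From Coquelicot Require Import Coquelicot.

Open Scope R_scope.

(** Put [x = w - sqrt (w^2 - 1)], so that the integrand is
    [exp (w t) F(w)] with [F = x exp ((1 - x^2) / 2)].  On the cut,
    [w = cos phi] and [x = exp (+-i phi)]; the jump of [F] there is
    [J(phi) = Im (exp (i phi) exp ((1 - exp (2 i phi)) / 2))], and both sides equal
    [exp (-t) / PI] times the integral over [[0, PI]] of
    [sin phi J(phi) exp (t cos phi)].

    Left-hand side: [F(w) = sum_m mu_m w^(-m-1)], where [mu_m] is [1 / PI] times the
    integral of [sin phi J(phi) cos^m phi]; this is summed from
    [x^n = sum_m N_n(m) w^(-m-1)], the [N_n(m)] being the moments of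
    [sin phi sin (n phi)].  The inverse Laplace transform of [w^(-m-1)] is [t^m / m!].

    Right-hand side: by Gamma(a+1/2) Gamma(b+1/2) / (a+b)! = integral of
    [sin^(2a) phi cos^(2b) phi] each term is an integral against [cosh (t cos phi)];
    the sum over [r] gives [exp (sin^2 phi)] and the sums over [n] give
    [cos (sin phi cos phi)] and [sin (sin phi cos phi)]. *)

(** * Series of functions and double series *)

(** The integral is never collapsed onto the cut by Cauchy's theorem. On [Re w = c > 1] one has
    [|w| >= c > 1], so the expansion in powers of [1/w] converges on the line itself, and
    integrating it term by term replaces contour deformation. The obstacle is the order of the limit
    [T -> infinity] and the summation: the leading term decays only like [1/|w|], so its line
    integral converges conditionally. The remainder after the power [w^(-M-1)], however, is at most
    a constant times [c^(-M) |w|^(-2)], and this is integrable along the line uniformly in [T]. The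
    branch is arbitrary, so no formula for it is available. Its square, its continuity and its sign
    above 1 give [|x| <= 1], and the series for [x^n] is then recognised as the only bounded
    solution of a recurrence. On the right-hand side the powers of [t] and the Bessel orders are
    matched: each bracket is [1/t] times an even power series that starts just late enough for all
    the iterated derivatives to keep this shape. *)

Lemma norm_sum_n_diff {V : NormedModule R_AbsRing} (f : nat -> V) (b : nat -> R)
    (N M : nat) :
  (forall n, norm (f n) <= b n) -> (N <= M)%nat ->
  norm (minus (sum_n f M) (sum_n f N)) <= sum_n b M - sum_n b N.
Proof.
intros Hb HNM; induction HNM as [| M HNM IH].
- rewrite minus_eq_zero, Rminus_diag; right; apply (norm_zero (V := V)).
- rewrite !sum_Sn; unfold minus.
  rewrite (plus_comm (sum_n f M)), <- plus_assoc.
  refine (Rle_trans _ _ _ (norm_triangle _ _) _).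
  pose proof (Hb (S M)) as H1.
  unfold plus in *; simpl in *; unfold minus, plus in IH; simpl in IH; lra.
Qed.

(** The bound between two partial sums survives the limit in the longer one. A general normed module
    is kept because the lemma serves real series under an integral as well as complex series in
    [1/w]. *)
Lemma series_tail_bound {V : NormedModule R_AbsRing} (f : nat -> V) (b : nat -> R)
    (L : V) (B : R) (N : nat) :
  (forall n, norm (f n) <= b n) -> is_series f L -> is_series b B ->
  norm (minus L (sum_n f N)) <= B - sum_n b N.
Proof.
intros Hb Hf HB.
assert (H1 : is_lim_seq (fun M => norm (minus (sum_n f M) (sum_n f N)))
               (norm (minus L (sum_n f N)))).
{ apply (filterlim_comp _ _ _ (fun M => minus (sum_n f M) (sum_n f N)) norm
           eventually (locally (minus L (sum_n f N)))); [| apply filterlim_norm].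
  unfold minus; apply (filterlim_comp_2 (G := locally L) (H := locally (opp (sum_n f N))));
    [exact Hf | apply filterlim_const | apply filterlim_plus]. }
assert (H2 : is_lim_seq (fun M => sum_n b M - sum_n b N) (B - sum_n b N)).
{ apply (is_lim_seq_minus' (sum_n b) (fun _ => sum_n b N)); [exact HB | apply is_lim_seq_const]. }
apply (is_lim_seq_le_loc _ _ (Finite _) (Finite _)) with (2 := H1) (3 := H2).
exists N; intros M HM; apply norm_sum_n_diff; assumption.
Qed.

Lemma series_remainder_lim (b : nat -> R) (B : R) :
  is_series b B -> is_lim_seq (fun N => B - sum_n b N) 0.
Proof.
intros H; replace (Finite 0) with (Finite (B - B)) by (f_equal; lra).
apply (is_lim_seq_minus' (fun _ => B) (sum_n b)); [apply is_lim_seq_const | exact H].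
Qed.

Lemma is_series_of_bound {V : NormedModule R_AbsRing} (f : nat -> V) (L : V) (e : nat -> R) :
  (forall N, norm (minus (sum_n f N) L) <= e N) -> is_lim_seq e 0 -> is_series f L.
Proof.
intros H He; apply filterlim_locally_ball_norm; intros eps.
apply is_lim_seq_spec in He; destruct (He eps) as [N HN].
exists N; intros n Hn; specialize (HN n Hn); unfold ball_norm.
apply Rle_lt_trans with (1 := H n).
rewrite Rminus_0_r in HN; apply Rle_lt_trans with (2 := HN), Rle_abs.
Qed.

Lemma is_series_Rmult_l (c : R) (a : nat -> R) (l : R) :
  is_series a l -> is_series (fun n => c * a n) (c * l).
Proof. exact (is_series_scal_l c a l). Qed.

Lemma ex_RInt_sum_n (f : nat -> R -> R) (a b : R) (N : nat) :
  (forall n, ex_RInt (f n) a b) ->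
  is_RInt (fun x => sum_n (fun n => f n x) N) a b (sum_n (fun n => RInt (f n) a b) N).
Proof.
intros H; induction N as [| N IH].
- rewrite sum_O; apply (is_RInt_ext (f 0%nat)); [intros; rewrite sum_O; reflexivity |].
  apply (RInt_correct (V := R_CompleteNormedModule)), H.
- rewrite sum_Sn.
  apply (is_RInt_ext (fun x => plus (sum_n (fun n => f n x) N) (f (S N) x)));
    [intros; rewrite sum_Sn; reflexivity |].
  apply (is_RInt_plus (V := R_NormedModule)); [exact IH |].
  apply (RInt_correct (V := R_CompleteNormedModule)), H.
Qed.

(** Weierstrass test: the remainder is at most [B - sum_n b N] at every point, so its integral is at
    most [be - al] times that. *)
Lemma is_series_RInt (f : nat -> R -> R) (g : R -> R) (b : nat -> R) (al be : R) :
  al <= be ->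
  (forall n x, al <= x <= be -> Rabs (f n x) <= b n) -> ex_series b ->
  (forall n, ex_RInt (f n) al be) -> ex_RInt g al be ->
  (forall x, al <= x <= be -> is_series (fun n => f n x) (g x)) ->
  is_series (fun n => RInt (f n) al be) (RInt g al be).
Proof.
intros Hab Hb [B HB] Hf Hg Hs.
apply (is_series_of_bound _ _ (fun N => (be - al) * (B - sum_n b N))).
- intros N.
  apply (norm_RInt_le (V := R_NormedModule)
           (fun x => minus (sum_n (fun n => f n x) N) (g x))
           (fun _ => B - sum_n b N) al be); [exact Hab | | |].
  + intros x Hx; rewrite <- norm_opp, opp_minus.
    apply (series_tail_bound (V := R_NormedModule) (fun n => f n x)); [intros n; apply Hb, Hx | apply Hs, Hx | exact HB].
  + apply (is_RInt_minus (V := R_NormedModule)); [apply ex_RInt_sum_n, Hf |].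
    apply (RInt_correct (V := R_CompleteNormedModule)), Hg.
  + apply (is_RInt_const (V := R_NormedModule)).
- replace (Finite 0) with (Rbar_mult (be - al) 0)
    by (simpl; f_equal; ring).
  apply is_lim_seq_scal_l, series_remainder_lim, HB.
Qed.

Lemma norm_sum_n_le {V : NormedModule R_AbsRing} (f : nat -> V) (b : nat -> R) (N : nat) :
  (forall n, norm (f n) <= b n) -> norm (sum_n f N) <= sum_n b N.
Proof.
intros H; induction N as [| N IH]; [rewrite !sum_O; apply H |].
rewrite !sum_Sn; refine (Rle_trans _ _ _ (norm_triangle _ _) _).
pose proof (H (S N)); unfold plus; simpl; lra.
Qed.

Lemma is_series_sum_n {V : NormedModule R_AbsRing} (f : nat -> nat -> V) (m : nat -> V) (N : nat) :
  (forall j, is_series (fun i => f i j) (m j)) ->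
  is_series (fun i => sum_n (f i) N) (sum_n m N).
Proof.
intros H; induction N as [| N IH].
- rewrite sum_O; apply (is_series_ext (fun i => f i 0%nat)), H.
  intros; rewrite sum_O; reflexivity.
- rewrite sum_Sn; apply (is_series_ext (fun i => plus (sum_n (f i) N) (f i (S N)))).
  + intros; rewrite sum_Sn; reflexivity.
  + apply @is_series_plus; [exact IH | apply H].
Qed.

Lemma series_norm_le {V : NormedModule R_AbsRing} (f : nat -> V) (b : nat -> R) (L : V) (B : R) :
  (forall n, norm (f n) <= b n) -> is_series f L -> is_series b B -> norm L <= B.
Proof.
intros Hb Hf HB.
assert (H1 : is_lim_seq (fun M => norm (sum_n f M)) (norm L)).
{ apply (filterlim_comp _ _ _ (sum_n f) norm eventually (locally L)); [exact Hf | apply filterlim_norm]. }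
apply (is_lim_seq_le _ _ (Finite _) (Finite _)) with (2 := H1) (3 := HB).
intros N; apply norm_sum_n_le, Hb.
Qed.

(** Cutting every row at [N] costs at most [a i * (B - sum_n b N)] in row [i], hence at most
    [A * (B - sum_n b N)] in total, which tends to 0. The product majorant is what makes the error
    factor in this way. *)
Lemma is_series_swap {V : NormedModule R_AbsRing} (f : nat -> nat -> V)
    (a b : nat -> R) (l m : nat -> V) (L : V) :
  (forall i j, norm (f i j) <= a i * b j) -> ex_series a -> ex_series b ->
  (forall i, is_series (f i) (l i)) ->
  (forall j, is_series (fun i => f i j) (m j)) ->
  is_series l L -> is_series m L.
Proof.
intros Hf [A HA] [B HB] Hl Hm HL.
apply (is_series_of_bound _ _ (fun N => A * (B - sum_n b N))).
- intros N; rewrite <- norm_opp, opp_minus.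
  apply (series_norm_le (fun i => minus (l i) (sum_n (f i) N))
           (fun i => a i * (B - sum_n b N))).
  + intros i.
    assert (E : sum_n (fun j => a i * b j) N = a i * sum_n b N)
      by exact (sum_n_mult_l (K := R_Ring) (a i) b N).
    rewrite Rmult_minus_distr_l, <- E.
    apply series_tail_bound; [apply Hf | apply Hl |].
    exact (is_series_scal_l (a i) b B HB).
  + apply @is_series_minus; [exact HL | apply is_series_sum_n, Hm].
  + apply is_series_scal_r, HA.
- replace (Finite 0) with (Rbar_mult A 0) by (simpl; f_equal; ring).
  apply is_lim_seq_scal_l, series_remainder_lim, HB.
Qed.

(** * Gamma at integers and half-integers *)

Lemma ex_RInt_continuous_all (f : R -> R) (a b : R) :
  (forall x, continuous f x) -> ex_RInt f a b.
Proof. intros H; apply (ex_RInt_continuous (V := R_CompleteNormedModule)); intros; apply H. Qed.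

Lemma is_derive_eq (f : R -> R) (x d d' : R) : is_derive f x d -> d = d' -> is_derive f x d'.
Proof. intros H <-; exact H. Qed.

(** Serves to evaluate Gamma at 1/2: with [u = s^2], Euler's integral there is twice the integral of
    [exp (- s^2)] over the half-line. *)
Definition gauss (z : R) : R := RInt (fun s => exp (- s ^ 2)) 0 z.

Lemma gauss_continuous (x : R) : continuous (fun s => exp (- s ^ 2)) x.
Proof. apply (ex_derive_continuous (V := R_NormedModule)); auto_derive; trivial. Qed.

Lemma gauss_derive (z : R) : is_derive gauss z (exp (- z ^ 2)).
Proof.
apply (is_derive_RInt (V := R_NormedModule) (fun s => exp (- s ^ 2)) gauss 0 z);
  [| apply gauss_continuous].
apply filter_forall; intros b; apply (RInt_correct (V := R_CompleteNormedModule)).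
apply ex_RInt_continuous_all, gauss_continuous.
Qed.

Lemma gauss_pos (z : R) : 0 <= z -> 0 <= gauss z.
Proof.
intros Hz; apply RInt_ge_0; [exact Hz | |].
- apply ex_RInt_continuous_all, gauss_continuous.
- intros; apply Rlt_le, exp_pos.
Qed.

(** The integrand of the classical companion of [gauss z ^ 2]: it reduces the Gaussian integral to
    the arctangent at [z = 0], without a double integral. *)
Definition gauss_kernel (z u : R) : R := exp (- (z ^ 2 * (1 + u ^ 2))) / (1 + u ^ 2).

Lemma gauss_kernel_continuous (z u : R) : continuous (gauss_kernel z) u.
Proof.
apply (ex_derive_continuous (V := R_NormedModule)); unfold gauss_kernel; auto_derive.
nra.
Qed.

Lemma gauss_scale (z : R) :
  RInt (fun u => z * exp (- (z ^ 2 * u ^ 2))) 0 1 = gauss z.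
Proof.
apply (is_RInt_unique (V := R_CompleteNormedModule)).
apply (is_RInt_ext (V := R_NormedModule) (fun u => scal z (exp (- (z * u + 0) ^ 2)))).
- intros x _; unfold scal; simpl; unfold mult; simpl; f_equal; f_equal; ring.
- apply (is_RInt_comp_lin (V := R_NormedModule) (fun s => exp (- s ^ 2))).
  replace (z * 0 + 0) with 0 by ring; replace (z * 1 + 0) with z by ring.
  apply (RInt_correct (V := R_CompleteNormedModule)).
  apply ex_RInt_continuous_all, gauss_continuous.
Qed.

Lemma gauss_kernel_derive (z : R) :
  is_derive (fun z => RInt (gauss_kernel z) 0 1) z (- 2 * exp (- z ^ 2) * gauss z).
Proof.
assert (HD : forall z u, is_derive (fun z => gauss_kernel z u) z
                 (- 2 * z * exp (- (z ^ 2 * (1 + u ^ 2))))).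
{ intros z0 u; unfold gauss_kernel; auto_derive; [nra |].
  set (E := exp _); change (exp _) with E; field; nra. }
replace (- 2 * exp (- z ^ 2) * gauss z)
  with (RInt (fun u => Derive (fun z => gauss_kernel z u) z) 0 1).
- apply is_derive_RInt_param.
  + apply filter_forall; intros z0 u _; eexists; apply HD.
  + intros u _.
    apply (continuity_2d_pt_ext (fun z u => - 2 * z * exp (- (z ^ 2 * (1 + u ^ 2))))).
    { intros; symmetry; apply is_derive_unique, HD. }
    apply (continuity_2d_pt_mult (fun z u => - 2 * z)).
    { apply (continuity_2d_pt_mult (fun z u => - 2)); 
       [apply continuity_2d_pt_const | apply continuity_2d_pt_id1]. }
    apply (continuity_1d_2d_pt_comp exp).
    { apply derivable_continuous_pt, derivable_pt_exp. }
    apply (continuity_2d_pt_ext (fun z u => - (z * z * (1 + u * u)))); [intros; ring |].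
    repeat first [apply continuity_2d_pt_opp | apply continuity_2d_pt_mult
      | apply continuity_2d_pt_plus | apply continuity_2d_pt_id1 | apply continuity_2d_pt_id2
      | apply continuity_2d_pt_const].
  + apply filter_forall; intros y; apply ex_RInt_continuous_all, gauss_kernel_continuous.
- rewrite <- (gauss_scale z).
  rewrite <- (RInt_scal (V := R_CompleteNormedModule)).
  + apply RInt_ext; intros u _.
    etransitivity; [apply is_derive_unique, HD |].
    replace (- (z ^ 2 * (1 + u ^ 2))) with (- z ^ 2 + - (z ^ 2 * u ^ 2)) by ring.
    rewrite exp_plus; unfold scal; simpl; unfold mult; simpl; ring.
  + apply ex_RInt_continuous_all; intros u.
    apply (ex_derive_continuous (V := R_NormedModule)); auto_derive; trivial.
Qed.

(* The two summands have opposite derivatives in [z]; the value is taken at [z = 0]. *)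
Lemma gauss_square (z : R) : 0 <= z -> gauss z ^ 2 + RInt (gauss_kernel z) 0 1 = PI / 4.
Proof.
intros Hz.
assert (E : RInt (gauss_kernel 0) 0 1 = PI / 4).
{ rewrite <- atan_1; apply (is_RInt_unique (V := R_CompleteNormedModule)).
  replace (atan 1) with (minus (atan 1) (atan 0))
    by (unfold minus, plus, opp; simpl; rewrite atan_0; ring).
  apply (is_RInt_derive (V := R_CompleteNormedModule) atan).
  - intros x _; unfold gauss_kernel.
    replace (exp _ / _) with (/ (1 + x²)); [apply is_derive_atan |].
    replace (- (0 ^ 2 * (1 + x ^ 2))) with 0 by ring; rewrite exp_0; unfold Rsqr.
    field; nra.
  - intros; apply gauss_kernel_continuous. }
assert (E0 : gauss 0 = 0) by (apply (RInt_point (V := R_CompleteNormedModule))).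
replace (PI / 4) with (gauss 0 ^ 2 + RInt (gauss_kernel 0) 0 1)
  by (rewrite E0, E; ring).
assert (Hd : forall x, is_derive (fun z => gauss z ^ 2 + RInt (gauss_kernel z) 0 1) x 0).
{ intros x.
  apply (is_derive_eq _ _ (INR 2 * exp (- x ^ 2) * gauss x ^ (2 - 1) + - 2 * exp (- x ^ 2) * gauss x));
    [| simpl; ring].
  apply (is_derive_plus (V := R_NormedModule) (fun z => gauss z ^ 2)); [| apply gauss_kernel_derive].
  apply (is_derive_pow gauss 2 x), gauss_derive. }
destruct (Req_dec z 0) as [-> | Hz0]; [reflexivity |].
destruct (MVT_gen (fun z => gauss z ^ 2 + RInt (gauss_kernel z) 0 1) 0 z (fun _ => 0)) as [c [_ Hc]].
- intros; apply Hd.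
- intros x _; apply continuity_pt_filterlim,
    (ex_derive_continuous (V := R_NormedModule) (fun z => gauss z ^ 2 + RInt (gauss_kernel z) 0 1)).
  exists 0; apply Hd.
- lra.
Qed.

Lemma gauss_kernel_bounds (z : R) : 0 <= RInt (gauss_kernel z) 0 1 <= exp (- z ^ 2).
Proof.
assert (Hi := ex_RInt_continuous_all _ 0 1 (gauss_kernel_continuous z)).
split.
- apply RInt_ge_0; [lra | exact Hi |].
  intros u _; unfold gauss_kernel.
  apply Rlt_le, Rdiv_lt_0_compat; [apply exp_pos | nra].
- replace (exp (- z ^ 2)) with (RInt (fun _ => exp (- z ^ 2)) 0 1).
  + apply RInt_le; [lra | exact Hi | apply (ex_RInt_const (V := R_NormedModule)) |].
    intros u Hu; unfold gauss_kernel.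
    apply Rle_trans with (exp (- (z ^ 2 * (1 + u ^ 2)))).
    * pose proof (exp_pos (- (z ^ 2 * (1 + u ^ 2)))).
      apply Rmult_le_reg_r with (1 + u ^ 2); [nra |].
      unfold Rdiv; rewrite Rmult_assoc, Rinv_l by nra; nra.
    * destruct (Rle_lt_or_eq_dec 0 (z ^ 2 * u ^ 2)) as [K | K]; [nra | |].
      -- left; apply exp_increasing; nra.
      -- right; f_equal; nra.
  + rewrite (RInt_const (V := R_CompleteNormedModule)); unfold scal; simpl; unfold mult; simpl; ring.
Qed.

Lemma gauss_lim : is_lim gauss p_infty (sqrt PI / 2).
Proof.
assert (Hk : is_lim (fun z => RInt (gauss_kernel z) 0 1) p_infty 0).
{ apply (is_lim_le_le_loc (fun _ => 0) (fun z => exp (- z))).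
  - exists 1; intros z Hz; destruct (gauss_kernel_bounds z) as [H1 H2]; split; [exact H1 |].
    apply Rle_trans with (1 := H2); left; apply exp_increasing; nra.
  - apply is_lim_const.
  - apply (is_lim_comp exp Ropp p_infty 0 m_infty); [apply is_lim_exp_m | | exists 0; discriminate].
    apply (is_lim_opp (fun z => z) p_infty p_infty), is_lim_id. }
assert (E : sqrt PI / 2 = sqrt (PI / 4 - 0)).
{ rewrite Rminus_0_r; replace (PI / 4) with (PI * (/ 2 * / 2)) by field.
  rewrite sqrt_mult_alt by (apply Rlt_le, PI_RGT_0).
  rewrite sqrt_square by lra; reflexivity. }
rewrite E.
apply (is_lim_ext_loc (fun z => sqrt (PI / 4 - RInt (gauss_kernel z) 0 1))).
- exists 0; intros z Hz; rewrite <- (gauss_square z) by lra.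
  replace (gauss z ^ 2 + _ - _) with (gauss z ^ 2) by ring.
  apply sqrt_pow2, gauss_pos; lra.
- apply (filterlim_comp _ _ _ (fun z => PI / 4 - RInt (gauss_kernel z) 0 1) sqrt
           (Rbar_locally' p_infty) (locally (PI / 4 - 0))).
  + apply (is_lim_minus' (fun _ => PI / 4)); [apply is_lim_const | exact Hk].
  + apply continuity_pt_filterlim, continuity_pt_sqrt.
    pose proof PI_RGT_0; lra.
Qed.

(** Both ends are improper, so [P] is an antiderivative on the open half-line only, and its limits
    stand for the missing end values. The filters supply the positivity of both bounds of
    integration. *)
Lemma is_RInt_gen_antiderivative (f P : R -> R) (la lb : R) :
  (forall x, 0 < x -> is_derive P x (f x)) -> (forall x, 0 < x -> continuous f x) ->
  filterlim P (at_right 0) (locally la) -> filterlim P (Rbar_locally p_infty) (locally lb) ->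
  is_RInt_gen f (at_right 0) (Rbar_locally p_infty) (lb - la).
Proof.
intros HP Hf Ha Hb D HD.
assert (HL : filterlim (fun ab : R * R => P (snd ab) - P (fst ab))
               (filter_prod (at_right 0) (Rbar_locally p_infty)) (locally (lb - la))).
{ apply (filterlim_comp_2 (G := locally lb) (H := locally (- la))) with
    (f := fun ab => P (snd ab)) (g := fun ab => - P (fst ab)) (h := Rplus).
  - apply (filterlim_comp _ _ _ snd P _ (Rbar_locally p_infty)); [apply filterlim_snd | exact Hb].
  - apply (filterlim_comp _ _ _ (fun ab => P (fst ab)) Ropp _ (locally la)).
    + apply (filterlim_comp _ _ _ fst P _ (at_right 0)); [apply filterlim_fst | exact Ha].
    + apply (filterlim_opp (V := R_NormedModule)).
  - apply (filterlim_plus (V := R_NormedModule)). }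
specialize (HL D HD); unfold filtermap in HL.
assert (Hpos : filter_prod (at_right 0) (Rbar_locally p_infty)
                 (fun ab : R * R => 0 < fst ab /\ 0 < snd ab)).
{ apply (Filter_prod _ _ _ (fun x => 0 < x) (fun x => 0 < x)).
  - exists (mkposreal 1 Rlt_0_1); intros y _ Hy; exact Hy.
  - exists 0; intros x Hx; exact Hx.
  - intros x y Hx Hy; split; assumption. }
unfold filtermapi; generalize (filter_and _ _ HL Hpos).
apply filter_imp; intros [x y] [H1 [Hx Hy]]; simpl in *.
exists (P y - P x); split; [| exact H1].
apply (is_RInt_derive (V := R_CompleteNormedModule) P f x y).
- intros z Hz; apply HP; apply Rlt_le_trans with (2 := proj1 Hz); apply Rmin_glb_lt; assumption.
- intros z Hz; apply Hf; apply Rlt_le_trans with (2 := proj1 Hz); apply Rmin_glb_lt; assumption.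
Qed.

(** [Gamma] is a total function, whose value alone says nothing about convergence. The relation
    carries convergence, so the recurrence can pass it on from [x] to [x + 1]. *)
Definition is_Gamma (x l : R) : Prop :=
  is_RInt_gen (fun u => Rpower u (x - 1) * exp (- u)) (at_right 0) (Rbar_locally p_infty) l.

Lemma is_Gamma_unique (x l : R) : is_Gamma x l -> Gamma x = l.
Proof.
intros H; unfold Gamma.
apply (is_RInt_gen_unique (V := R_CompleteNormedModule)), H.
Qed.

Lemma continuous_at_right (f : R -> R) (x : R) :
  continuous f x -> filterlim f (at_right x) (locally (f x)).
Proof. intros H; exact (filterlim_filter_le_1 f (filter_le_within (F := locally x) (fun u => x < u)) H). Qed.

Lemma Gamma_weight_lim_0 (x : R) :
  0 < x -> filterlim (fun u => Rpower u x * exp (- u)) (at_right 0) (locally 0).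
Proof.
intros Hx; replace 0 with (0 * exp (- 0)) at 2 by ring.
apply (filterlim_comp_2 (G := locally 0) (H := locally (exp (- 0))))
  with (f := fun u => Rpower u x) (g := fun u => exp (- u)) (h := Rmult).
- apply (filterlim_comp _ _ _ ln (fun y => exp (x * y)) _ (Rbar_locally m_infty));
    [apply is_lim_ln_0 |].
  apply (is_lim_comp exp (fun y => x * y) m_infty 0 m_infty);
    [apply is_lim_exp_m | | exists 0; discriminate].
  replace m_infty with (Rbar_mult x m_infty) at 2.
  + apply is_lim_scal_l, is_lim_id.
  + apply is_Rbar_mult_unique, is_Rbar_mult_sym, is_Rbar_mult_m_infty_pos, Hx.
- apply (continuous_at_right (fun u => exp (- u))), (ex_derive_continuous (V := R_NormedModule)).
  auto_derive; trivial.
- apply (filterlim_mult (K := R_AbsRing)).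
Qed.

Lemma Gamma_weight_lim_infty (x : R) :
  filterlim (fun u => Rpower u x * exp (- u)) (Rbar_locally p_infty) (locally 0).
Proof.
(* The exponent [x ln u - u] is factored as [u (x ln u / u - 1)]; the second factor tends to -1. *)
apply (is_lim_ext_loc (fun u => exp (u * (x * (ln u / u) - 1)))  _ p_infty 0).
- exists 0; intros u Hu; unfold Rpower; rewrite <- exp_plus; f_equal; field; lra.
- apply (is_lim_comp exp (fun u => u * (x * (ln u / u) - 1)) p_infty 0 m_infty);
    [apply is_lim_exp_m | | exists 0; discriminate].
  replace m_infty with (Rbar_mult p_infty (-1)).
  + apply is_lim_mult; [apply is_lim_id | | simpl; lra].
    replace (-1) with (x * 0 - 1) by ring.
    apply (is_lim_minus' (fun u => x * (ln u / u)) (fun _ => 1)); [| apply is_lim_const].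
    apply (is_lim_scal_l _ x p_infty 0), is_lim_div_ln_p.
  + apply is_Rbar_mult_unique, is_Rbar_mult_p_infty_neg; simpl; lra.
Qed.

Lemma Gamma_integrand_continuous (x u : R) :
  0 < u -> continuous (fun u => Rpower u x * exp (- u)) u.
Proof.
intros Hu; apply (ex_derive_continuous (V := R_NormedModule)); unfold Rpower; auto_derive.
exact Hu.
Qed.

(** Integration by parts in additive form: the difference of the integrands of Gamma at [x + 1] and
    of [x] times Gamma at [x] is the derivative of [- u^x exp (- u)], which vanishes at both
    ends. *)
Lemma is_Gamma_succ (x l : R) : 0 < x -> is_Gamma x l -> is_Gamma (x + 1) (x * l).
Proof.
intros Hx H.
assert (H0 : is_RInt_gen (fun u => Rpower u x * exp (- u) - x * (Rpower u (x - 1) * exp (- u)))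
               (at_right 0) (Rbar_locally p_infty) (- 0 - - 0)).
{ apply (is_RInt_gen_antiderivative _ (fun u => - (Rpower u x * exp (- u)))).
  - intros u Hu; unfold Rpower; auto_derive; [exact Hu |].
    replace ((x - 1) * ln u) with (x * ln u + - ln u) by ring.
    rewrite (exp_plus (x * ln u)), (exp_Ropp (ln u)), (exp_ln u) by exact Hu; field; lra.
  - intros u Hu.
    apply (continuous_minus (V := R_NormedModule)); [apply Gamma_integrand_continuous, Hu |].
    apply (continuous_scal_r (V := R_NormedModule) x), Gamma_integrand_continuous, Hu.
  - apply (filterlim_comp _ _ _ _ Ropp _ (locally 0)); [apply Gamma_weight_lim_0, Hx |].
    apply (filterlim_opp (V := R_NormedModule) 0).
  - apply (filterlim_comp _ _ _ _ Ropp _ (locally 0)); [apply Gamma_weight_lim_infty |].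
    apply (filterlim_opp (V := R_NormedModule) 0). }
unfold is_Gamma; replace (x + 1 - 1) with x by ring.
apply (is_RInt_gen_scal (V := R_NormedModule) _ x) in H.
replace (x * l) with (plus (- 0 - - 0) (scal x l))
  by (unfold plus, scal; simpl; unfold mult; simpl; ring).
generalize (is_RInt_gen_plus (V := R_NormedModule) _ _ _ _ H0 H).
apply is_RInt_gen_ext, filter_forall; intros ab u _.
unfold plus, scal; simpl; unfold mult; simpl; ring.
Qed.

Lemma is_Gamma_1 : is_Gamma 1 1.
Proof.
assert (E : - 0 - - exp (- 0) = 1) by (rewrite Ropp_0, exp_0; ring).
apply (eq_ind _ (is_Gamma 1)) with (2 := E).
apply (is_RInt_gen_antiderivative _ (fun u => - exp (- u))).
- intros u Hu; unfold Rpower; replace ((1 - 1) * ln u) with 0 by ring; rewrite exp_0.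
  auto_derive; [trivial | ring].
- intros; apply Gamma_integrand_continuous; assumption.
- apply (continuous_at_right (fun u => - exp (- u))), (ex_derive_continuous (V := R_NormedModule)).
  auto_derive; trivial.
- apply (filterlim_comp _ _ _ (fun u => exp (- u)) Ropp _ (locally 0)); [| apply (filterlim_opp (V := R_NormedModule) 0)].
  apply (filterlim_ext_loc (fun u => Rpower u 0 * exp (- u))); [| apply Gamma_weight_lim_infty].
  exists 0; intros u Hu; rewrite Rpower_O by exact Hu; ring.
Qed.

Lemma is_Gamma_half : is_Gamma (1 / 2) (sqrt PI).
Proof.
(* The lower limit is written as a value of the antiderivative at 0, so that it follows from
   continuity. *)
unfold is_Gamma; replace (sqrt PI) with (2 * (sqrt PI / 2) - 2 * gauss (sqrt 0)).
2:{ rewrite sqrt_0; unfold gauss; rewrite (RInt_point (V := R_CompleteNormedModule)).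
    unfold zero; simpl; field. }
apply (is_RInt_gen_antiderivative _ (fun u => 2 * gauss (sqrt u))).
- intros u Hu.
  assert (Hs := sqrt_lt_R0 u Hu).
  replace (Rpower u (1 / 2 - 1) * exp (- u)) with (2 * (/ (2 * sqrt u) * exp (- sqrt u ^ 2))).
  + apply (is_derive_scal (fun u => gauss (sqrt u))).
    apply (is_derive_comp (V := R_NormedModule) gauss sqrt); [apply gauss_derive |].
    apply is_derive_Reals, derivable_pt_lim_sqrt, Hu.
  + rewrite pow2_sqrt by lra.
    replace (1 / 2 - 1) with (- / 2) by field.
    rewrite Rpower_Ropp, Rpower_sqrt by exact Hu; field; lra.
- intros; apply Gamma_integrand_continuous; assumption.
- apply (continuous_at_right (fun u => 2 * gauss (sqrt u))).
  apply (continuous_scal_r (V := R_NormedModule) 2 (fun u => gauss (sqrt u))).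
  apply (continuous_comp sqrt gauss).
  + apply continuity_pt_filterlim, continuity_pt_sqrt; lra.
  + apply (ex_derive_continuous (V := R_NormedModule)); eexists; apply gauss_derive.
- apply (is_lim_scal_l (fun u => gauss (sqrt u)) 2 p_infty (sqrt PI / 2)).
  apply (filterlim_comp _ _ _ sqrt gauss _ (Rbar_locally' p_infty)); [apply filterlim_sqrt_p |].
  apply gauss_lim.
Qed.

(** The Pochhammer symbol of 1/2, that is Gamma at [a + 1/2] divided by [sqrt PI]. *)
Fixpoint half_poch (a : nat) : R :=
  match a with O => 1 | S a => half_poch a * (INR a + / 2) end.

Lemma is_Gamma_half_int (a : nat) : is_Gamma (INR a + 1 / 2) (sqrt PI * half_poch a).
Proof.
induction a as [| a IH].
- simpl; rewrite Rplus_0_l, Rmult_1_r; apply is_Gamma_half.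
- rewrite S_INR; replace (INR a + 1 + 1 / 2) with (INR a + 1 / 2 + 1) by ring.
  replace (sqrt PI * half_poch (S a)) with ((INR a + 1 / 2) * (sqrt PI * half_poch a))
    by (simpl; field).
  apply is_Gamma_succ; [pose proof (pos_INR a); lra | exact IH].
Qed.

Lemma is_Gamma_fact (n : nat) : is_Gamma (INR n + 1) (INR (fact n)).
Proof.
induction n as [| n IH].
- simpl; rewrite Rplus_0_l; apply is_Gamma_1.
- rewrite fact_simpl, mult_INR, S_INR.
  apply is_Gamma_succ; [pose proof (pos_INR n); lra | exact IH].
Qed.

(** * Wallis integrals and derivatives of Bessel functions *)

Lemma is_RInt_derive_R (f df : R -> R) (a b : R) :
  (forall x, is_derive f x (df x)) -> (forall x, continuous df x) ->
  RInt df a b = f b - f a.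
Proof.
intros H1 H2; apply (is_RInt_unique (V := R_CompleteNormedModule)).
apply (is_RInt_derive (V := R_CompleteNormedModule) f df); intros; [apply H1 | apply H2].
Qed.

Ltac real_eq := match goal with |- @eq _ ?a ?b => let H := fresh in enough (@eq R a b) as H by exact H end.

Ltac norm_abs := match goal with |- @norm _ _ ?x <= ?b => change (Rabs x <= b) end.

Ltac continuity_by_derive :=
  apply (ex_derive_continuous (V := R_NormedModule)); auto_derive; trivial.

Definition wallis (a b : nat) : R :=
  RInt (fun x => sin x ^ (2 * a) * cos x ^ (2 * b)) 0 PI.

Lemma ex_wallis (a b : nat) (u v : R) :
  ex_RInt (fun x => sin x ^ (2 * a) * cos x ^ (2 * b)) u v.
Proof. apply ex_RInt_continuous_all; intros x; continuity_by_derive. Qed.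

Lemma wallis_split (a b : nat) : wallis (S a) b + wallis a (S b) = wallis a b.
Proof.
unfold wallis.
rewrite <- (RInt_plus (V := R_CompleteNormedModule)) by apply ex_wallis.
apply RInt_ext; intros x _.
replace (2 * S a)%nat with (2 * a + 2)%nat by ring.
replace (2 * S b)%nat with (2 * b + 2)%nat by ring.
rewrite !pow_add; pose proof (sin2_cos2 x) as H; unfold Rsqr in H.
unfold plus; simpl; real_eq.
transitivity (sin x ^ (a + (a + 0)) * cos x ^ (b + (b + 0)) * (sin x * sin x + cos x * cos x));
  [ring | rewrite H; apply Rmult_1_r].
Qed.

(** The difference of the two sides is the integral of the derivative of [sin^(2a+1) cos^(2b+1)],
    which vanishes at 0 and at [PI]. *)
Lemma wallis_parts (a b : nat) :
  (2 * INR a + 1) * wallis a (S b) = (2 * INR b + 1) * wallis (S a) b.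
Proof.
assert (H : RInt (fun x => (2 * INR a + 1) * (sin x ^ (2 * a) * cos x ^ (2 * S b))
                           - (2 * INR b + 1) * (sin x ^ (2 * S a) * cos x ^ (2 * b))) 0 PI = 0).
{ rewrite (is_RInt_derive_R (fun x => sin x ^ (2 * a + 1) * cos x ^ (2 * b + 1))).
  - rewrite sin_PI, sin_0, !pow_i by lia; real_eq; ring.
  - intros x; auto_derive; [trivial |].
    replace (Init.Nat.pred (a + (a + 0) + 1)) with (2 * a)%nat by lia.
    replace (Init.Nat.pred (b + (b + 0) + 1)) with (2 * b)%nat by lia.
    replace (a + (a + 0) + 1)%nat with (2 * a + 1)%nat by ring.
    replace (b + (b + 0) + 1)%nat with (2 * b + 1)%nat by ring.
    replace (2 * S a)%nat with (2 * a + 2)%nat by ring.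
    replace (2 * S b)%nat with (2 * b + 2)%nat by ring.
    rewrite !plus_INR, !mult_INR, !pow_add; simpl (INR 2); simpl (INR 1); real_eq.
    generalize (sin x ^ (2 * a)) (cos x ^ (2 * b)); intros u v; ring.
  - intros x; continuity_by_derive. }
rewrite (RInt_minus (V := R_CompleteNormedModule)) in H.
- rewrite !(RInt_scal (V := R_CompleteNormedModule)) in H by apply ex_wallis.
  unfold minus, plus, opp, scal in H; simpl in H; unfold mult in H; simpl in H.
  unfold wallis; simpl; lra.
- apply (ex_RInt_scal (V := R_NormedModule)), ex_wallis.
- apply (ex_RInt_scal (V := R_NormedModule)), ex_wallis.
Qed.

(** [wallis_split] and [wallis_parts] are two linear equations for [wallis (S a) b] and
    [wallis a (S b)]; solving them gives one recurrence in each index. This is a Beta integral, and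
    its denominator is the second factorial of a Bessel coefficient. *)
Lemma wallis_formula (a b : nat) :
  wallis a b = PI * half_poch a * half_poch b / INR (fact (a + b)).
Proof.
assert (Hb : forall a b, (INR a + INR b + 1) * wallis a (S b) = (INR b + / 2) * wallis a b).
{ intros a' b'; pose proof (wallis_split a' b'); pose proof (wallis_parts a' b'); nra. }
assert (Ha : forall a b, (INR a + INR b + 1) * wallis (S a) b = (INR a + / 2) * wallis a b).
{ intros a' b'; pose proof (wallis_split a' b'); pose proof (wallis_parts a' b'); nra. }
assert (H0 : wallis 0 0 = PI).
{ unfold wallis; simpl.
  rewrite (RInt_ext (V := R_CompleteNormedModule) _ (fun _ => 1)) by (intros; apply Rmult_1_r).
  rewrite (RInt_const (V := R_CompleteNormedModule)); unfold scal; simpl; unfold mult; simpl; ring. }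
assert (Hf : forall n, INR (fact n) <> 0) by (intros; apply INR_fact_neq_0).
assert (HS : forall n, INR n + 1 <> 0) by (intros n; pose proof (pos_INR n); lra).
induction a as [| a IHa].
- induction b as [| b IHb]; [rewrite H0; simpl; field |].
  specialize (Hb 0%nat b); rewrite IHb in Hb.
  apply Rmult_eq_reg_l with (INR 0 + INR b + 1); [rewrite Hb | simpl; rewrite Rplus_0_l; apply HS].
  change (0 + S b)%nat with (S b); change (0 + b)%nat with b.
  rewrite fact_simpl, mult_INR, S_INR; cbn [half_poch]; change (INR 0) with 0.
  field; auto.
- specialize (Ha a b); rewrite IHa in Ha.
  pose proof (pos_INR a); pose proof (pos_INR b).
  apply Rmult_eq_reg_l with (INR a + INR b + 1); [rewrite Ha | lra].
  change (S a + b)%nat with (S (a + b)).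
  rewrite fact_simpl, mult_INR, S_INR, plus_INR; cbn [half_poch].
  field; split; [apply Hf | lra].
Qed.

Lemma half_poch_pos (a : nat) : 0 < half_poch a.
Proof.
induction a as [| a IH]; simpl; [lra |].
apply Rmult_lt_0_compat; [exact IH | pose proof (pos_INR a); lra].
Qed.

(** The duplication formula. It merges the [4^k], [k!] and [half_poch k] in the denominator of a
    differentiated Bessel term into the [(2k)!] of the hyperbolic cosine. *)
Lemma fact_double (k : nat) : INR (fact (2 * k)) = 4 ^ k * INR (fact k) * half_poch k.
Proof.
induction k as [| k IH]; [simpl; ring |].
replace (2 * S k)%nat with (S (S (2 * k))) by ring.
rewrite !fact_simpl, !mult_INR, IH, !S_INR, mult_INR; simpl half_poch; simpl pow; simpl (INR 2).
field.
Qed.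

(** * Exponential and hyperbolic cosine series *)

Lemma is_series_exp (x : R) : is_series (fun n => x ^ n / INR (fact n)) (exp x).
Proof.
apply (is_series_ext (fun n => / INR (fact n) * x ^ n)); [intros; apply Rmult_comm |].
apply is_pseries_R, is_exp_Reals.
Qed.

Lemma ex_series_exp (x : R) : ex_series (fun n => x ^ n / INR (fact n)).
Proof. exists (exp x); apply is_series_exp. Qed.

Lemma pow_div_fact_le_exp (x : R) (n : nat) : 0 <= x -> x ^ n / INR (fact n) <= exp x.
Proof.
intros Hx.
assert (Hp : forall k, 0 <= x ^ k / INR (fact k)).
{ intros k; apply Rmult_le_pos; [apply pow_le, Hx | apply Rlt_le, Rinv_0_lt_compat, INR_fact_lt_0]. }
apply Rle_trans with (sum_n (fun k => x ^ k / INR (fact k)) n).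
- destruct n as [| n]; [rewrite sum_O; lra |].
  rewrite sum_Sn; unfold plus; simpl.
  enough (0 <= sum_n (fun k => x ^ k / INR (fact k)) n) by (simpl in *; lra).
  induction n as [| n IH]; [rewrite sum_O; apply Hp |].
  rewrite sum_Sn; unfold plus; simpl; pose proof (Hp (S n)); simpl in *; lra.
- apply (is_lim_seq_incr_compare (sum_n (fun k => x ^ k / INR (fact k)))).
  + apply is_series_exp.
  + intros k; rewrite sum_Sn; unfold plus; simpl; pose proof (Hp (S k)); simpl in *; lra.
Qed.

Lemma fact_double_ge (k : nat) : INR (fact k) <= INR (fact (2 * k)).
Proof. apply le_INR, fact_le; lia. Qed.

Lemma ex_series_cosh (x : R) : ex_series (fun k => x ^ (2 * k) / INR (fact (2 * k))).
Proof.
apply (ex_series_le (K := R_AbsRing) (V := R_CompleteNormedModule)) with (2 := ex_series_exp (x ^ 2)).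
intros k; norm_abs.
rewrite pow_mult.
pose proof (pow_le (x ^ 2) k (pow2_ge_0 x)) as H.
pose proof (INR_fact_lt_0 k); pose proof (fact_double_ge k).
rewrite Rabs_pos_eq.
- apply Rmult_le_compat_l; [exact H | apply Rinv_le_contravar; lra].
- apply Rmult_le_pos; [exact H | apply Rlt_le, Rinv_0_lt_compat; lra].
Qed.

Lemma is_series_cosh (x : R) : is_series (fun k => x ^ (2 * k) / INR (fact (2 * k))) (cosh x).
Proof.
set (e := fun k => / INR (fact (2 * k))); set (o := fun k => / INR (fact (2 * k + 1))).
assert (He : ex_series (fun k => e k * (x ^ 2) ^ k)).
{ apply (ex_series_ext (fun k => x ^ (2 * k) / INR (fact (2 * k)))); [| apply ex_series_cosh].
  intros k; unfold e; rewrite pow_mult; apply Rmult_comm. }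
assert (Ho : ex_series (fun k => o k * (x ^ 2) ^ k)).
{ apply (ex_series_le (K := R_AbsRing) (V := R_CompleteNormedModule)) with (2 := He).
  intros k; norm_abs.
  pose proof (pow_le (x ^ 2) k (pow2_ge_0 x)) as H.
  pose proof (INR_fact_lt_0 (2 * k)); pose proof (INR_fact_lt_0 (2 * k + 1)).
  rewrite Rabs_pos_eq.
  - apply Rmult_le_compat_r; [exact H |]; apply Rinv_le_contravar; [lra | apply le_INR, fact_le; lia].
  - apply Rmult_le_pos; [apply Rlt_le, Rinv_0_lt_compat; lra | exact H]. }
destruct He as [E HE]; destruct Ho as [O HO]; simpl in E, O.
(* The even and odd parts [E] and [O] depend on [y] only through [y^2]; averaging over [x] and [- x]
   therefore leaves [E]. *)
assert (K : forall y, y ^ 2 = x ^ 2 -> exp y = E + y * O).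
{ intros y Hy; rewrite exp_Reals; apply is_pseries_unique.
  apply (is_pseries_odd_even (fun n => / INR (fact n))); apply is_pseries_R; rewrite Hy; assumption. }
unfold cosh; rewrite (K x), (K (- x)) by ring.
replace ((E + x * O + (E + - x * O)) / 2) with E by field.
apply (is_series_ext (fun k => e k * (x ^ 2) ^ k)); [| exact HE].
intros k; unfold e; rewrite pow_mult; apply Rmult_comm.
Qed.

(** * Power series in [s^2] under the operator [(1/s) d/ds] *)

Lemma CV_radius_infinite (a : nat -> R) :
  (forall r, exists M, forall n, Rabs (a n * r ^ n) <= M) -> CV_radius a = p_infty.
Proof.
intros H; destruct (CV_radius_bounded a) as [Hub _].
destruct (CV_radius a) as [c | |] eqn:E; [| reflexivity |].
- specialize (Hub (c + 1) (H _)); simpl in Hub; lra.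
- specialize (Hub 0 (H _)); simpl in Hub; contradiction.
Qed.

(* [(1/s) d/ds] maps [sum_k b_k s^(2k-1)] to [sum_k (2k+1) b_(k+1) s^(2k-1)] when
   [b_0 = 0]; the term [b_0 / s] would leave this shape. *)
Definition PS_tinv_deriv (b : nat -> R) (k : nat) : R := (2 * INR k + 1) * b (S k).

Lemma PS_tinv_deriv_eq (b : nat -> R) (k : nat) :
  PS_tinv_deriv b k = PS_plus (PS_scal 2 (PS_derive b)) (PS_scal (-1) (PS_decr_1 b)) k.
Proof.
change ((2 * INR k + 1) * b (S k) = 2 * (INR (S k) * b (S k)) + -1 * b (S k)).
rewrite S_INR; ring.
Qed.

Lemma CV_radius_PS_tinv_deriv (b : nat -> R) :
  CV_radius b = p_infty -> CV_radius (PS_tinv_deriv b) = p_infty.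
Proof.
intros H.
rewrite (CV_radius_ext _ (PS_plus (PS_scal 2 (PS_derive b)) (PS_scal (-1) (PS_decr_1 b)))).
- pose proof (CV_radius_plus (PS_scal 2 (PS_derive b)) (PS_scal (-1) (PS_decr_1 b))) as K.
  rewrite !CV_radius_scal, CV_radius_derive, CV_radius_decr_1, H in K by lra.
  destruct (CV_radius (PS_plus _ _)); simpl in K; [contradiction | reflexivity | contradiction].
- apply PS_tinv_deriv_eq.
Qed.

(** If [f] is the sum of [b], the derivative of [f(s^2) / s] is [2 f'(s^2) - f(s^2) / s^2]. The
    condition [b 0 = 0] makes the last quotient a power series again, namely that of
    [PS_decr_1 b]. *)
Lemma PSeries_tinv_deriv (b : nat -> R) (h : R -> R) (t : R) :
  CV_radius b = p_infty -> b 0%nat = 0 ->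
  (forall s, 0 < s -> h s = / s * PSeries b (s ^ 2)) -> 0 < t ->
  / t * Derive h t = / t * PSeries (PS_tinv_deriv b) (t ^ 2).
Proof.
intros HR Hb Hh Ht; f_equal.
assert (Hin : forall x a, CV_radius a = p_infty -> Rbar_lt (Rabs x) (CV_radius a))
  by (intros x a ->; exact I).
rewrite (Derive_ext_loc h (fun s => / s * PSeries b (s ^ 2))).
2:{ exists (mkposreal t Ht); intros s Hs; apply Hh.
    unfold ball in Hs; simpl in Hs; unfold AbsRing_ball, abs, minus, plus, opp in Hs; simpl in Hs.
    apply Rabs_def2 in Hs; lra. }
apply is_derive_unique.
apply (is_derive_eq _ _ (- / t ^ 2 * PSeries b (t ^ 2) + / t * (2 * t * PSeries (PS_derive b) (t ^ 2)))).
- apply (is_derive_eq _ _ (plus (mult (- / t ^ 2) (PSeries b (t ^ 2)))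
          (mult (/ t) (scal (2 * t) (PSeries (PS_derive b) (t ^ 2)))))); [| reflexivity].
  apply (is_derive_mult (K := R_AbsRing) Rinv (fun s => PSeries b (s ^ 2))).
  + auto_derive; [lra | field; lra].
  + apply (is_derive_comp (V := R_NormedModule) (PSeries b) (fun s => s ^ 2)).
    * apply is_derive_PSeries, Hin, HR.
    * auto_derive; [trivial | ring].
  + intros; apply Rmult_comm.
- rewrite (PSeries_decr_1_aux b _ Hb).
  transitivity (PSeries (PS_plus (PS_scal 2 (PS_derive b)) (PS_scal (-1) (PS_decr_1 b))) (t ^ 2)).
  + rewrite PSeries_plus, !PSeries_scal; [field; lra | |].
    * apply (ex_pseries_scal 2); [apply Rmult_comm |].
      apply CV_radius_inside, Hin; rewrite CV_radius_derive; exact HR.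
    * apply (ex_pseries_scal (-1)); [apply Rmult_comm |].
      apply CV_radius_inside, Hin; rewrite CV_radius_decr_1; exact HR.
  + symmetry; apply PSeries_ext, PS_tinv_deriv_eq.
Qed.

(** The factors [2k+1, 2k+3, ..., 2(k+n)-1] collected by the iteration are [2^n] times a quotient of
    Pochhammer symbols of 1/2. *)
Lemma iter_PS_tinv_deriv (b : nat -> R) (n k : nat) :
  Nat.iter n PS_tinv_deriv b k
  = 2 ^ n * half_poch (k + n) / half_poch k * b (k + n)%nat.
Proof.
revert k; induction n as [| n IH]; intros k.
- simpl; rewrite Nat.add_0_r; pose proof (half_poch_pos k); field; lra.
- simpl Nat.iter; unfold PS_tinv_deriv; rewrite IH.
  replace (k + S n)%nat with (S k + n)%nat by lia.
  pose proof (half_poch_pos k); pose proof (pos_INR k); simpl half_poch at 2; simpl pow.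
  field; split; lra.
Qed.

(** Each application of the operator uses up one vanishing coefficient: the leading coefficient of
    the [n]-th iterate is a multiple of [b n], so [p] applications need exactly [b 0, ..., b (p-1)]
    to vanish. *)
Lemma tinv_deriv_iter_PSeries (b : nat -> R) (p : nat) (h : R -> R) :
  CV_radius b = p_infty -> (forall j, (j < p)%nat -> b j = 0) ->
  (forall s, 0 < s -> h s = / s * PSeries b (s ^ 2)) ->
  forall t, 0 < t ->
  tinv_deriv_iter p h t = / t * PSeries (Nat.iter p PS_tinv_deriv b) (t ^ 2).
Proof.
intros HR Hb Hh.
assert (Hn : forall n, (n <= p)%nat ->
   CV_radius (Nat.iter n PS_tinv_deriv b) = p_infty /\
   forall t, 0 < t ->
   tinv_deriv_iter n h t = / t * PSeries (Nat.iter n PS_tinv_deriv b) (t ^ 2)).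
{ induction n as [| n IH]; intros Hnp; [split; [exact HR | exact Hh] |].
  destruct (IH ltac:(lia)) as [IH1 IH2].
  split; [apply CV_radius_PS_tinv_deriv, IH1 |].
  intros t Ht; apply (PSeries_tinv_deriv (Nat.iter n PS_tinv_deriv b) _ t IH1);
    [| exact IH2 | exact Ht].
  rewrite iter_PS_tinv_deriv, Hb by lia; ring. }
apply Hn; lia.
Qed.

(** * Bessel functions of integer order and their integral representation *)

Lemma BesselI_nat (nu : nat) (s : R) :
  0 < s ->
  BesselI (INR nu) s
  = Series (fun k => (s / 2) ^ (2 * k + nu) / (INR (fact k) * INR (fact (k + nu)))).
Proof.
intros Hs; apply Series_ext; intros k.
rewrite <- Rpower_pow by lra; rewrite plus_INR, mult_INR.
replace (INR k + 1 + INR nu) with (INR (k + nu) + 1) by (rewrite plus_INR; ring).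
rewrite (is_Gamma_unique _ _ (is_Gamma_fact (k + nu))); reflexivity.
Qed.

Definition bessel_coef (nu k : nat) : R :=
  / (2 ^ (2 * k + nu) * INR (fact k) * INR (fact (k + nu))).

Lemma bessel_coef_bound (nu k : nat) : 0 < bessel_coef nu k <= / INR (fact k).
Proof.
pose proof (INR_fact_lt_0 k).
assert (1 <= INR (fact (k + nu))) by (apply (le_INR 1), lt_O_fact).
assert (1 <= 2 ^ (2 * k + nu)) by (apply pow_R1_Rle; lra).
assert (1 <= 2 ^ (2 * k + nu) * INR (fact (k + nu))) by nra.
unfold bessel_coef; split.
- apply Rinv_0_lt_compat; nra.
- apply Rinv_le_contravar; nra.
Qed.

Lemma PS_incr_n_eq (a : nat -> R) (p k : nat) : PS_incr_n a p (k + p) = a k.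
Proof.
rewrite PS_incr_n_simplify; destruct (le_lt_dec p (k + p)) as [H | H]; [f_equal; lia | lia].
Qed.

Lemma CV_radius_bessel (nu p : nat) : CV_radius (PS_incr_n (bessel_coef nu) p) = p_infty.
Proof.
apply CV_radius_infinite; intros r.
exists (Rabs r ^ p * exp (Rabs r)); intros n.
pose proof (Rabs_pos r); pose proof (exp_pos (Rabs r)); pose proof (pow_le (Rabs r) p (Rabs_pos r)).
rewrite Rabs_mult, <- RPow_abs, PS_incr_n_simplify.
destruct (le_lt_dec p n) as [Hn | Hn].
- destruct (bessel_coef_bound nu (n - p)) as [H3 H4].
  rewrite (Rabs_pos_eq (bessel_coef _ _)) by lra.
  replace n with (p + (n - p))%nat at 2 by lia.
  rewrite pow_add.
  pose proof (pow_div_fact_le_exp (Rabs r) (n - p) H).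
  pose proof (pow_le (Rabs r) (n - p) H).
  assert (bessel_coef nu (n - p) * Rabs r ^ (n - p) <= exp (Rabs r)) by (unfold Rdiv in *; nra).
  nra.
- unfold zero; simpl; rewrite Rabs_R0; nra.
Qed.

Definition bessel_integral (t : R) (a p : nat) : R :=
  RInt (fun x => sin x ^ (2 * a) * cos x ^ (2 * p) * cosh (t * cos x)) 0 PI.

Lemma pow_sin_cos_le_1 (a b : nat) (x : R) : Rabs (sin x ^ a * cos x ^ b) <= 1.
Proof.
rewrite Rabs_mult, <- !RPow_abs.
assert (H : forall y n, -1 <= y <= 1 -> 0 <= Rabs y ^ n <= 1).
{ intros y n Hy; split; [apply pow_le, Rabs_pos |].
  rewrite <- (pow1 n); apply pow_incr; split; [apply Rabs_pos | apply Rabs_le, Hy]. }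
pose proof (H _ a (SIN_bound x)); pose proof (H _ b (COS_bound x)); nra.
Qed.

Lemma is_series_bessel_integral (t : R) (a p : nat) :
  is_series (fun k => t ^ (2 * k) / INR (fact (2 * k)) * wallis a (p + k)) (bessel_integral t a p).
Proof.
apply (is_series_ext (fun k => RInt (fun x =>
   t ^ (2 * k) / INR (fact (2 * k)) * (sin x ^ (2 * a) * cos x ^ (2 * (p + k)))) 0 PI)).
{ intros k; apply (RInt_scal (V := R_CompleteNormedModule)), ex_wallis. }
apply is_series_RInt with (b := fun k => t ^ (2 * k) / INR (fact (2 * k))).
- pose proof PI_RGT_0; lra.
- intros k x _; rewrite Rabs_mult, Rabs_pos_eq.
  + rewrite <- (Rmult_1_r (t ^ _ / _)) at 2; apply Rmult_le_compat_l; [| apply pow_sin_cos_le_1].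
    apply Rmult_le_pos; [rewrite pow_mult; apply pow_le, pow2_ge_0
      | apply Rlt_le, Rinv_0_lt_compat, INR_fact_lt_0].
  + apply Rmult_le_pos; [rewrite pow_mult; apply pow_le, pow2_ge_0
      | apply Rlt_le, Rinv_0_lt_compat, INR_fact_lt_0].
- apply ex_series_cosh.
- intros k; apply ex_RInt_continuous_all; intros x; continuity_by_derive.
- apply ex_RInt_continuous_all; intros x; unfold cosh; continuity_by_derive.
- intros x _.
  apply (is_series_ext (fun k => sin x ^ (2 * a) * cos x ^ (2 * p) *
           ((t * cos x) ^ (2 * k) / INR (fact (2 * k))))).
  + intros k; rewrite Nat.mul_add_distr_l, pow_add, Rpow_mult_distr; unfold Rdiv; real_eq; ring.
  + apply is_series_Rmult_l, is_series_cosh.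
Qed.

(** The relation [a + 1 = p + q] makes [s^(-q) I_(a+p)(s)] equal to [1/s] times a series in [s^2]
    starting at [s^(2p)], so [p] applications are allowed. They produce
    [half_poch (k + p) / half_poch k], the Gamma factor produces [half_poch a], and with the
    remaining factorials these form [wallis a (p + k) / (2k)!]. Both double series of the theorem
    are instances. *)
Lemma Gamma_tinv_deriv_iter_BesselI (a p q : nat) (t : R) :
  (a + 1 = p + q)%nat -> 0 < t ->
  Gamma (INR a + 1 / 2)
    * tinv_deriv_iter p (fun s => / s ^ q * BesselI (INR (a + p)) s) t
  = / (t * sqrt PI) * / 2 ^ a * bessel_integral t a p.
Proof.
intros Haq Ht.
rewrite (tinv_deriv_iter_PSeries (PS_incr_n (bessel_coef (a + p)) p)); [| | | | exact Ht].
- rewrite (is_Gamma_unique _ _ (is_Gamma_half_int a)).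
  rewrite <- (is_series_unique _ _ (is_series_bessel_integral t a p)).
  unfold PSeries; rewrite <- !Series_scal_l; apply Series_ext; intros k.
  rewrite iter_PS_tinv_deriv, PS_incr_n_eq, wallis_formula, fact_double; unfold bessel_coef.
  rewrite (Nat.add_comm p k); replace (a + (k + p))%nat with (k + (a + p))%nat by lia.
  rewrite !pow_add, !pow_mult; replace (2 ^ 2) with 4 by ring.
  pose proof (half_poch_pos k); pose proof (INR_fact_lt_0 k); pose proof (INR_fact_lt_0 (k + (a + p))).
  assert (0 < 4 ^ k /\ 0 < 2 ^ a /\ 0 < 2 ^ p) as [H4 [Hpa Hpp]] by (repeat split; apply pow_lt; lra).
  assert (Hs := sqrt_lt_R0 _ PI_RGT_0).
  assert (Hpi := sqrt_sqrt PI (Rlt_le _ _ PI_RGT_0)).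
  set (r := sqrt PI) in *; rewrite <- Hpi.
  field; repeat split; lra.
- apply CV_radius_bessel.
- intros j Hj; rewrite PS_incr_n_simplify; destruct (le_lt_dec p j); [lia | reflexivity].
- intros s Hs; rewrite BesselI_nat by exact Hs.
  rewrite PSeries_incr_n; unfold PSeries; rewrite <- !Series_scal_l.
  apply Series_ext; intros k; unfold bessel_coef.
  (* The powers of [s] agree because [a + p + 1 = q + 2p]. *)
  assert (E : (s / 2) ^ (2 * k + (a + p)) * s = s ^ q * (s ^ 2) ^ p * (s ^ 2) ^ k * / 2 ^ (2 * k + (a + p))).
  { unfold Rdiv; rewrite Rpow_mult_distr, pow_inv, <- !pow_mult, <- !pow_add.
    replace (q + 2 * p + 2 * k)%nat with (2 * k + (a + p) + 1)%nat by lia.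
    rewrite (pow_add s _ 1); ring. }
  pose proof (INR_fact_lt_0 k); pose proof (INR_fact_lt_0 (k + (a + p))).
  assert (0 < 2 ^ (2 * k + (a + p)) /\ 0 < s ^ q) as [H4 H5] by (split; apply pow_lt; lra).
  apply Rmult_eq_reg_l with s; [| lra].
  transitivity ((s / 2) ^ (2 * k + (a + p)) * s * / s ^ q / (INR (fact k) * INR (fact (k + (a + p))))).
  + field; repeat split; lra.
  + rewrite E; field; repeat split; lra.
Qed.

(** * Summation of the two double series *)

Lemma cosh_bounds (t y : R) : -1 <= y <= 1 -> 0 <= cosh (t * y) <= exp (Rabs t).
Proof.
intros Hy; unfold cosh.
assert (H : forall u, u <= Rabs t -> exp u <= exp (Rabs t)).
{ intros u [Hu | ->]; [left; apply exp_increasing, Hu | right; reflexivity]. }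
assert (Hu : Rabs (t * y) <= Rabs t).
{ rewrite Rabs_mult; pose proof (Rabs_pos t); pose proof (Rabs_le y 1 Hy); nra. }
pose proof (H (t * y) (Rle_trans _ _ _ (Rle_abs _) Hu)).
pose proof (H (- (t * y))) as H1; rewrite <- Rabs_Ropp in Hu.
specialize (H1 (Rle_trans _ _ _ (Rle_abs _) Hu)).
pose proof (exp_pos (t * y)); pose proof (exp_pos (- (t * y))); lra.
Qed.

Lemma weight_bound (t x : R) (a b : nat) :
  Rabs (sin x ^ a * cos x ^ b * cosh (t * cos x)) <= exp (Rabs t).
Proof.
pose proof (cosh_bounds t _ (COS_bound x)) as H; pose proof (pow_sin_cos_le_1 a b x).
pose proof (Rabs_pos (sin x ^ a * cos x ^ b)).
rewrite Rabs_mult, (Rabs_pos_eq (cosh _)) by lra; nra.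
Qed.

(** The form in which all later interchanges are made: only [f] is summed, and the bounded weight
    [W] collects the factors that do not depend on the summation index. *)
Lemma is_series_weighted_RInt (f : nat -> R -> R) (b : nat -> R) (F W : R -> R) (M : R) :
  (forall x, Rabs (W x) <= M) -> (forall n x, Rabs (f n x) <= b n) -> ex_series b ->
  (forall n x, continuous (f n) x) -> (forall x, continuous F x) -> (forall x, continuous W x) ->
  (forall x, is_series (fun n => f n x) (F x)) ->
  is_series (fun n => RInt (fun x => f n x * W x) 0 PI) (RInt (fun x => F x * W x) 0 PI).
Proof.
intros HM Hb Hs Hf HF HW Hsum.
apply is_series_RInt with (b := fun n => b n * M).
- pose proof PI_RGT_0; lra.
- intros n x _; rewrite Rabs_mult.
  apply Rmult_le_compat; [apply Rabs_pos | apply Rabs_pos | apply Hb | apply HM].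
- apply ex_series_scal_r, Hs.
- intros n; apply ex_RInt_continuous_all; intros x.
  apply (continuous_mult (K := R_AbsRing) (f n) W); [apply Hf | apply HW].
- apply ex_RInt_continuous_all; intros x.
  apply (continuous_mult (K := R_AbsRing) F W); [apply HF | apply HW].
- intros x _; exact (is_series_scal_r (W x) _ _ (Hsum x)).
Qed.

Lemma ex_series_inv_fact : ex_series (fun n => / INR (fact n)).
Proof.
apply (ex_series_ext (fun n => 1 ^ n / INR (fact n))); [| apply ex_series_exp].
intros n; rewrite pow1; real_eq; unfold Rdiv; ring.
Qed.

Lemma inv_fact_pos (n : nat) : 0 < / INR (fact n).
Proof. apply Rinv_0_lt_compat, INR_fact_lt_0. Qed.

Lemma sin_sq_pow (x : R) (n : nat) : 0 <= (sin x ^ 2) ^ n <= 1.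
Proof.
pose proof (SIN_bound x); split; [apply pow_le, pow2_ge_0 |].
rewrite <- (pow1 n); apply pow_incr; nra.
Qed.

(** What the sum over [r] leaves. The exponents are the full powers here, whereas [bessel_integral]
    doubles its arguments. *)
Definition exp_integral (t : R) (a b : nat) : R :=
  RInt (fun x => exp (sin x ^ 2) * (sin x ^ a * cos x ^ b * cosh (t * cos x))) 0 PI.

Lemma is_series_exp_integral (t : R) (a p : nat) :
  is_series (fun r => / INR (fact r) * bessel_integral t (a + r) p)
            (exp_integral t (2 * a) (2 * p)).
Proof.
apply (is_series_ext (fun r => RInt (fun x => (sin x ^ 2) ^ r / INR (fact r)
         * (sin x ^ (2 * a) * cos x ^ (2 * p) * cosh (t * cos x))) 0 PI)).
{ intros r; unfold bessel_integral.
  rewrite <- (RInt_scal (V := R_CompleteNormedModule)).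
  - apply RInt_ext; intros x _; rewrite Nat.mul_add_distr_l, pow_add, (pow_mult _ 2 r).
    unfold scal; simpl; unfold mult; simpl; real_eq; unfold Rdiv; ring.
  - apply ex_RInt_continuous_all; intros x; unfold cosh; continuity_by_derive. }
apply is_series_weighted_RInt with (b := fun r => / INR (fact r)) (M := exp (Rabs t)).
- intros x; apply weight_bound.
- intros r x; pose proof (sin_sq_pow x r); pose proof (inv_fact_pos r).
  unfold Rdiv; rewrite Rabs_pos_eq by nra; nra.
- apply ex_series_inv_fact.
- intros r x; continuity_by_derive.
- intros x; continuity_by_derive.
- intros x; unfold cosh; continuity_by_derive.
- intros x; apply is_series_exp.
Qed.

Lemma is_series_cos (x : R) : is_series (fun n => (-1) ^ n / INR (fact (2 * n)) * x ^ (2 * n)) (cos x).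
Proof.
unfold cos; destruct (exist_cos (Rsqr x)) as [l H]; apply is_series_Reals in H.
apply (is_series_ext _ _ _) with (2 := H); intros n.
unfold cos_n; rewrite Rsqr_pow2, pow_mult; reflexivity.
Qed.

Lemma is_series_sin (x : R) :
  is_series (fun n => (-1) ^ n / INR (fact (2 * n + 1)) * x ^ (2 * n + 1)) (sin x).
Proof.
unfold sin; destruct (exist_sin (Rsqr x)) as [l H]; apply is_series_Reals in H.
apply (is_series_ext (fun n => x * (sin_n n * Rsqr x ^ n))).
- intros n; unfold sin_n; rewrite Rsqr_pow2, pow_add, pow_mult; simpl (x ^ 1); real_eq; ring.
- apply is_series_Rmult_l, H.
Qed.

(** Weakening [1/m!] to [1/n!] gives the cosine series ([m = 2n]) and the sine series ([m = 2n+1])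
    the same summable majorant. *)
Lemma Rabs_trig_term (x : R) (n m : nat) :
  (n <= m)%nat -> Rabs ((-1) ^ n / INR (fact m) * (sin x * cos x) ^ m) <= / INR (fact n).
Proof.
intros Hnm; rewrite Rabs_mult; unfold Rdiv; rewrite Rabs_mult, pow_1_abs, Rmult_1_l.
pose proof (inv_fact_pos m).
rewrite Rpow_mult_distr, (Rabs_pos_eq (/ _)) by lra.
pose proof (pow_sin_cos_le_1 m m x); pose proof (Rabs_pos (sin x ^ m * cos x ^ m)).
apply Rle_trans with (/ INR (fact m)); [nra |].
apply Rinv_le_contravar; [apply INR_fact_lt_0 | apply le_INR, fact_le, Hnm].
Qed.

(** The exponents [2(n+1)] and [2n] differ by two, so a factor [sin^2] stays outside
    [(sin x cos x)^(2n)]. In the sine series both exponents are [2(n+1)], and a factor [sin x cos x]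
    stays outside [(sin x cos x)^(2n+1)]. *)
Lemma is_series_outer_cos (t : R) :
  is_series (fun n => (-1) ^ n / INR (fact (2 * n)) * exp_integral t (2 * (n + 1)) (2 * n))
    (RInt (fun x => cos (sin x * cos x) * (sin x ^ 2 * exp (sin x ^ 2) * cosh (t * cos x))) 0 PI).
Proof.
apply (is_series_ext (fun n => RInt (fun x => (-1) ^ n / INR (fact (2 * n)) * (sin x * cos x) ^ (2 * n)
         * (sin x ^ 2 * exp (sin x ^ 2) * cosh (t * cos x))) 0 PI)).
{ intros n; unfold exp_integral.
  rewrite <- (RInt_scal (V := R_CompleteNormedModule)).
  - apply RInt_ext; intros x _; rewrite Nat.mul_add_distr_l, pow_add, Rpow_mult_distr.
    change (2 * 1)%nat with 2%nat.
    unfold scal; simpl; unfold mult; simpl; real_eq; unfold Rdiv; ring.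
  - apply ex_RInt_continuous_all; intros x; unfold cosh; continuity_by_derive. }
apply is_series_weighted_RInt with (b := fun r => / INR (fact r)) (M := exp 1 * exp (Rabs t)).
- intros x; replace (sin x ^ 2 * exp (sin x ^ 2) * cosh (t * cos x))
    with (exp (sin x ^ 2) * (sin x ^ 2 * cos x ^ 0 * cosh (t * cos x))) by (simpl; ring).
  rewrite Rabs_mult; apply Rmult_le_compat; [apply Rabs_pos | apply Rabs_pos | | apply weight_bound].
  rewrite Rabs_pos_eq by (apply Rlt_le, exp_pos).
  pose proof (sin_sq_pow x 1) as [_ [H | H]]; rewrite pow_1 in H;
    [left; apply exp_increasing, H | right; f_equal; exact H].
- intros n x; apply Rabs_trig_term; lia.
- apply ex_series_inv_fact.
- intros r x; continuity_by_derive.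
- intros x; continuity_by_derive.
- intros x; unfold cosh; continuity_by_derive.
- intros x; apply is_series_cos.
Qed.

Lemma is_series_outer_sin (t : R) :
  is_series (fun n => (-1) ^ n / INR (fact (2 * n + 1)) * exp_integral t (2 * (n + 1)) (2 * (n + 1)))
    (RInt (fun x => sin (sin x * cos x) * (sin x * cos x * exp (sin x ^ 2) * cosh (t * cos x))) 0 PI).
Proof.
apply (is_series_ext (fun n => RInt (fun x => (-1) ^ n / INR (fact (2 * n + 1)) * (sin x * cos x) ^ (2 * n + 1)
         * (sin x * cos x * exp (sin x ^ 2) * cosh (t * cos x))) 0 PI)).
{ intros n; unfold exp_integral.
  rewrite <- (RInt_scal (V := R_CompleteNormedModule)).
  - apply RInt_ext; intros x _.
    replace (2 * (n + 1))%nat with ((2 * n + 1) + 1)%nat by ring.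
    rewrite !(pow_add _ (2 * n + 1) 1), Rpow_mult_distr, !pow_1.
    generalize (2 * n + 1)%nat; intros m.
    unfold scal; simpl; unfold mult; simpl; real_eq; unfold Rdiv; ring.
  - apply ex_RInt_continuous_all; intros x; unfold cosh; continuity_by_derive. }
apply is_series_weighted_RInt with (b := fun r => / INR (fact r)) (M := exp 1 * exp (Rabs t)).
- intros x; replace (sin x * cos x * exp (sin x ^ 2) * cosh (t * cos x))
    with (exp (sin x ^ 2) * (sin x ^ 1 * cos x ^ 1 * cosh (t * cos x))) by (simpl; ring).
  rewrite Rabs_mult; apply Rmult_le_compat; [apply Rabs_pos | apply Rabs_pos | | apply weight_bound].
  rewrite Rabs_pos_eq by (apply Rlt_le, exp_pos).
  pose proof (sin_sq_pow x 1) as [_ [H | H]]; rewrite pow_1 in H;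
    [left; apply exp_increasing, H | right; f_equal; exact H].
- intros n x; apply Rabs_trig_term; lia.
- apply ex_series_inv_fact.
- intros r x; continuity_by_derive.
- intros x; continuity_by_derive.
- intros x; unfold cosh; continuity_by_derive.
- intros x; apply is_series_sin.
Qed.

(** The case [a = n + 1 + r], [p = n], [q = r + 2]. The [2^r] in [bcoef] cancels against [2^(-a)],
    so that only the plain weight [1/r!] depends on [r] outside the integral. *)
Lemma inner1_eq (t : R) (n r : nat) :
  0 < t ->
  inner1 t n r = / (2 * t * sqrt PI) * / 2 ^ n * (/ INR (fact r) * bessel_integral t (n + 1 + r) n).
Proof.
intros Ht; unfold inner1, bcoef.
replace (INR n + INR r + 3 / 2) with (INR (n + 1 + r) + 1 / 2)
  by (rewrite !plus_INR; simpl; field).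
replace (2 * n + r + 1)%nat with (n + 1 + r + n)%nat by ring.
pose proof (Gamma_tinv_deriv_iter_BesselI (n + 1 + r) n (r + 2) t ltac:(lia) Ht) as H.
transitivity (2 ^ r / INR (fact r) *
  (Gamma (INR (n + 1 + r) + 1 / 2)
    * tinv_deriv_iter n (fun s => / s ^ (r + 2) * BesselI (INR (n + 1 + r + n)) s) t)).
{ unfold Rdiv; ring. }
rewrite H, !pow_add, pow_1.
pose proof (INR_fact_lt_0 r); assert (Hs := sqrt_lt_R0 _ PI_RGT_0).
assert (0 < 2 ^ r /\ 0 < 2 ^ n) as [H1 H2] by (split; apply pow_lt; lra).
field; repeat split; lra.
Qed.

(** The case [p = n + 1], [q = r + 1] with the same [a]: one more derivative and one power of [1/t]
    less raise the exponent of the cosine by two. *)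
Lemma inner2_eq (t : R) (n r : nat) :
  0 < t ->
  inner2 t n r
  = / (2 * t * sqrt PI) * / 2 ^ n * (/ INR (fact r) * bessel_integral t (n + 1 + r) (n + 1)).
Proof.
intros Ht; unfold inner2, bcoef.
replace (INR n + INR r + 3 / 2) with (INR (n + 1 + r) + 1 / 2)
  by (rewrite !plus_INR; simpl; field).
replace (2 * n + r + 2)%nat with (n + 1 + r + (n + 1))%nat by ring.
pose proof (Gamma_tinv_deriv_iter_BesselI (n + 1 + r) (n + 1) (r + 1) t ltac:(lia) Ht) as H.
transitivity (2 ^ r / INR (fact r) *
  (Gamma (INR (n + 1 + r) + 1 / 2)
    * tinv_deriv_iter (n + 1) (fun s => / s ^ (r + 1) * BesselI (INR (n + 1 + r + (n + 1))) s) t)).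
{ unfold Rdiv; ring. }
rewrite H, !pow_add, pow_1.
pose proof (INR_fact_lt_0 r); assert (Hs := sqrt_lt_R0 _ PI_RGT_0).
assert (0 < 2 ^ r /\ 0 < 2 ^ n) as [H1 H2] by (split; apply pow_lt; lra).
field; repeat split; lra.
Qed.

Lemma is_series_inner1 (t : R) (n : nat) :
  0 < t ->
  is_series (inner1 t n) (/ (2 * t * sqrt PI) * / 2 ^ n * exp_integral t (2 * (n + 1)) (2 * n)).
Proof.
intros Ht; eapply is_series_ext; [intros r; symmetry; apply inner1_eq, Ht |].
apply is_series_Rmult_l, is_series_exp_integral.
Qed.

Lemma is_series_inner2 (t : R) (n : nat) :
  0 < t ->
  is_series (inner2 t n)
    (/ (2 * t * sqrt PI) * / 2 ^ n * exp_integral t (2 * (n + 1)) (2 * (n + 1))).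
Proof.
intros Ht; eapply is_series_ext; [intros r; symmetry; apply inner2_eq, Ht |].
apply is_series_Rmult_l, is_series_exp_integral.
Qed.

(** Isolates the [2^n] that cancels the [/ 2 ^ n] left by the inner sums; the alternating sign
    remains for the cosine and sine series. *)
Lemma pow_m2 (n : nat) : (-2) ^ n = (-1) ^ n * 2 ^ n.
Proof. rewrite <- Rpow_mult_distr; f_equal; ring. Qed.

Lemma is_series_outer1 (t : R) :
  0 < t ->
  is_series (outer1 t) (/ (2 * t * sqrt PI) *
    RInt (fun x => cos (sin x * cos x) * (sin x ^ 2 * exp (sin x ^ 2) * cosh (t * cos x))) 0 PI).
Proof.
intros Ht; apply (is_series_ext (fun n => / (2 * t * sqrt PI) *
  ((-1) ^ n / INR (fact (2 * n)) * exp_integral t (2 * (n + 1)) (2 * n)))).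
- intros n; unfold outer1; rewrite (is_series_unique _ _ (is_series_inner1 t n Ht)), pow_m2.
  pose proof (INR_fact_lt_0 (2 * n)); assert (Hs := sqrt_lt_R0 _ PI_RGT_0).
  assert (0 < 2 ^ n) by (apply pow_lt; lra).
  real_eq; field; repeat split; lra.
- apply is_series_Rmult_l, is_series_outer_cos.
Qed.

Lemma is_series_outer2 (t : R) :
  0 < t ->
  is_series (outer2 t) (/ (2 * t * sqrt PI) *
    RInt (fun x => sin (sin x * cos x) * (sin x * cos x * exp (sin x ^ 2) * cosh (t * cos x))) 0 PI).
Proof.
intros Ht; apply (is_series_ext (fun n => / (2 * t * sqrt PI) *
  ((-1) ^ n / INR (fact (2 * n + 1)) * exp_integral t (2 * (n + 1)) (2 * (n + 1))))).
- intros n; unfold outer2; rewrite (is_series_unique _ _ (is_series_inner2 t n Ht)), pow_m2.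
  pose proof (INR_fact_lt_0 (2 * n + 1)); assert (Hs := sqrt_lt_R0 _ PI_RGT_0).
  assert (0 < 2 ^ n) by (apply pow_lt; lra).
  real_eq; field; repeat split; lra.
- apply is_series_Rmult_l, is_series_outer_sin.
Qed.

(** Since [(1 - exp (2ix)) / 2 = sin^2 x - i sin x cos x], the jump is
    [exp (sin^2 x) sin (x - sin x cos x)], here expanded by the addition formula. *)
Definition jump (x : R) : R :=
  exp (sin x ^ 2) * (sin x * cos (sin x * cos x) - cos x * sin (sin x * cos x)).

Lemma outer_difference (t : R) :
  0 < t ->
  2 * t * exp (- t) / sqrt PI * (Series (outer1 t) - Series (outer2 t))
  = exp (- t) * (/ PI * RInt (fun x => sin x * jump x * cosh (t * cos x)) 0 PI).
Proof.
intros Ht.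
rewrite (is_series_unique _ _ (is_series_outer1 t Ht)), (is_series_unique _ _ (is_series_outer2 t Ht)).
rewrite <- Rmult_minus_distr_l.
replace (RInt _ 0 PI - RInt _ 0 PI) with (RInt (fun x => sin x * jump x * cosh (t * cos x)) 0 PI).
- assert (Hpi := sqrt_sqrt PI (Rlt_le _ _ PI_RGT_0)); assert (Hs := sqrt_lt_R0 _ PI_RGT_0).
  generalize (RInt (fun x => sin x * jump x * cosh (t * cos x)) 0 PI); intros I.
  set (r := sqrt PI) in *; rewrite <- Hpi; field; lra.
- symmetry; rewrite <- (RInt_minus (V := R_CompleteNormedModule)).
  + apply RInt_ext; intros x _; unfold jump, minus, plus, opp; simpl; real_eq; ring.
  + apply ex_RInt_continuous_all; intros x; unfold cosh; continuity_by_derive.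
  + apply ex_RInt_continuous_all; intros x; unfold cosh; continuity_by_derive.
Qed.

(** * Complex series and moments *)

Lemma norm_Cmod (z : C) : @norm R_AbsRing C_R_NormedModule z = Cmod z.
Proof.
change (sqrt (Rabs (fst z) ^ 2 + Rabs (snd z) ^ 2) = Cmod z).
rewrite !pow2_abs; reflexivity.
Qed.

Lemma filterlim_C {T : Type} {F : (T -> Prop) -> Prop} {FF : Filter F} (f : T -> C) (l : C) :
  filterlim (fun x => fst (f x)) F (locally (fst l)) ->
  filterlim (fun x => snd (f x)) F (locally (snd l)) ->
  filterlim f F (locally (T := C_R_NormedModule) l).
Proof.
intros H1 H2; apply filterlim_locally; intros eps.
generalize (filter_and _ _ (proj1 (filterlim_locally _ _) H1 eps) (proj1 (filterlim_locally _ _) H2 eps)).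
apply filter_imp; intros x [K1 K2]; split; assumption.
Qed.

Lemma filterlim_fst_C {T : Type} {F : (T -> Prop) -> Prop} {FF : Filter F} (f : T -> C) (l : C) :
  filterlim f F (locally (T := C_R_NormedModule) l) ->
  filterlim (fun x => fst (f x)) F (locally (fst l)).
Proof.
intros H; apply filterlim_locally; intros eps.
generalize (proj1 (filterlim_locally _ _) H eps).
apply filter_imp; intros x [K1 K2]; exact K1.
Qed.

Lemma filterlim_snd_C {T : Type} {F : (T -> Prop) -> Prop} {FF : Filter F} (f : T -> C) (l : C) :
  filterlim f F (locally (T := C_R_NormedModule) l) ->
  filterlim (fun x => snd (f x)) F (locally (snd l)).
Proof.
intros H; apply filterlim_locally; intros eps.
generalize (proj1 (filterlim_locally _ _) H eps).
apply filter_imp; intros x [K1 K2]; exact K2.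
Qed.

Lemma sum_n_C (f : nat -> C) (N : nat) :
  @sum_n C_R_NormedModule f N = (sum_n (fun n => fst (f n)) N, sum_n (fun n => snd (f n)) N).
Proof.
induction N as [| N IH]; [rewrite !sum_O; apply surjective_pairing |].
rewrite !sum_Sn, IH; reflexivity.
Qed.

Notation is_series_C := (@is_series R_AbsRing C_R_NormedModule).

Lemma is_series_C_pair (f : nat -> C) (l : C) :
  is_series (fun n => fst (f n)) (fst l) -> is_series (fun n => snd (f n)) (snd l) ->
  is_series_C f l.
Proof.
intros H1 H2; apply filterlim_C.
- apply (filterlim_ext (sum_n (fun n => fst (f n)))); [| exact H1].
  intros N; rewrite sum_n_C; reflexivity.
- apply (filterlim_ext (sum_n (fun n => snd (f n)))); [| exact H2].
  intros N; rewrite sum_n_C; reflexivity.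
Qed.

Lemma is_series_C_fst (f : nat -> C) (l : C) :
  is_series_C f l -> is_series (fun n => fst (f n)) (fst l).
Proof.
intros H; apply filterlim_fst_C in H; revert H; apply filterlim_ext.
intros N; rewrite sum_n_C; reflexivity.
Qed.

Lemma is_series_C_snd (f : nat -> C) (l : C) :
  is_series_C f l -> is_series (fun n => snd (f n)) (snd l).
Proof.
intros H; apply filterlim_snd_C in H; revert H; apply filterlim_ext.
intros N; rewrite sum_n_C; reflexivity.
Qed.

Lemma is_series_C_mult (w : C) (f : nat -> C) (l : C) :
  is_series_C f l -> is_series_C (fun n => w * f n)%C (w * l)%C.
Proof.
intros H; pose proof (is_series_C_fst _ _ H) as H1; pose proof (is_series_C_snd _ _ H) as H2.
apply is_series_C_pair; simpl.
- apply (is_series_minus (K := R_AbsRing) (V := R_NormedModule)); apply is_series_Rmult_l; assumption.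
- apply (is_series_plus (K := R_AbsRing) (V := R_NormedModule)); apply is_series_Rmult_l; assumption.
Qed.

Lemma is_series_C_RtoC_mult (w : C) (f : nat -> R) (l : R) :
  is_series f l -> is_series_C (fun n => RtoC (f n) * w)%C (RtoC l * w)%C.
Proof.
intros H; apply is_series_C_pair; simpl.
- apply (is_series_ext (fun n => fst w * f n)); [intros; real_eq; ring |].
  replace (l * fst w - 0 * snd w) with (fst w * l) by ring; apply is_series_Rmult_l, H.
- apply (is_series_ext (fun n => snd w * f n)); [intros; real_eq; ring |].
  replace (l * snd w + 0 * fst w) with (snd w * l) by ring; apply is_series_Rmult_l, H.
Qed.

(** * The complex exponential and its series *)

Lemma Cexp_plus (z w : C) : Cexp (z + w) = (Cexp z * Cexp w)%C.
Proof.
unfold Cexp, Cmult, Re, Im; simpl; rewrite exp_plus, cos_plus, sin_plus; f_equal; ring.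
Qed.

Lemma Cmod_Cexp (z : C) : Cmod (Cexp z) = exp (Re z).
Proof.
unfold Cmod, Cexp; simpl.
pose proof (sin2_cos2 (Im z)) as H; unfold Rsqr in H; pose proof (exp_pos (Re z)).
rewrite <- (sqrt_square (exp (Re z))) at 5 by lra; f_equal.
transitivity (exp (Re z) * exp (Re z) * (sin (Im z) * sin (Im z) + cos (Im z) * cos (Im z)));
  [ring | rewrite H; ring].
Qed.

Lemma Re_le_Cmod (z : C) : Rabs (Re z) <= Cmod z.
Proof. apply Rle_trans with (2 := Rmax_Cmod z), Rmax_l. Qed.

(** A real function of [s] whose Taylor series, evaluated at [s = 1], yields the complex exponential
    series: [l = 1] gives the real part and [l = - i] the imaginary part. *)
Definition Re_Cexp (l z : C) (s : R) : R := Re (l * Cexp (RtoC s * z)).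

Lemma Re_Cexp_derive (l z : C) (s : R) : is_derive (Re_Cexp l z) s (Re_Cexp (l * z) z s).
Proof.
destruct l as [l1 l2]; destruct z as [a b]; unfold Re_Cexp, Cexp, Cmult, RtoC; simpl.
auto_derive; [trivial |].
replace (s * a - 0 * b) with (s * a) by ring; replace (s * b + 0 * a) with (s * b) by ring.
replace (s * a + - (0 * b)) with (s * a) by ring.
ring.
Qed.

Lemma Re_Cexp_derive_n (l z : C) (n : nat) (s : R) :
  is_derive_n (Re_Cexp l z) n s (Re_Cexp (l * Cpow z n) z s).
Proof.
revert s; induction n as [| n IH]; intros s.
- simpl; rewrite Cmult_1_r; reflexivity.
- change (is_derive (Derive_n (Re_Cexp l z) n) s (Re_Cexp (l * Cpow z (S n)) z s)).
  apply (is_derive_ext (Re_Cexp (l * Cpow z n) z)).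
  + intros x; symmetry; apply is_derive_n_unique, IH.
  + replace (l * Cpow z (S n))%C with (l * Cpow z n * z)%C by (simpl; ring).
    apply Re_Cexp_derive.
Qed.

Lemma is_series_Re_Cexp (l z : C) :
  Cmod z <= 1 -> is_series (fun n => Re (l * Cpow z n) / INR (fact n)) (Re (l * Cexp z)).
Proof.
intros Hz.
assert (H : is_pseries (fun n => Derive_n (Re_Cexp l z) n 0 / INR (fact n)) 1 (Re_Cexp l z 1)).
(* The bound on the derivatives must not depend on their order, which [|z| <= 1] provides. Radius 2
   puts the point [s = 1] in the interior, and [|s| < 2] gives the factor [exp 2]. *)
{ apply mk_pseries with (M := Cmod l * exp 2) (r := 2); [| simpl; rewrite Rabs_R1; lra].
  intros n x Hx; simpl in Hx; split.
  - destruct n as [| n]; [exact I |]; exists (Re_Cexp (l * Cpow z (S n)) z x).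
    apply (Re_Cexp_derive_n l z (S n)).
  - rewrite (is_derive_n_unique _ _ _ _ (Re_Cexp_derive_n l z n x)); unfold Re_Cexp.
    apply Rle_trans with (1 := Re_le_Cmod _).
    rewrite !Cmod_mult, Cmod_Cexp, Rmult_assoc.
    apply Rmult_le_compat_l; [apply Cmod_ge_0 |].
    rewrite <- (Rmult_1_l (exp 2)).
    apply Rmult_le_compat; [apply Cmod_ge_0 | apply Rlt_le, exp_pos | |].
    + induction n as [| n IHn]; [simpl; rewrite Cmod_1; lra |].
      simpl; rewrite Cmod_mult; pose proof (Cmod_ge_0 z); pose proof (Cmod_ge_0 (Cpow z n)); nra.
    + assert (Re (x * z) <= 2).
      { apply Rle_trans with (1 := Rle_abs _); apply Rle_trans with (1 := Re_le_Cmod _).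
        rewrite Cmod_mult, Cmod_R; pose proof (Cmod_ge_0 z); pose proof (Rabs_pos x); nra. }
      destruct (Rle_lt_or_eq_dec _ _ H) as [K | K]; [left; apply exp_increasing, K | right; f_equal; exact K]. }
apply is_pseries_R in H; unfold Re_Cexp at 2 in H; rewrite Cmult_1_l in H.
revert H; apply is_series_ext; intros n; rewrite pow1, Rmult_1_r.
rewrite (is_derive_n_unique _ _ _ _ (Re_Cexp_derive_n l z n 0)); unfold Re_Cexp.
replace (Cexp (RtoC 0 * z)) with (RtoC 1); [f_equal; f_equal; ring |].
rewrite Cmult_0_l; unfold Cexp; simpl; rewrite exp_0, cos_0, sin_0; unfold RtoC; f_equal; ring.
Qed.

Lemma is_series_Cexp (z : C) :
  Cmod z <= 1 -> is_series_C (fun n => RtoC (/ INR (fact n)) * Cpow z n)%C (Cexp z).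
Proof.
intros Hz; apply is_series_C_pair.
- generalize (is_series_Re_Cexp 1 z Hz); rewrite Cmult_1_l; apply is_series_ext.
  intros n; rewrite Cmult_1_l; simpl; unfold Re; real_eq; unfold Rdiv; ring.
- generalize (is_series_Re_Cexp (- Ci) z Hz).
  replace (Re (- Ci * Cexp z)) with (snd (Cexp z)) by (simpl; ring).
  apply is_series_ext; intros n; simpl; real_eq; unfold Rdiv; ring.
Qed.

(** * Moments of [sin x sin (n x)] and the expansion of [x^n] in powers of [1/w] *)

Definition moment (n m : nat) : R :=
  / PI * RInt (fun x => sin x * sin (INR n * x) * cos x ^ m) 0 PI.

Lemma moment_continuous (n m : nat) (x : R) :
  continuous (fun x => sin x * sin (INR n * x) * cos x ^ m) x.
Proof. continuity_by_derive. Qed.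

Lemma ex_moment (n m : nat) : ex_RInt (fun x => sin x * sin (INR n * x) * cos x ^ m) 0 PI.
Proof. apply ex_RInt_continuous_all, moment_continuous. Qed.

Lemma moment_0 (m : nat) : moment 0 m = 0.
Proof.
unfold moment; rewrite (RInt_ext (V := R_CompleteNormedModule) _ (fun _ => 0)).
- rewrite (RInt_const (V := R_CompleteNormedModule)); unfold scal; simpl; unfold mult; simpl; ring.
- intros x _; simpl; rewrite Rmult_0_l, sin_0; real_eq; ring.
Qed.

Lemma sin_nat_PI (k : nat) : sin (INR k * PI) = 0.
Proof. apply sin_eq_0_1; exists (Z.of_nat k); rewrite INR_IZR_INZ; reflexivity. Qed.

Lemma moment_zero (n : nat) : moment n 0 = if Nat.eqb n 1 then / 2 else 0.
Proof.
destruct (Nat.eqb_spec n 1) as [-> | Hn].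
- assert (H := wallis_formula 1 0); unfold wallis in H; unfold moment.
  rewrite (RInt_ext (V := R_CompleteNormedModule) _ (fun x => sin x ^ (2 * 1) * cos x ^ (2 * 0))).
  + rewrite H; simpl; field; apply PI_neq0.
  + intros x _; simpl; rewrite Rmult_1_l; real_eq; ring.
- destruct n as [| n]; [apply moment_0 |].
  assert (Hn0 : 0 < INR n) by (apply (lt_INR 0); lia).
  unfold moment.
  rewrite (is_RInt_derive_R (fun x => (sin (INR n * x) / INR n - sin (INR (S (S n)) * x) / INR (S (S n))) / 2)).
  + rewrite !sin_nat_PI, !Rmult_0_r, sin_0; unfold Rdiv; rewrite !Rmult_0_l; ring.
  + intros x; rewrite !S_INR; auto_derive; [lra |].
    replace ((INR n + 1 + 1) * x) with ((INR n + 1) * x + x) by ring.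
    replace (INR n * x) with ((INR n + 1) * x - x) by ring.
    rewrite cos_plus, cos_minus; real_eq; field; lra.
  + intros x; apply moment_continuous.
Qed.

(** From [2 cos x sin ((n+1) x) = sin ((n+2) x) + sin (n x)]. This mirrors
    [2 w x^(n+1) = x^(n+2) + x^n], with multiplication by [w] read as a shift of [m]. *)
Lemma moment_succ (n m : nat) : 2 * moment (S n) (S m) = moment (S (S n)) m + moment n m.
Proof.
unfold moment; rewrite <- Rmult_plus_distr_l, <- Rmult_assoc, (Rmult_comm 2), Rmult_assoc; f_equal.
etransitivity; [symmetry; apply (RInt_scal (V := R_CompleteNormedModule) _ _ _ 2), ex_moment |].
rewrite <- (RInt_plus (V := R_CompleteNormedModule)) by apply ex_moment.
apply RInt_ext; intros x _; rewrite !S_INR.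
replace ((INR n + 1 + 1) * x) with ((INR n + 1) * x + x) by ring.
replace (INR n * x) with ((INR n + 1) * x - x) by ring.
rewrite sin_plus, sin_minus; unfold scal, plus; simpl; unfold mult; simpl; real_eq; ring.
Qed.

Lemma moment_bound (n m : nat) : Rabs (moment n m) <= 1.
Proof.
pose proof PI_RGT_0; unfold moment; rewrite Rabs_mult, Rabs_inv, (Rabs_pos_eq PI) by lra.
apply Rmult_le_reg_l with PI; [lra |]; rewrite <- Rmult_assoc, Rinv_r by lra.
rewrite Rmult_1_l; rewrite <- (Rminus_0_r PI) at 2; apply abs_RInt_le_const; [lra | apply ex_moment |].
intros x _.
replace (sin x * sin (INR n * x) * cos x ^ m) with (sin (INR n * x) * (sin x ^ 1 * cos x ^ m))
  by (simpl; ring).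
rewrite Rabs_mult; pose proof (pow_sin_cos_le_1 1 m x).
pose proof (Rabs_le (sin (INR n * x)) 1 (SIN_bound _)).
pose proof (Rabs_pos (sin x ^ 1 * cos x ^ m)); pose proof (Rabs_pos (sin (INR n * x))); nra.
Qed.

Lemma is_series_geom_succ (q : R) :
  Rabs q < 1 -> is_series (fun m => q ^ S m) (q / (1 - q)).
Proof.
intros Hq; apply is_series_Rmult_l, is_series_geom, Hq.
Qed.

Lemma Cmod_Cpow (z : C) (n : nat) : Cmod (Cpow z n) = Cmod z ^ n.
Proof.
induction n as [| n IH]; [apply Cmod_1 |].
simpl; rewrite Cmod_mult, IH; reflexivity.
Qed.

Lemma ex_moment_series (n : nat) (u : C) :
  Cmod u < 1 ->
  exists G : C, is_series_C (fun m => RtoC (moment n m) * Cpow u (S m))%C G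
                /\ Cmod G <= Cmod u / (1 - Cmod u).
Proof.
intros Hu; pose proof (Cmod_ge_0 u) as Hu0.
assert (Hs := is_series_geom_succ (Cmod u) ltac:(rewrite Rabs_pos_eq; assumption)).
assert (Hb : forall m, @norm R_AbsRing C_R_NormedModule (RtoC (moment n m) * Cpow u (S m))%C <= Cmod u ^ S m).
{ intros m; rewrite norm_Cmod, Cmod_mult, Cmod_Cpow, Cmod_R.
  pose proof (moment_bound n m); pose proof (pow_le _ (S m) Hu0); nra. }
destruct (ex_series_le (K := R_AbsRing) (V := C_R_CompleteNormedModule) _ _ Hb (ex_intro _ _ Hs)) as [G HG].
exists G; split; [exact HG |].
rewrite <- norm_Cmod; exact (series_norm_le _ _ _ _ Hb HG Hs).
Qed.

Ltac complex_eq := match goal with |- @eq _ ?a ?b => let H := fresh in enough (@eq C a b) as H by exact H end.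

Definition C_Series (f : nat -> C) : C :=
  (Series (fun n => fst (f n)), Series (fun n => snd (f n))).

Lemma C_Series_correct (f : nat -> C) (l : C) : is_series_C f l -> C_Series f = l.
Proof.
intros H; unfold C_Series.
rewrite (is_series_unique _ _ (is_series_C_fst _ _ H)), (is_series_unique _ _ (is_series_C_snd _ _ H)).
symmetry; apply surjective_pairing.
Qed.

Lemma is_series_C_unique (f : nat -> C) (l l' : C) : is_series_C f l -> is_series_C f l' -> l = l'.
Proof. intros H H'; rewrite <- (C_Series_correct _ _ H); apply C_Series_correct, H'. Qed.

(* A bounded sequence with [2 w d (n+1) = d (n+2) + d n], [|w| > 1], [d 0 = 0]
   gains a factor [1 / |w|] at each use of the recurrence, hence vanishes. *)
Lemma bounded_recurrence_zero (d : nat -> C) (u w : C) (B : R) :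
  (w * u = 1)%C -> Cmod u < 1 -> d 0%nat = 0%C ->
  (forall n, (2 * w * d (S n) = d (S (S n)) + d n)%C) -> (forall n, Cmod (d n) <= B) ->
  forall n, d n = 0%C.
Proof.
intros Hwu Hu H0 Hd HB n.
assert (Hk : forall k n, Cmod (d n) <= B * Cmod u ^ k).
{ induction k as [| k IH]; intros m; [rewrite Rmult_1_r; apply HB |].
  destruct m as [| m].
  - rewrite H0, Cmod_0; apply Rmult_le_pos; [| apply pow_le, Cmod_ge_0].
    apply Rle_trans with (2 := HB 0%nat), Cmod_ge_0.
  - assert (E : (2 * d (S m) = u * (d (S (S m)) + d m))%C).
    { rewrite <- Hd; transitivity (2 * (w * u) * d (S m))%C; [rewrite Hwu; ring | ring]. }
    assert (E2 : 2 * Cmod (d (S m)) = Cmod u * Cmod (d (S (S m)) + d m)).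
    { rewrite <- Cmod_mult, <- E, Cmod_mult, Cmod_R, Rabs_pos_eq; lra. }
    pose proof (Cmod_triangle (d (S (S m))) (d m)); pose proof (IH (S (S m))); pose proof (IH m).
    pose proof (Cmod_ge_0 u); simpl pow.
    assert (Cmod u * Cmod (d (S (S m)) + d m) <= Cmod u * (2 * (B * Cmod u ^ k)))
      by (apply Rmult_le_compat_l; lra).
    lra. }
apply Cmod_eq_0, Rle_antisym; [| apply Cmod_ge_0].
assert (HL : is_lim_seq (fun k => B * Cmod u ^ k) (B * 0)).
{ apply (is_lim_seq_scal_l _ B 0), is_lim_seq_geom.
  rewrite Rabs_pos_eq; [exact Hu | apply Cmod_ge_0]. }
rewrite Rmult_0_r in HL.
apply (is_lim_seq_le (fun _ => Cmod (d n)) (fun k => B * Cmod u ^ k) (Cmod (d n)) 0);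
  [intros k; apply Hk | apply is_lim_seq_const | exact HL].
Qed.

(** The generating functions [G n] of the moments satisfy the recurrence of the powers of [x], and
    both are bounded in [n], the powers because [|x| <= 1]. As [|w| > 1], a bounded solution
    starting at 0 vanishes, so they coincide. No contour integral is involved. *)
Lemma moment_series (u w x : C) (n : nat) :
  (w * u = 1)%C -> Cmod u < 1 -> (2 * w * x = 1 + x * x)%C -> Cmod x <= 1 ->
  is_series_C (fun m => RtoC (moment (S n) m) * Cpow u (S m))%C (Cpow x (S n)).
Proof.
intros Hwu Hu Hx Hx1.
set (G := fun n => C_Series (fun m => RtoC (moment n m) * Cpow u (S m))%C).
assert (HG : forall n, is_series_C (fun m => RtoC (moment n m) * Cpow u (S m))%C (G n)
                /\ Cmod (G n) <= Cmod u / (1 - Cmod u)).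
{ intros k; destruct (ex_moment_series k u Hu) as [g [H1 H2]].
  unfold G; rewrite (C_Series_correct _ _ H1); split; assumption. }
assert (G0 : G 0%nat = 0%C).
{ apply (is_series_C_unique _ _ _ (proj1 (HG 0%nat))).
  generalize (is_series_C_mult 0 _ _ (proj1 (HG 0%nat))); rewrite Cmult_0_l.
  apply is_series_ext; intros m; rewrite moment_0; complex_eq; ring. }
(* Multiplication by [w] shifts the series by one index and drops the moment with [m = 0], which
   equals 1/2 for [n = 1] and is 0 otherwise; hence the extra 1 at [k = 0]. *)
assert (Hrec : forall k, (2 * w * G (S k) = G (S (S k)) + G k + RtoC (if Nat.eqb k 0 then 1 else 0))%C).
{ intros k.
  assert (H1 : is_series_C (fun m => 2 * w * (RtoC (moment (S k) (S m)) * Cpow u (S (S m))))%C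
                 (2 * w * G (S k) - 2 * w * (RtoC (moment (S k) 0) * Cpow u 1))%C).
  { apply (is_series_incr_1 (fun m => 2 * w * (RtoC (moment (S k) m) * Cpow u (S m)))%C).
    generalize (is_series_C_mult (2 * w) _ _ (proj1 (HG (S k)))).
    replace (plus _ _) with (2 * w * G (S k))%C; [trivial |].
    change plus with Cplus; complex_eq; ring. }
  pose proof (is_series_plus _ _ _ _ (proj1 (HG (S (S k)))) (proj1 (HG k))) as H2.
  assert (E : (2 * w * G (S k) - 2 * w * (RtoC (moment (S k) 0) * Cpow u 1) = G (S (S k)) + G k)%C).
  { apply (is_series_C_unique _ _ _ H1); revert H2; apply is_series_ext; intros m.
    change (RtoC (moment (S (S k)) m) * Cpow u (S m) + RtoC (moment k m) * Cpow u (S m)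
            = 2 * w * (RtoC (moment (S k) (S m)) * Cpow u (S (S m))))%C.
    transitivity (RtoC (2 * moment (S k) (S m)) * Cpow u (S m))%C.
    - rewrite moment_succ, RtoC_plus; ring.
    - rewrite RtoC_mult; transitivity (2 * (w * u) * RtoC (moment (S k) (S m)) * Cpow u (S m))%C;
        [rewrite Hwu; ring | simpl; ring]. }
  replace (2 * w * (RtoC (moment (S k) 0) * Cpow u 1))%C with (RtoC (if Nat.eqb k 0 then 1 else 0)) in E.
  - rewrite <- E; ring.
  - rewrite moment_zero; simpl Cpow.
    transitivity ((w * u) * (2 * RtoC (if Nat.eqb (S k) 1 then / 2 else 0)))%C; [| ring].
    rewrite Hwu, <- RtoC_mult, Cmult_1_l; f_equal; destruct k; simpl; field. }
(* At [k = 0] the value 0 is subtracted instead of [x^0 = 1]. This absorbs the extra 1 of [Hrec]: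
   [d] satisfies the homogeneous recurrence and starts at 0. *)
set (d := fun k => (G k - match k with O => 0 | S _ => Cpow x k end)%C).
assert (Hd : forall k, d k = 0%C).
{ apply (bounded_recurrence_zero d u w (Cmod u / (1 - Cmod u) + 1)); [exact Hwu | exact Hu | | |].
  - unfold d; rewrite G0; ring.
  - intros k; unfold d.
    transitivity (2 * w * G (S k) - 2 * w * x * Cpow x k)%C; [simpl; ring |].
    rewrite Hrec, Hx; destruct k as [| k]; simpl; ring.
  - intros k; unfold d, Cminus; refine (Rle_trans _ _ _ (Cmod_triangle _ _) _).
    rewrite Cmod_opp; apply Rplus_le_compat; [apply HG |].
    destruct k as [| k]; [rewrite Cmod_0; lra |].
    rewrite Cmod_Cpow, <- (pow1 (S k)); apply pow_incr; split; [apply Cmod_ge_0 | exact Hx1]. }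
replace (Cpow x (S n)) with (G (S n)); [apply HG |].
specialize (Hd (S n)); unfold d in Hd.
transitivity (G (S n) - Cpow x (S n) + Cpow x (S n))%C; [ring | rewrite Hd; ring].
Qed.

(** * Expansion of the transform in powers of 1/w *)

(** The Taylor coefficients of [x exp ((1 - x^2) / 2)] at [x^(2j+1)]. They serve both on the cut,
    where [x^(2j+1)] has imaginary part [sin ((2j+1) phi)], and off it. *)
Definition jump_coef (j : nat) : R := exp (/ 2) * ((- / 2) ^ j / INR (fact j)).

Lemma Cpow_trig (y : R) (n : nat) : Cpow (cos y, sin y) n = (cos (INR n * y), sin (INR n * y)).
Proof.
induction n as [| n IH].
- simpl; rewrite Rmult_0_l, cos_0, sin_0; reflexivity.
- simpl Cpow; rewrite IH, S_INR, Rmult_plus_distr_r, Rmult_1_l, cos_plus, sin_plus.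
  unfold Cmult; simpl; f_equal; ring.
Qed.

Lemma Cpow_mult_l (z w : C) (n : nat) : Cpow (z * w) n = (Cpow z n * Cpow w n)%C.
Proof. induction n as [| n IH]; simpl; [ring | rewrite IH; ring]. Qed.

Lemma is_series_jump (x : R) :
  is_series (fun j => jump_coef j * sin (INR (2 * j + 1) * x)) (jump x).
Proof.
(* Here [l = - i exp (ix)] and [z = - exp (2ix) / 2], so that the real part of [l exp z] is the
   imaginary part of [exp (ix) exp z]. *)
set (l := ((sin x, - cos x) : C)); set (z := (RtoC (- / 2) * (cos (2 * x), sin (2 * x)))%C).
assert (Hz : Cmod z <= 1).
{ unfold z; rewrite Cmod_mult, Cmod_R.
  replace (Cmod (cos (2 * x), sin (2 * x))) with 1.
  - rewrite Rabs_Ropp, Rabs_pos_eq; lra.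
  - symmetry; unfold Cmod; simpl; rewrite !Rmult_1_r; rewrite <- sqrt_1; f_equal.
    pose proof (sin2_cos2 (2 * x)) as H; unfold Rsqr in H; lra. }
pose proof (is_series_Rmult_l (exp (/ 2)) _ _ (is_series_Re_Cexp l z Hz)) as H.
replace (jump x) with (exp (/ 2) * Re (l * Cexp z)).
- revert H; apply is_series_ext; intros j; unfold jump_coef.
  unfold z; rewrite Cpow_mult_l, Cpow_trig, <- RtoC_pow.
  replace (INR (2 * j + 1) * x) with (INR j * (2 * x) + x)
    by (rewrite plus_INR, mult_INR; simpl; ring).
  rewrite sin_plus; unfold l, Cmult, RtoC; simpl; real_eq; unfold Rdiv; ring.
- unfold jump, l, z, Cexp, Cmult, RtoC, Re, Im; simpl.
  replace (- / 2 * cos (2 * x) - 0 * sin (2 * x)) with (sin x * (sin x * 1) + - / 2)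
    by (rewrite cos_2a_sin; field).
  replace (- / 2 * sin (2 * x) + 0 * cos (2 * x)) with (- (sin x * cos x)) by (rewrite sin_2a; field).
  rewrite exp_plus, cos_neg, sin_neg, (exp_Ropp (/ 2)).
  pose proof (exp_pos (/ 2)); field; lra.
Qed.

Lemma Rabs_jump_coef (j : nat) : Rabs (jump_coef j) <= exp (/ 2) * / INR (fact j).
Proof.
unfold jump_coef, Rdiv; pose proof (exp_pos (/ 2)); pose proof (inv_fact_pos j).
rewrite !Rabs_mult, (Rabs_pos_eq (exp _)), (Rabs_pos_eq (/ INR _)) by lra.
apply Rmult_le_compat_l; [lra |].
rewrite <- RPow_abs, Rabs_Ropp, (Rabs_pos_eq (/ 2)) by lra.
assert (0 <= (/ 2) ^ j <= 1).
{ split; [apply pow_le; lra | rewrite <- (pow1 j); apply pow_incr; lra]. }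
nra.
Qed.

Lemma is_series_jump_bound : is_series (fun j => exp (/ 2) * / INR (fact j)) (exp (/ 2) * exp 1).
Proof.
apply is_series_Rmult_l; generalize (is_series_exp 1); apply is_series_ext.
intros n; rewrite pow1; real_eq; unfold Rdiv; ring.
Qed.

Lemma jump_bound (x : R) : Rabs (jump x) <= exp (/ 2) * exp 1.
Proof.
apply (series_norm_le (V := R_NormedModule) _ (fun j => exp (/ 2) * / INR (fact j)) (jump x) _)
  with (2 := is_series_jump x); [| exact is_series_jump_bound].
intros j; norm_abs; rewrite Rabs_mult.
pose proof (Rabs_jump_coef j); pose proof (Rabs_pos (jump_coef j)).
pose proof (Rabs_le (sin (INR (2 * j + 1) * x)) 1 (SIN_bound _)).
pose proof (Rabs_pos (sin (INR (2 * j + 1) * x))); nra.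
Qed.

Lemma jump_continuous (x : R) : continuous jump x.
Proof. unfold jump; continuity_by_derive. Qed.

Definition jump_moment (m : nat) : R := / PI * RInt (fun x => jump x * (sin x * cos x ^ m)) 0 PI.

Lemma is_series_jump_moment (m : nat) :
  is_series (fun j => jump_coef j * moment (2 * j + 1) m) (jump_moment m).
Proof.
apply (is_series_ext (fun j => / PI *
  RInt (fun x => jump_coef j * sin (INR (2 * j + 1) * x) * (sin x * cos x ^ m)) 0 PI)).
{ intros j; unfold moment.
  rewrite <- Rmult_assoc, (Rmult_comm (jump_coef j)), Rmult_assoc; real_eq; f_equal.
  etransitivity; [| apply (RInt_scal (V := R_CompleteNormedModule) _ _ _ (jump_coef j)), ex_moment].
  apply RInt_ext; intros x _; unfold scal; simpl; unfold mult; simpl; real_eq; ring. }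
apply is_series_Rmult_l, is_series_weighted_RInt with
  (b := fun j => exp (/ 2) * / INR (fact j)) (M := 1).
- intros x; generalize (pow_sin_cos_le_1 1 m x); rewrite pow_1; trivial.
- intros j x; rewrite Rabs_mult.
  pose proof (Rabs_jump_coef j); pose proof (Rabs_pos (jump_coef j)).
  pose proof (Rabs_le (sin (INR (2 * j + 1) * x)) 1 (SIN_bound _)).
  pose proof (Rabs_pos (sin (INR (2 * j + 1) * x))); nra.
- exists (exp (/ 2) * exp 1); exact is_series_jump_bound.
- intros j x; continuity_by_derive.
- apply jump_continuous.
- intros x; continuity_by_derive.
- intros x; apply is_series_jump.
Qed.

Lemma jump_moment_bound (m : nat) : Rabs (jump_moment m) <= exp (/ 2) * exp 1.
Proof.
apply (series_norm_le (V := R_NormedModule) _ (fun j => exp (/ 2) * / INR (fact j)) (jump_moment m) _)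
  with (2 := is_series_jump_moment m); [| exact is_series_jump_bound].
intros j; norm_abs; rewrite Rabs_mult.
pose proof (Rabs_jump_coef j); pose proof (Rabs_pos (jump_coef j)).
pose proof (moment_bound (2 * j + 1) m); pose proof (Rabs_pos (moment (2 * j + 1) m)); nra.
Qed.

Lemma Cpow_add_r (z : C) (a b : nat) : Cpow z (a + b) = (Cpow z a * Cpow z b)%C.
Proof. induction a as [| a IH]; simpl; [ring | rewrite IH; ring]. Qed.

Lemma Cpow_mult_r (z : C) (a b : nat) : Cpow z (a * b) = Cpow (Cpow z a) b.
Proof.
induction b as [| b IH]; [rewrite Nat.mul_0_r; reflexivity |].
rewrite Nat.mul_succ_r, Nat.add_comm, Cpow_add_r, IH; reflexivity.
Qed.

Lemma is_series_jump_transform (x : C) :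
  Cmod x <= 1 ->
  is_series_C (fun j => RtoC (jump_coef j) * Cpow x (2 * j + 1))%C
    (Cexp (RtoC (/ 2) * (1 - x * x)) * x)%C.
Proof.
intros Hx; set (z := (RtoC (- / 2) * (x * x))%C).
assert (Hz : Cmod z <= 1).
{ unfold z; rewrite !Cmod_mult, Cmod_R, Rabs_Ropp, Rabs_pos_eq by lra.
  pose proof (Cmod_ge_0 x); nra. }
generalize (is_series_C_mult (RtoC (exp (/ 2)) * x) _ _ (is_series_Cexp z Hz)).
replace (RtoC (exp (/ 2)) * x * Cexp z)%C with (Cexp (RtoC (/ 2) * (1 - x * x)) * x)%C.
- apply is_series_ext; intros j; unfold jump_coef, z.
  rewrite Cpow_mult_l, <- RtoC_pow, Cpow_add_r, Cpow_mult_r, RtoC_mult.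
  unfold Rdiv; rewrite RtoC_mult; simpl Cpow; complex_eq.
  replace (x * (x * 1))%C with (x * x)%C by ring; ring.
- replace (RtoC (/ 2) * (1 - x * x))%C with (RtoC (/ 2) + z)%C
    by (unfold z; rewrite RtoC_opp; ring).
  rewrite Cexp_plus.
  replace (Cexp (RtoC (/ 2))) with (RtoC (exp (/ 2)));
    [ring | unfold Cexp, RtoC; simpl; rewrite cos_0, sin_0; f_equal; ring].
Qed.

Lemma jump_moment_series (u w x : C) :
  (w * u = 1)%C -> Cmod u < 1 -> (2 * w * x = 1 + x * x)%C -> Cmod x <= 1 ->
  is_series_C (fun m => RtoC (jump_moment m) * Cpow u (S m))%C
    (Cexp (RtoC (/ 2) * (1 - x * x)) * x)%C.
Proof.
intros Hwu Hu Hx Hx1; pose proof (Cmod_ge_0 u) as Hu0.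
apply (is_series_swap (V := C_R_NormedModule)
  (fun j m => RtoC (jump_coef j) * (RtoC (moment (2 * j + 1) m) * Cpow u (S m)))%C
  (fun j => exp (/ 2) * / INR (fact j)) (fun m => Cmod u ^ S m)
  (fun j => RtoC (jump_coef j) * Cpow x (2 * j + 1))%C).
- intros j m; rewrite norm_Cmod, !Cmod_mult, !Cmod_R, Cmod_Cpow.
  pose proof (Rabs_jump_coef j); pose proof (Rabs_pos (jump_coef j)).
  pose proof (moment_bound (2 * j + 1) m); pose proof (Rabs_pos (moment (2 * j + 1) m)).
  pose proof (pow_le _ (S m) Hu0).
  apply Rmult_le_compat; [assumption | nra | assumption | nra].
- eexists; exact is_series_jump_bound.
- eexists; apply is_series_geom_succ; rewrite Rabs_pos_eq; assumption.
- intros j; apply is_series_C_mult; replace (2 * j + 1)%nat with (S (2 * j)) by ring.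
  apply moment_series with w; assumption.
- intros m; generalize (is_series_C_RtoC_mult (Cpow u (S m)) _ _ (is_series_jump_moment m)).
  apply is_series_ext; intros j; rewrite RtoC_mult; complex_eq; ring.
- apply is_series_jump_transform, Hx1.
Qed.

Lemma RInt_odd_reflection (f : R -> R) (a b : R) :
  ex_RInt f a b -> (forall x, f (a + b - x) = - f x) -> RInt f a b = 0.
Proof.
intros Hf Hodd.
pose proof (RInt_correct (V := R_CompleteNormedModule) _ _ _ Hf) as H.
apply (is_RInt_swap (V := R_NormedModule)) in H.
assert (K : is_RInt (fun y => scal (-1) (f (-1 * y + (a + b)))) a b (opp (RInt f a b))).
{ apply (is_RInt_comp_lin (V := R_NormedModule)).
  replace (-1 * a + (a + b)) with b by ring; replace (-1 * b + (a + b)) with a by ring; exact H. }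
apply (is_RInt_ext _ f) in K.
- apply (is_RInt_unique (V := R_CompleteNormedModule)) in K.
  unfold opp in K; simpl in K; lra.
- intros x _; unfold scal; simpl; unfold mult; simpl.
  replace (-1 * x + (a + b)) with (a + b - x) by ring; rewrite Hodd; real_eq; ring.
Qed.

Lemma jump_reflection (x : R) : sin (PI - x) * jump (PI - x) = sin x * jump x.
Proof.
unfold jump; rewrite sin_PI_x, cos_minus, cos_PI, sin_PI.
replace (-1 * cos x + 0 * sin x) with (- cos x) by ring.
replace (sin x * - cos x) with (- (sin x * cos x)) by ring.
rewrite cos_neg, sin_neg; ring.
Qed.

Lemma is_series_jump_exp (t : R) :
  is_series (fun m => jump_moment m * (t ^ m / INR (fact m)))
    (/ PI * RInt (fun x => sin x * jump x * cosh (t * cos x)) 0 PI).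
Proof.
replace (RInt (fun x => sin x * jump x * cosh (t * cos x)) 0 PI)
  with (RInt (fun x => exp (t * cos x) * (jump x * sin x)) 0 PI).
- apply (is_series_ext (fun m => / PI *
    RInt (fun x => (t * cos x) ^ m / INR (fact m) * (jump x * sin x)) 0 PI)).
  { intros m; unfold jump_moment.
    rewrite Rmult_assoc; real_eq; f_equal; rewrite (Rmult_comm (RInt _ _ _)).
    etransitivity; [| apply (RInt_scal (V := R_CompleteNormedModule) _ _ _ (t ^ m / INR (fact m)))].
    - apply RInt_ext; intros x _; rewrite Rpow_mult_distr.
      unfold scal; simpl; unfold mult; simpl; real_eq; unfold Rdiv; ring.
    - apply ex_RInt_continuous_all; intros x; unfold jump; continuity_by_derive. }
  apply is_series_Rmult_l, is_series_weighted_RInt with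
    (b := fun m => Rabs t ^ m / INR (fact m)) (M := exp (/ 2) * exp 1).
  + intros x; rewrite Rabs_mult; pose proof (jump_bound x); pose proof (Rabs_pos (jump x)).
    pose proof (Rabs_le (sin x) 1 (SIN_bound _)); pose proof (Rabs_pos (sin x)); nra.
  + intros m x; pose proof (inv_fact_pos m).
    unfold Rdiv; rewrite Rabs_mult, (Rabs_pos_eq (/ _)), Rpow_mult_distr, Rabs_mult, <- !RPow_abs by lra.
    apply Rmult_le_compat_r; [lra |].
    pose proof (pow_le _ m (Rabs_pos t)).
    pose proof (pow_sin_cos_le_1 0 m x) as K; rewrite pow_O, Rmult_1_l, <- RPow_abs in K; nra.
  + apply ex_series_exp.
  + intros m x; continuity_by_derive.
  + intros x; continuity_by_derive.
  + intros x; unfold jump; continuity_by_derive.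
  + intros x; apply is_series_exp.
(* Under [x -> PI - x] the factor [sin x * jump x] is invariant while [cos x] changes sign. The
   hyperbolic sine part thus integrates to 0, and [exp] may be replaced by [cosh]. *)
- assert (Hs : RInt (fun x => sin x * jump x * sinh (t * cos x)) 0 PI = 0).
  { apply RInt_odd_reflection.
    - apply ex_RInt_continuous_all; intros x; unfold jump, sinh; continuity_by_derive.
    - intros x; rewrite Rplus_0_l, jump_reflection, cos_minus, cos_PI, sin_PI.
      replace (t * (-1 * cos x + 0 * sin x)) with (- (t * cos x)) by ring.
      unfold sinh; rewrite Ropp_involutive; field. }
  transitivity (RInt (fun x => sin x * jump x * cosh (t * cos x)) 0 PI
                + RInt (fun x => sin x * jump x * sinh (t * cos x)) 0 PI); [| rewrite Hs; apply Rplus_0_r].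
  rewrite <- (RInt_plus (V := R_CompleteNormedModule)).
  + apply RInt_ext; intros x _; unfold plus, cosh, sinh; simpl; real_eq; field.
  + apply ex_RInt_continuous_all; intros x; unfold jump, cosh; continuity_by_derive.
  + apply ex_RInt_continuous_all; intros x; unfold jump, sinh; continuity_by_derive.
Qed.

(** * The line integral of exp(wt)/w *)

(** With [kernel_im], the real and imaginary parts of [exp (wt) / w] at [w = a + iy]. *)
Definition kernel_re (t a y : R) : R :=
  exp (a * t) * (a * cos (y * t) + y * sin (y * t)) / (a ^ 2 + y ^ 2).

Definition kernel_im (t a y : R) : R :=
  exp (a * t) * (a * sin (y * t) - y * cos (y * t)) / (a ^ 2 + y ^ 2).

(** The real part of the complex derivative [(tw - 1) exp (wt) / w^2]. By the Cauchy-Riemann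
    equations it is both the derivative of [kernel_re] in [a] and that of [kernel_im] in [y]. *)
Definition kernel_diff (t a y : R) : R :=
  exp (a * t) *
  (((t * a - 1) * cos (y * t) - t * y * sin (y * t)) * (a * a - y * y)
   + ((t * a - 1) * sin (y * t) + t * y * cos (y * t)) * (2 * a * y))
  * / ((a * a + y * y) * (a * a + y * y)).

Lemma sum_sq_pos (a y : R) : a <> 0 -> 0 < a ^ 2 + y ^ 2.
Proof. intros Ha; pose proof (pow2_gt_0 a Ha); pose proof (pow2_ge_0 y); lra. Qed.

Lemma kernel_re_derive (t a y : R) :
  a <> 0 -> is_derive (fun a => kernel_re t a y) a (kernel_diff t a y).
Proof.
intros Ha; pose proof (sum_sq_pos a y Ha); unfold kernel_re, kernel_diff; auto_derive; [simpl in *; lra |].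
set (e := exp _); set (c := cos _); set (s := sin _); change (exp _) with e; field; nra.
Qed.

Lemma kernel_im_derive (t a y : R) :
  a <> 0 -> is_derive (fun y => kernel_im t a y) y (kernel_diff t a y).
Proof.
intros Ha; pose proof (sum_sq_pos a y Ha); unfold kernel_im, kernel_diff; auto_derive; [simpl in *; lra |].
set (e := exp _); set (c := cos _); set (s := sin _); field; nra.
Qed.

Lemma kernel_diff_continuity_2d (t a y : R) :
  a <> 0 -> continuity_2d_pt (kernel_diff t) a y.
Proof.
intros Ha; pose proof (sum_sq_pos a y Ha); unfold kernel_diff.
assert (Hcos : continuity_2d_pt (fun _ y => cos (y * t)) a y).
{ apply (continuity_1d_2d_pt_comp cos (fun _ y => y * t)); [apply continuity_cos |].
  apply continuity_2d_pt_mult; [apply continuity_2d_pt_id2 | apply continuity_2d_pt_const]. }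
assert (Hsin : continuity_2d_pt (fun _ y => sin (y * t)) a y).
{ apply (continuity_1d_2d_pt_comp sin (fun _ y => y * t)); [apply continuity_sin |].
  apply continuity_2d_pt_mult; [apply continuity_2d_pt_id2 | apply continuity_2d_pt_const]. }
assert (Hexp : continuity_2d_pt (fun a _ => exp (a * t)) a y).
{ apply (continuity_1d_2d_pt_comp exp (fun a _ => a * t)).
  - apply derivable_continuous_pt, derivable_pt_exp.
  - apply continuity_2d_pt_mult; [apply continuity_2d_pt_id1 | apply continuity_2d_pt_const]. }
repeat first [assumption | apply continuity_2d_pt_const | apply continuity_2d_pt_id1
  | apply continuity_2d_pt_id2 | apply continuity_2d_pt_inv | apply continuity_2d_pt_mult
  | apply continuity_2d_pt_plus | apply continuity_2d_pt_opp ].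
nra.
Qed.

Lemma kernel_re_continuous (t a y : R) : a <> 0 -> continuous (kernel_re t a) y.
Proof.
intros Ha; pose proof (sum_sq_pos a y Ha); unfold kernel_re.
apply (ex_derive_continuous (V := R_NormedModule)); auto_derive; simpl in *; lra.
Qed.

Lemma kernel_im_continuous (t a y : R) : a <> 0 -> continuous (kernel_im t a) y.
Proof.
intros Ha; apply (ex_derive_continuous (V := R_NormedModule) (kernel_im t a)).
eexists; apply kernel_im_derive, Ha.
Qed.

Lemma kernel_diff_continuous (t a y : R) : a <> 0 -> continuous (kernel_diff t a) y.
Proof.
intros Ha; pose proof (sum_sq_pos a y Ha); unfold kernel_diff.
apply (ex_derive_continuous (V := R_NormedModule)); auto_derive; nra.
Qed.

Definition line_re (t T a : R) : R := RInt (kernel_re t a) (- T) T.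

Lemma locally_neq_0 (a : R) : a <> 0 -> locally a (fun x => x <> 0).
Proof.
intros Ha; exists (mkposreal _ (Rabs_pos_lt a Ha)); intros x Hx ->.
unfold ball in Hx; simpl in Hx; unfold AbsRing_ball, abs, minus, plus, opp in Hx; simpl in Hx.
rewrite Rplus_0_l, Rabs_Ropp in Hx; lra.
Qed.

(** Differentiation under the integral followed by a Cauchy-Riemann equation turns the derivative in
    the abscissa into boundary values at [y = T] and [y = - T]. This takes the place of Cauchy's
    theorem on a rectangle. *)
Lemma line_re_derive (t T a : R) :
  a <> 0 -> is_derive (line_re t T) a (2 * kernel_im t a T).
Proof.
intros Ha.
assert (E : 2 * kernel_im t a T = RInt (fun y => Derive (fun a => kernel_re t a y) a) (- T) T).
{ transitivity (RInt (kernel_diff t a) (- T) T).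
  - rewrite (is_RInt_derive_R (kernel_im t a) (kernel_diff t a)).
    + unfold kernel_im.
      replace (- T * t) with (- (T * t)) by ring.
      rewrite sin_neg, cos_neg; pose proof (sum_sq_pos a T Ha).
      real_eq; field; nra.
    + intros; apply kernel_im_derive, Ha.
    + intros; apply kernel_diff_continuous, Ha.
  - apply RInt_ext; intros y _; symmetry; apply is_derive_unique, kernel_re_derive, Ha. }
rewrite E; apply is_derive_RInt_param.
- generalize (locally_neq_0 a Ha); apply filter_imp; intros x Hx y _.
  eexists; apply kernel_re_derive, Hx.
- intros y _; apply (continuity_2d_pt_ext_loc (kernel_diff t)); [| apply kernel_diff_continuity_2d, Ha].
  destruct (locally_neq_0 a Ha) as [d Hd]; exists d; intros u v Hu _.
  symmetry; apply is_derive_unique, kernel_re_derive, Hd, Hu.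
- generalize (locally_neq_0 a Ha); apply filter_imp; intros x Hx.
  apply ex_RInt_continuous_all; intros y; apply kernel_re_continuous, Hx.
Qed.

Lemma kernel_im_bound (t a T : R) :
  a <> 0 -> 0 < T -> Rabs (2 * kernel_im t a T) <= 4 * exp (a * t) / T.
Proof.
intros Ha HT; unfold kernel_im; pose proof (sum_sq_pos a T Ha) as H.
pose proof (exp_pos (a * t)) as He.
unfold Rdiv; rewrite !Rabs_mult, Rabs_inv, (Rabs_pos_eq (exp _)), (Rabs_pos_eq (a ^ 2 + T ^ 2)), (Rabs_pos_eq 2) by lra.
assert (K : Rabs (a * sin (T * t) - T * cos (T * t)) <= Rabs a + T).
{ unfold Rminus; refine (Rle_trans _ _ _ (Rabs_triang _ _) _).
  rewrite Rabs_Ropp, !Rabs_mult, (Rabs_pos_eq T) by lra.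
  pose proof (Rabs_le (sin (T * t)) 1 (SIN_bound (T * t))).
  pose proof (Rabs_le (cos (T * t)) 1 (COS_bound (T * t))).
  pose proof (Rabs_pos a); nra. }
assert (K2 : (Rabs a + T) * T <= 2 * (a ^ 2 + T ^ 2)).
{ rewrite <- (pow2_abs a); nra. }
apply Rmult_le_reg_r with (T * (a ^ 2 + T ^ 2)); [nra |].
replace (2 * (exp (a * t) * Rabs (a * sin (T * t) - T * cos (T * t)) * / (a ^ 2 + T ^ 2)) * (T * (a ^ 2 + T ^ 2)))
  with (2 * exp (a * t) * (Rabs (a * sin (T * t) - T * cos (T * t)) * T)) by (field; lra).
replace (4 * exp (a * t) * / T * (T * (a ^ 2 + T ^ 2)))
  with (2 * exp (a * t) * (2 * (a ^ 2 + T ^ 2))) by (field; lra).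
apply Rmult_le_compat_l; [lra |].
apply Rle_trans with (2 := K2); apply Rmult_le_compat_r; lra.
Qed.

Lemma line_re_right (t T a c : R) :
  0 < t -> 0 < T -> 0 < a -> a < c ->
  Rabs (line_re t T c - line_re t T a) <= 4 * c * exp (c * t) / T.
Proof.
intros Ht HT Ha Hc.
destruct (MVT_gen (line_re t T) a c (fun x => 2 * kernel_im t x T)) as [x [Hx E]].
- intros x Hx; rewrite Rmin_left in Hx by lra; apply line_re_derive; lra.
- intros x Hx; rewrite Rmin_left in Hx by lra.
  apply continuity_pt_filterlim, (ex_derive_continuous (V := R_NormedModule) (line_re t T)).
  eexists; apply line_re_derive; lra.
- rewrite Rmin_left, Rmax_right in Hx by lra.
  rewrite E, Rabs_mult, (Rabs_pos_eq (c - a)) by lra.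
  pose proof (kernel_im_bound t x T ltac:(lra) HT).
  assert (exp (x * t) <= exp (c * t)).
  { destruct (Rle_lt_or_eq_dec x c) as [K | ->]; [lra | left; apply exp_increasing; nra | lra]. }
  pose proof (exp_pos (x * t)); pose proof (Rinv_0_lt_compat T HT).
  apply Rle_trans with (4 * exp (c * t) / T * c).
  + apply Rmult_le_compat; [apply Rabs_pos | lra | | lra].
    apply Rle_trans with (1 := H); unfold Rdiv; apply Rmult_le_compat_r; lra.
  + right; unfold Rdiv; ring.
Qed.

Lemma line_re_far (t T A : R) :
  0 < t -> 0 < T -> 0 < A -> Rabs (line_re t T (- A)) <= 2 * T / A.
Proof.
intros Ht HT HA; unfold line_re.
replace (2 * T / A) with ((T - - T) * / A) by (field; lra).
apply abs_RInt_le_const; [lra | |].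
- apply ex_RInt_continuous_all; intros y; apply kernel_re_continuous; lra.
- intros y _; unfold kernel_re; pose proof (sum_sq_pos (- A) y ltac:(lra)) as H.
  assert (He : exp (- A * t) <= 1).
  { rewrite <- exp_0; left; apply exp_increasing; nra. }
  pose proof (exp_pos (- A * t)) as He0.
  set (C := cos (y * t)); set (S := sin (y * t)).
  assert (HCS : C * C + S * S = 1).
  { pose proof (sin2_cos2 (y * t)) as K; unfold Rsqr in K; fold C S in K; lra. }
  set (v := - A * C + y * S).
  (* Cauchy-Schwarz for the vector [(- A, y)] and the unit vector [(C, S)]; the defect is
     [(A S + y C)^2]. *)
  assert (Hv : v * v <= (- A) ^ 2 + y ^ 2).
  { replace ((- A) ^ 2 + y ^ 2) with (v * v + (A * S + y * C) * (A * S + y * C)).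
    - pose proof (Rle_0_sqr (A * S + y * C)) as K; unfold Rsqr in K; lra.
    - unfold v; transitivity ((A * A + y * y) * (C * C + S * S)); [ring | rewrite HCS; ring]. }
  assert (Hv2 : Rabs v * A <= (- A) ^ 2 + y ^ 2).
  { apply Rsqr_incr_0_var; [| lra].
    replace (Rsqr (Rabs v * A)) with (Rsqr v * Rsqr A)
      by (rewrite (Rsqr_abs v); unfold Rsqr; ring).
    unfold Rsqr; assert (A * A <= (- A) ^ 2 + y ^ 2) by nra.
    apply Rmult_le_compat; nra. }
  unfold Rdiv; rewrite !Rabs_mult, Rabs_inv, (Rabs_pos_eq (exp _)), (Rabs_pos_eq (_ + _)) by lra.
  pose proof (Rabs_pos v).
  apply Rmult_le_reg_r with (A * ((- A) ^ 2 + y ^ 2)); [nra |].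
  replace (exp (- A * t) * Rabs v * / ((- A) ^ 2 + y ^ 2) * (A * ((- A) ^ 2 + y ^ 2)))
    with (exp (- A * t) * (Rabs v * A)) by (field; lra).
  replace (/ A * (A * ((- A) ^ 2 + y ^ 2))) with ((- A) ^ 2 + y ^ 2) by (field; lra).
  assert (0 <= Rabs v * A) by nra; nra.
Qed.

Lemma line_re_left (t T a : R) :
  0 < t -> 1 < T -> 0 < a < 1 -> Rabs (line_re t T (- a)) <= 4 / (t * T) + 2 / T.
Proof.
intros Ht HT Ha.
(* With this abscissa the bound [2 T / A] at the far end is itself [O(1/T)]. *)
set (A := T ^ 2); assert (HA : 1 < A) by (unfold A; nra).
pose proof (line_re_far t T A Ht ltac:(lra) ltac:(lra)) as Hfar.
replace (2 * T / A) with (2 / T) in Hfar by (unfold A; field; lra).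
assert (Hs : forall s, s = 1 \/ s = -1 ->
   s * line_re t T (- a) <= s * line_re t T (- A) + 4 / (t * T)).
{ intros s Hs.
  (* The mean value bound times the length of the interval would be far too large. Subtracting the
     antiderivative of the bound [4 exp (x t) / T] makes [v] nonincreasing instead, at a total cost
     of [4 / (t T)]. The sign [s] treats both halves of the absolute value. *)
  set (v := fun x => s * line_re t T x - 4 / (t * T) * exp (x * t)).
  set (v' := fun x => s * (2 * kernel_im t x T) - 4 / (t * T) * (t * exp (x * t))).
  assert (Hv : forall x, x <> 0 -> is_derive v x (v' x)).
  { intros x Hx; unfold v, v'.
    apply (is_derive_minus (V := R_NormedModule) (fun x => s * line_re t T x)
             (fun x => 4 / (t * T) * exp (x * t))).
    - apply (is_derive_scal (line_re t T)), line_re_derive, Hx.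
    - auto_derive; [trivial | ring]. }
  destruct (MVT_gen v (- A) (- a) v') as [x [Hx E]].
  - intros x Hx; rewrite Rmax_right in Hx by lra; apply Hv; lra.
  - intros x Hx; rewrite Rmax_right in Hx by lra.
    apply continuity_pt_filterlim, (ex_derive_continuous (V := R_NormedModule) v).
    eexists; apply Hv; lra.
  - rewrite Rmin_left, Rmax_right in Hx by lra.
    pose proof (kernel_im_bound t x T ltac:(lra) ltac:(lra)) as Hb.
    assert (Hneg : v' x <= 0).
    { unfold v'; replace (4 / (t * T) * (t * exp (x * t))) with (4 * exp (x * t) / T) by (field; lra).
      apply Rabs_le_between in Hb; destruct Hs as [-> | ->]; lra. }
    assert (v (- a) <= v (- A)) by nra.
    unfold v in *.
    assert (0 < 4 / (t * T)) by (apply Rdiv_lt_0_compat; nra).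
    assert (exp (- a * t) <= 1).
    { rewrite <- exp_0; left; apply exp_increasing; nra. }
    pose proof (exp_pos (- A * t)); nra. }
apply Rabs_le_between in Hfar; pose proof (Hs 1 ltac:(auto)); pose proof (Hs (-1) ltac:(auto)).
apply Rabs_le; lra.
Qed.

Lemma atan_le_id (z : R) : 0 <= z -> 0 <= atan z <= z.
Proof.
intros Hz; split.
- rewrite <- atan_0; destruct Hz as [Hz | <-]; [left; apply atan_increasing, Hz | right; reflexivity].
- destruct Hz as [Hz | <-]; [| rewrite atan_0; lra].
  destruct (MVT_gen atan 0 z (fun x => / (1 + Rsqr x))) as [x [_ E]].
  + intros; apply is_derive_atan.
  + intros; apply continuity_pt_filterlim, (ex_derive_continuous (V := R_NormedModule) atan).
    eexists; apply is_derive_atan.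
  + rewrite atan_0, !Rminus_0_r in E; rewrite E.
    rewrite <- (Rmult_1_l z) at 2; apply Rmult_le_compat_r; [lra |].
    rewrite <- Rinv_1; apply Rinv_le_contravar; [lra | pose proof (Rle_0_sqr x); lra].
Qed.

Lemma RInt_poisson (a T : R) :
  0 < a -> 0 < T -> is_RInt (fun y => a / (a ^ 2 + y ^ 2)) (- T) T (PI - 2 * atan (a / T)).
Proof.
intros Ha HT.
replace (PI - 2 * atan (a / T)) with (minus (atan (T / a)) (atan (- T / a))).
2:{ replace (a / T) with (/ (T / a)) by (field; lra).
    rewrite atan_inv by (apply Rdiv_lt_0_compat; assumption).
    replace (- T / a) with (- (T / a)) by (field; lra).
    rewrite atan_opp; unfold minus, plus, opp; simpl; real_eq; field. }
apply (is_RInt_derive (V := R_CompleteNormedModule) (fun y => atan (y / a))).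
- intros y _; apply (is_derive_eq _ _ (/ a * / (1 + Rsqr (y / a)))).
  + apply (is_derive_comp (V := R_NormedModule) atan (fun y => y / a)); [apply is_derive_atan |].
    auto_derive; [trivial | field; lra].
  + unfold Rsqr; field; split; nra.
- intros y _; apply (ex_derive_continuous (V := R_NormedModule)); auto_derive.
  pose proof (sum_sq_pos a y ltac:(lra)); simpl in *; lra.
Qed.

(** Once the exponential factors are removed, the terms in [y sin (y t)] at [a] and [- a] are equal
    and cancel, and those in [a cos (y t)] add up. *)
Lemma line_re_reflect (t T a : R) :
  0 < a ->
  exp (- a * t) * line_re t T a - exp (a * t) * line_re t T (- a)
  = 2 * RInt (fun y => a * cos (y * t) / (a ^ 2 + y ^ 2)) (- T) T.
Proof.
intros Ha; unfold line_re.
assert (Hre : forall b u v, b <> 0 -> ex_RInt (kernel_re t b) u v).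
{ intros; apply ex_RInt_continuous_all; intros y; apply kernel_re_continuous; assumption. }
assert (Hc : ex_RInt (fun y => a * cos (y * t) / (a ^ 2 + y ^ 2)) (- T) T).
{ apply ex_RInt_continuous_all; intros y.
  apply (ex_derive_continuous (V := R_NormedModule)); auto_derive.
  pose proof (sum_sq_pos a y ltac:(lra)); simpl in *; lra. }
symmetry; etransitivity; [symmetry; apply (RInt_scal (V := R_CompleteNormedModule) _ _ _ 2 Hc) |].
apply (is_RInt_unique (V := R_CompleteNormedModule)).
apply (is_RInt_ext (fun y => minus (scal (exp (- a * t)) (kernel_re t a y))
                               (scal (exp (a * t)) (kernel_re t (- a) y)))).
- intros y _; unfold minus, plus, opp, scal; simpl; unfold mult; simpl; unfold kernel_re.
  pose proof (sum_sq_pos a y ltac:(lra)).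
  replace (- a * t) with (- (a * t)) by ring; rewrite exp_Ropp.
  pose proof (exp_pos (a * t)).
  set (e := exp (a * t)) in *; set (C := cos _); set (S := sin _); real_eq; field.
  repeat split; nra.
- apply (is_RInt_minus (V := R_NormedModule)); apply (is_RInt_scal (V := R_NormedModule));
    apply (RInt_correct (V := R_CompleteNormedModule)), Hre; lra.
Qed.

Lemma one_minus_cos_bound (x : R) : 0 <= 1 - cos x <= x ^ 2 / 2.
Proof.
pose proof (COS_bound x); split; [lra |].
replace x with (2 * (x / 2)) at 1 by field; rewrite cos_2a_sin.
assert (Rsqr (sin (x / 2)) <= Rsqr (x / 2)).
{ apply Rsqr_le_abs_1.
  assert (Hs : forall z, 0 <= z -> Rabs (sin z) <= z).
  { intros z Hz; pose proof (SIN_bound z).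
    destruct (Rle_lt_dec z 1) as [Hz1 | Hz1]; [| apply Rabs_le; lra].
    pose proof PI2_1; pose proof PI_RGT_0.
    rewrite Rabs_pos_eq by (apply sin_ge_0; lra).
    destruct Hz as [Hz | <-]; [left; apply sin_lt_x, Hz | rewrite sin_0; lra]. }
  destruct (Rle_lt_dec 0 (x / 2)) as [H0 | H0].
  - rewrite (Rabs_pos_eq (x / 2)) by exact H0; apply Hs, H0.
  - rewrite <- (Rabs_Ropp (sin _)), <- sin_neg, (Rabs_left (x / 2)) by exact H0; apply Hs; lra. }
unfold Rsqr in *; lra.
Qed.

(** Writing [cos = 1 - (1 - cos)] leaves the Poisson integral and a remainder whose integrand is at
    most [a t^2 / 2], because [1 - cos (y t) <= (y t)^2 / 2]. The bound grows with [T] but vanishes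
    as [a -> 0] with [T] fixed, which is how it is used. *)
Lemma poisson_cos_bound (t T a : R) :
  0 < t -> 1 < T -> 0 < a ->
  Rabs (RInt (fun y => a * cos (y * t) / (a ^ 2 + y ^ 2)) (- T) T - PI) <= a * (2 + t ^ 2 * T).
Proof.
intros Ht HT Ha.
pose proof (RInt_poisson a T Ha ltac:(lra)) as HP.
assert (Hd : forall y, a ^ 2 + y ^ 2 <> 0) by (intros y; pose proof (sum_sq_pos a y ltac:(lra)); lra).
assert (Hc : forall y, continuous (fun y => a * (1 - cos (y * t)) / (a ^ 2 + y ^ 2)) y).
{ intros y; apply (ex_derive_continuous (V := R_NormedModule)); auto_derive; apply Hd. }
assert (E : RInt (fun y => a * cos (y * t) / (a ^ 2 + y ^ 2)) (- T) T
   = PI - 2 * atan (a / T) - RInt (fun y => a * (1 - cos (y * t)) / (a ^ 2 + y ^ 2)) (- T) T).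
{ apply (is_RInt_unique (V := R_CompleteNormedModule)).
  apply (is_RInt_ext (fun y => minus (a / (a ^ 2 + y ^ 2)) (a * (1 - cos (y * t)) / (a ^ 2 + y ^ 2)))).
  - intros y _; unfold minus, plus, opp; simpl; real_eq; field; pose proof (Hd y); nra.
  - apply (is_RInt_minus (V := R_NormedModule)); [exact HP |].
    apply (RInt_correct (V := R_CompleteNormedModule)), ex_RInt_continuous_all, Hc. }
assert (K : Rabs (RInt (fun y => a * (1 - cos (y * t)) / (a ^ 2 + y ^ 2)) (- T) T)
            <= (T - - T) * (a * t ^ 2 / 2)).
{ apply abs_RInt_le_const; [lra | apply ex_RInt_continuous_all, Hc |].
  intros y _; pose proof (one_minus_cos_bound (y * t)) as [K1 K2].
  pose proof (sum_sq_pos a y ltac:(lra)) as Hq.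
  rewrite Rabs_pos_eq by (apply Rmult_le_pos; [nra | left; apply Rinv_0_lt_compat, Hq]).
  apply Rmult_le_reg_r with (a ^ 2 + y ^ 2); [exact Hq |].
  replace (a * (1 - cos (y * t)) / (a ^ 2 + y ^ 2) * (a ^ 2 + y ^ 2)) with (a * (1 - cos (y * t)))
    by (field; lra).
  replace (a * t ^ 2 / 2 * (a ^ 2 + y ^ 2)) with (a * ((y * t) ^ 2 / 2 + t ^ 2 * a ^ 2 / 2)) by field.
  apply Rmult_le_compat_l; [lra |].
  pose proof (pow2_ge_0 (t * a)); nra. }
pose proof (atan_le_id (a / T) ltac:(apply Rlt_le, Rdiv_lt_0_compat; lra)) as [A1 A2].
assert (A3 : a / T <= a).
{ apply Rmult_le_reg_r with T; [lra |]; unfold Rdiv; rewrite Rmult_assoc, Rinv_l by lra; nra. }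
rewrite E; apply Rabs_le_between in K; apply Rabs_le; lra.
Qed.

(* No residue calculus is needed: moving the abscissa from [c] down to a small [a > 0]
   costs O(1/T), the integral at [- a] is O(1/T) because it can be moved to [- infinity],
   and the two are related by the Poisson integral of [line_re_reflect], which tends to
   [PI] as [a -> 0]. *)
Lemma line_re_bound (t T c : R) :
  0 < t -> 1 < T -> 1 < c ->
  Rabs (line_re t T c - 2 * PI) <= (4 * c * exp (c * t) + 4 / t + 2) / T.
Proof.
intros Ht HT Hc.
set (B := 4 / (t * T) + 2 / T).
(* Total error for a given [a]: the move from [c] to [a], the factor [exp (a t)] in front of [2 PI],
   the Poisson integral, and the line at [- a]. The quantity to be bounded does not depend on [a],
   so the value at 0 bounds it as well. *)
set (Psi := fun a => 4 * c * exp (c * t) / T + (exp (a * t) - 1) * (2 * PI)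
       + exp (a * t) * (2 * (a * (2 + t ^ 2 * T))) + exp (a * t) * exp (a * t) * B).
assert (H0 : Psi 0 = (4 * c * exp (c * t) + 4 / t + 2) / T).
{ unfold Psi, B; rewrite Rmult_0_l, exp_0; field; lra. }
rewrite <- H0.
assert (Hlim : filterlim Psi (at_right 0) (locally (Psi 0))).
{ apply continuous_at_right, (ex_derive_continuous (V := R_NormedModule) Psi); unfold Psi.
  auto_derive; trivial. }
assert (Hall : at_right 0 (fun a => Rabs (line_re t T c - 2 * PI) <= Psi a)).
{ exists (mkposreal 1 Rlt_0_1); intros a Ha1 Ha0.
  unfold ball in Ha1; simpl in Ha1; unfold AbsRing_ball, abs, minus, plus, opp in Ha1; simpl in Ha1.
  apply Rabs_def2 in Ha1.
  pose proof (line_re_right t T a c Ht ltac:(lra) Ha0 ltac:(lra)) as H1.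
  pose proof (line_re_left t T a Ht HT ltac:(lra)) as H2; fold B in H2.
  pose proof (poisson_cos_bound t T a Ht HT Ha0) as H3.
  pose proof (line_re_reflect t T a Ha0) as H4.
  set (J := RInt _ _ _) in *.
  assert (He1 : 1 <= exp (a * t)) by (rewrite <- exp_0; left; apply exp_increasing; nra).
  assert (He : exp (- a * t) * exp (a * t) = 1).
  { rewrite <- exp_plus; replace (- a * t + a * t) with 0 by ring; apply exp_0. }
  assert (E : line_re t T a = exp (a * t) * (2 * J) + exp (a * t) * exp (a * t) * line_re t T (- a)).
  { rewrite <- H4.
    transitivity (exp (- a * t) * exp (a * t) * line_re t T a); [rewrite He; ring | ring]. }
  set (e := exp (a * t)) in *.
  replace (line_re t T c - 2 * PI)
    with ((line_re t T c - line_re t T a) + (e - 1) * (2 * PI) + e * (2 * (J - PI))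
          + e * e * line_re t T (- a)) by (rewrite E; ring).
  unfold Psi; fold e; pose proof PI_RGT_0.
  refine (Rle_trans _ _ _ (Rabs_triang _ _) _); apply Rplus_le_compat.
  - refine (Rle_trans _ _ _ (Rabs_triang _ _) _); apply Rplus_le_compat.
    + refine (Rle_trans _ _ _ (Rabs_triang _ _) _); apply Rplus_le_compat; [exact H1 |].
      rewrite Rabs_pos_eq; nra.
    + rewrite !Rabs_mult, (Rabs_pos_eq e), (Rabs_pos_eq 2) by lra.
      apply Rmult_le_compat_l; lra.
  - rewrite !Rabs_mult, (Rabs_pos_eq e) by lra; apply Rmult_le_compat_l; nra. }
apply (filterlim_le (F := at_right 0) (fun _ => Rabs (line_re t T c - 2 * PI)) Psi
         (Rabs (line_re t T c - 2 * PI)) (Psi 0) Hall); [apply filterlim_const | exact Hlim].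
Qed.

(** * Line integrals of exp(wt)/w^(m+1) *)

Notation is_RInt_C := (@is_RInt C_R_NormedModule).

(** * Componentwise calculus for complex functions of a real variable *)

Definition C_derive (f : R -> C) (y : R) (d : C) : Prop :=
  is_derive (fun y => fst (f y)) y (fst d) /\ is_derive (fun y => snd (f y)) y (snd d).

Definition C_continuous (f : R -> C) (y : R) : Prop :=
  continuous (fun y => fst (f y)) y /\ continuous (fun y => snd (f y)) y.

Lemma C_derive_continuous (f : R -> C) (y : R) (d : C) : C_derive f y d -> C_continuous f y.
Proof.
intros [H1 H2]; split.
- apply (ex_derive_continuous (V := R_NormedModule) (fun y => fst (f y))); exists (fst d); exact H1.
- apply (ex_derive_continuous (V := R_NormedModule) (fun y => snd (f y))); exists (snd d); exact H2.
Qed.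

Lemma C_derive_mult (f g : R -> C) (y : R) (df dg : C) :
  C_derive f y df -> C_derive g y dg -> C_derive (fun y => f y * g y)%C y (df * g y + f y * dg)%C.
Proof.
intros [H1 H2] [K1 K2]; split; simpl.
- apply (is_derive_eq _ _ ((fst df * fst (g y) + fst (f y) * fst dg)
                           - (snd df * snd (g y) + snd (f y) * snd dg))); [| ring].
  apply (is_derive_minus (V := R_NormedModule) (fun y => fst (f y) * fst (g y)) (fun y => snd (f y) * snd (g y)));
    apply (is_derive_mult (K := R_AbsRing)); try assumption; apply Rmult_comm.
- apply (is_derive_eq _ _ ((fst df * snd (g y) + fst (f y) * snd dg)
                           + (snd df * fst (g y) + snd (f y) * fst dg))); [| ring].
  apply (is_derive_plus (V := R_NormedModule) (fun y => fst (f y) * snd (g y)) (fun y => snd (f y) * fst (g y)));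
    apply (is_derive_mult (K := R_AbsRing)); try assumption; apply Rmult_comm.
Qed.

Lemma C_continuous_mult (f g : R -> C) (y : R) :
  C_continuous f y -> C_continuous g y -> C_continuous (fun y => f y * g y)%C y.
Proof.
intros [H1 H2] [K1 K2]; split; simpl.
- apply (continuous_minus (V := R_NormedModule) (fun y => fst (f y) * fst (g y)) (fun y => snd (f y) * snd (g y)));
    apply (continuous_mult (K := R_AbsRing)); assumption.
- apply (continuous_plus (V := R_NormedModule) (fun y => fst (f y) * snd (g y)) (fun y => snd (f y) * fst (g y)));
    apply (continuous_mult (K := R_AbsRing)); assumption.
Qed.

Lemma C_continuous_minus (f g : R -> C) (y : R) :
  C_continuous f y -> C_continuous g y -> C_continuous (fun y => f y - g y)%C y.
Proof.
intros [H1 H2] [K1 K2]; split; simpl.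
- apply (continuous_minus (V := R_NormedModule) (fun y => fst (f y)) (fun y => fst (g y))); assumption.
- apply (continuous_minus (V := R_NormedModule) (fun y => snd (f y)) (fun y => snd (g y))); assumption.
Qed.

Lemma C_continuous_const (z : C) (y : R) : C_continuous (fun _ => z) y.
Proof. split; apply continuous_const. Qed.

Lemma C_continuous_line (c y : R) : C_continuous (fun y => (c, y)) y.
Proof. split; simpl; [apply continuous_const | apply continuous_id]. Qed.

Lemma C_continuous_Cexp (f : R -> C) (y : R) :
  C_continuous f y -> C_continuous (fun y => Cexp (f y)) y.
Proof.
intros [H1 H2]; unfold Cexp; split; simpl.
- apply (continuous_mult (K := R_AbsRing) (fun y => exp (fst (f y))) (fun y => cos (snd (f y)))).
  + apply (continuous_comp _ exp); [exact H1 |].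
    apply (ex_derive_continuous (V := R_NormedModule)); auto_derive; trivial.
  + apply (continuous_comp _ cos); [exact H2 | apply continuous_cos].
- apply (continuous_mult (K := R_AbsRing) (fun y => exp (fst (f y))) (fun y => sin (snd (f y)))).
  + apply (continuous_comp _ exp); [exact H1 |].
    apply (ex_derive_continuous (V := R_NormedModule)); auto_derive; trivial.
  + apply (continuous_comp _ sin); [exact H2 | apply continuous_sin].
Qed.

Lemma is_RInt_C_pair (f : R -> C) (a b : R) (l : C) :
  is_RInt (fun y => fst (f y)) a b (fst l) -> is_RInt (fun y => snd (f y)) a b (snd l) ->
  is_RInt_C f a b l.
Proof.
intros H1 H2; rewrite (surjective_pairing l).
apply (is_RInt_fct_extend_pair (U := R_NormedModule) (V := R_NormedModule)); assumption.
Qed.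

Lemma is_RInt_C_fst (f : R -> C) (a b : R) (l : C) :
  is_RInt_C f a b l -> is_RInt (fun y => fst (f y)) a b (fst l).
Proof. apply (is_RInt_fct_extend_fst (U := R_NormedModule) (V := R_NormedModule)). Qed.

Lemma is_RInt_C_snd (f : R -> C) (a b : R) (l : C) :
  is_RInt_C f a b l -> is_RInt (fun y => snd (f y)) a b (snd l).
Proof. apply (is_RInt_fct_extend_snd (U := R_NormedModule) (V := R_NormedModule)). Qed.

Lemma ex_RInt_C (f : R -> C) (a b : R) :
  (forall y, C_continuous f y) -> exists l : C, is_RInt_C f a b l.
Proof.
intros H; exists (RInt (fun y => fst (f y)) a b, RInt (fun y => snd (f y)) a b).
apply is_RInt_C_pair; apply (RInt_correct (V := R_CompleteNormedModule)), ex_RInt_continuous_all;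
  intros; apply H.
Qed.

Lemma is_RInt_C_mult (w : C) (f : R -> C) (a b : R) (l : C) :
  is_RInt_C f a b l -> is_RInt_C (fun y => w * f y)%C a b (w * l)%C.
Proof.
intros H; pose proof (is_RInt_C_fst _ _ _ _ H) as H1; pose proof (is_RInt_C_snd _ _ _ _ H) as H2.
apply is_RInt_C_pair; simpl.
- apply (is_RInt_minus (V := R_NormedModule)); apply (is_RInt_scal (V := R_NormedModule)); assumption.
- apply (is_RInt_plus (V := R_NormedModule)); apply (is_RInt_scal (V := R_NormedModule)); assumption.
Qed.

Lemma is_RInt_C_plus (f g : R -> C) (a b : R) (lf lg : C) :
  is_RInt_C f a b lf -> is_RInt_C g a b lg -> is_RInt_C (fun y => f y + g y)%C a b (lf + lg)%C.
Proof. apply (is_RInt_plus (V := C_R_NormedModule)). Qed.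

Lemma is_RInt_C_derive (f df : R -> C) (a b : R) :
  (forall y, C_derive f y (df y)) -> (forall y, C_continuous df y) ->
  is_RInt_C df a b (f b - f a)%C.
Proof.
intros H1 H2; apply is_RInt_C_pair.
- apply (is_RInt_derive (V := R_CompleteNormedModule) (fun y => fst (f y)) (fun y => fst (df y)));
    intros; [apply H1 | apply H2].
- apply (is_RInt_derive (V := R_CompleteNormedModule) (fun y => snd (f y)) (fun y => snd (df y)));
    intros; [apply H1 | apply H2].
Qed.

Lemma line_neq_0 (c y : R) : 0 < c -> ((c, y) : C) <> 0%C.
Proof. intros Hc H; injection H; lra. Qed.

Lemma C_derive_inv_line (c y : R) :
  0 < c -> C_derive (fun y => / (c, y))%C y (- Ci * (/ (c, y) * / (c, y)))%C.
Proof.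
intros Hc; pose proof (sum_sq_pos c y ltac:(lra)) as H; unfold Cinv; split; simpl in *.
- auto_derive; [lra | field; lra].
- auto_derive; [lra | field; lra].
Qed.

Lemma C_derive_Cpow_inv_line (c y : R) (m : nat) :
  0 < c -> C_derive (fun y => Cpow (/ (c, y)) m)%C y (- Ci * RtoC (INR m) * Cpow (/ (c, y)) (S m))%C.
Proof.
intros Hc; induction m as [| m IH].
- assert (E : (- Ci * RtoC (INR 0) * Cpow (/ (c, y)) 1)%C = RtoC 0)
    by (change (INR 0) with 0; ring).
  rewrite E; split; simpl; apply (is_derive_const (V := R_NormedModule)).
- pose proof (C_derive_mult _ _ _ _ _ (C_derive_inv_line c y Hc) IH) as H.
  replace (- Ci * RtoC (INR (S m)) * Cpow (/ (c, y)) (S (S m)))%C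
    with (- Ci * (/ (c, y) * / (c, y)) * Cpow (/ (c, y)) m
          + / (c, y) * (- Ci * RtoC (INR m) * Cpow (/ (c, y)) (S m)))%C; [exact H |].
  rewrite S_INR, RtoC_plus; simpl; ring.
Qed.

Lemma C_derive_Cexp_line (c t y : R) :
  C_derive (fun y => Cexp ((c, y) * RtoC t))%C y (Ci * RtoC t * Cexp ((c, y) * RtoC t))%C.
Proof.
unfold Cexp, Cmult, RtoC, Ci, Re, Im; split; simpl; (auto_derive; [trivial |]);
  replace (c * t - y * 0) with (c * t) by ring; replace (c * t + - (y * 0)) with (c * t) by ring; ring.
Qed.

Definition line_power (c t : R) (m : nat) (y : R) : C :=
  (Cexp ((c, y) * RtoC t) * Cpow (/ (c, y)) (S m))%C.

(** Integrated over the line, this is the integration by parts that expresses the integral for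
    [m + 1] as [t / (m + 1)] times the one for [m], up to boundary terms. *)
Lemma line_power_derive (c t y : R) (m : nat) :
  0 < c ->
  C_derive (line_power c t m) y
    (Ci * (RtoC t * line_power c t m y - RtoC (INR m + 1) * line_power c t (S m) y))%C.
Proof.
intros Hc.
pose proof (C_derive_mult _ _ _ _ _ (C_derive_Cexp_line c t y) (C_derive_Cpow_inv_line c y (S m) Hc)) as H.
unfold line_power; rewrite S_INR in H.
match type of H with C_derive _ _ ?d => match goal with |- C_derive _ _ ?d' => replace d' with d; [exact H | ring] end end.
Qed.

Lemma line_power_continuous (c t y : R) (m : nat) : 0 < c -> C_continuous (line_power c t m) y.
Proof. intros Hc; exact (C_derive_continuous _ _ _ (line_power_derive c t y m Hc)). Qed.

Lemma Cmod_inv_line (c y : R) : 0 < c -> Cmod (/ (c, y)) = / sqrt (c ^ 2 + y ^ 2).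
Proof. intros Hc; rewrite Cmod_inv by (apply line_neq_0, Hc); reflexivity. Qed.

Lemma sqrt_line_ge (c y : R) : 0 < c -> c <= sqrt (c ^ 2 + y ^ 2) /\ Rabs y <= sqrt (c ^ 2 + y ^ 2).
Proof.
intros Hc; split.
- rewrite <- (sqrt_pow2 c) at 1 by lra; apply sqrt_le_1_alt; nra.
- rewrite <- (sqrt_pow2 (Rabs y)) by apply Rabs_pos; apply sqrt_le_1_alt; rewrite pow2_abs; nra.
Qed.

Lemma line_power_lim (c t : R) (m : nat) (s : R) :
  1 < c -> Rabs s = 1 ->
  filterlim (fun T => line_power c t m (s * T)) (Rbar_locally p_infty)
    (locally (T := C_R_NormedModule) (RtoC 0)).
Proof.
intros Hc Hs.
assert (Hb : forall T, 0 < T -> Cmod (line_power c t m (s * T)) <= exp (c * t) / T).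
{ intros T HT; unfold line_power; rewrite Cmod_mult, Cmod_Cexp, Cmod_Cpow, Cmod_inv_line by lra.
  replace (Re ((c, s * T) * RtoC t)) with (c * t) by (simpl; ring).
  apply Rmult_le_compat_l; [apply Rlt_le, exp_pos |].
  destruct (sqrt_line_ge c (s * T) ltac:(lra)) as [H1 H2].
  rewrite Rabs_mult, Hs, Rmult_1_l, Rabs_pos_eq in H2 by lra.
  set (q := sqrt _) in *.
  assert (Hq : 0 < / q <= 1).
  { split; [apply Rinv_0_lt_compat; lra | rewrite <- Rinv_1; apply Rinv_le_contravar; lra]. }
  assert (/ q <= / T) by (apply Rinv_le_contravar; lra).
  assert (0 <= (/ q) ^ m <= 1).
  { split; [apply pow_le; lra | rewrite <- (pow1 m); apply pow_incr; lra]. }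
  simpl; nra. }
assert (HL : is_lim (fun T => exp (c * t) / T) p_infty 0).
{ replace (Finite 0) with (Rbar_mult (exp (c * t)) 0) by (simpl; f_equal; ring).
  apply is_lim_scal_l, (is_lim_inv (fun T => T) p_infty p_infty); [apply is_lim_id | discriminate]. }
assert (Hc0 : forall f : R -> R, (forall T, 0 < T -> Rabs (f T) <= exp (c * t) / T) -> is_lim f p_infty 0).
{ intros f Hf; apply (is_lim_le_le_loc (fun T => - (exp (c * t) / T)) (fun T => exp (c * t) / T)).
  - exists 0; intros T HT; apply Rabs_le_between, Hf, HT.
  - replace (Finite 0) with (Rbar_opp 0) by (simpl; f_equal; ring); apply is_lim_opp, HL.
  - exact HL. }
apply filterlim_C; simpl; apply Hc0; intros T HT; apply Rle_trans with (2 := Hb T HT);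
  refine (Rle_trans _ _ _ _ (Rmax_Cmod _)); [apply Rmax_l | apply Rmax_r].
Qed.

Lemma line_power_0 (c t y : R) :
  0 < c -> line_power c t 0 y = (kernel_re t c y, kernel_im t c y).
Proof.
intros Hc; pose proof (sum_sq_pos c y ltac:(lra)) as H.
unfold line_power, kernel_re, kernel_im, Cexp, Cinv, Cmult, RtoC, Re, Im; simpl in *.
replace (c * t - y * 0) with (c * t) by ring; replace (c * 0 + y * t) with (y * t) by ring.
f_equal; field; lra.
Qed.

Lemma filterlim_C_mult {T : Type} {F : (T -> Prop) -> Prop} {FF : Filter F} (w : C) (f : T -> C) (l : C) :
  filterlim f F (locally (T := C_R_NormedModule) l) ->
  filterlim (fun x => w * f x)%C F (locally (T := C_R_NormedModule) (w * l)%C).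
Proof.
intros H; pose proof (filterlim_fst_C _ _ H) as H1; pose proof (filterlim_snd_C _ _ H) as H2.
assert (Hs : forall (g : T -> R) (k r : R), filterlim g F (locally r) ->
   filterlim (fun x => k * g x) F (locally (k * r))).
{ intros g k r Hg; apply (filterlim_comp _ _ _ g (Rmult k) F (locally r)); [exact Hg |].
  apply (filterlim_scal_r (K := R_AbsRing) (V := R_NormedModule) k r). }
apply filterlim_C; simpl.
- apply (filterlim_comp_2 (G := locally (fst w * fst l)) (H := locally (- (snd w * snd l))))
    with (f := fun x => fst w * fst (f x)) (g := fun x => - (snd w * snd (f x))) (h := Rplus).
  + apply Hs, H1.
  + apply (filterlim_comp _ _ _ (fun x => snd w * snd (f x)) Ropp F (locally (snd w * snd l)));
      [apply Hs, H2 | apply (filterlim_opp (V := R_NormedModule))].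
  + apply (filterlim_plus (V := R_NormedModule)).
- apply (filterlim_comp_2 (G := locally (fst w * snd l)) (H := locally (snd w * fst l)))
    with (f := fun x => fst w * snd (f x)) (g := fun x => snd w * fst (f x)) (h := Rplus).
  + apply Hs, H2.
  + apply Hs, H1.
  + apply (filterlim_plus (V := R_NormedModule)).
Qed.

Lemma filterlim_C_plus {T : Type} {F : (T -> Prop) -> Prop} {FF : Filter F} (f g : T -> C) (l k : C) :
  filterlim f F (locally (T := C_R_NormedModule) l) ->
  filterlim g F (locally (T := C_R_NormedModule) k) ->
  filterlim (fun x => f x + g x)%C F (locally (T := C_R_NormedModule) (l + k)%C).
Proof.
intros H K.
apply (filterlim_comp_2 (G := locally (T := C_R_NormedModule) l) (H := locally (T := C_R_NormedModule) k) _ _ Cplus);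
  [exact H | exact K | apply (filterlim_plus (V := C_R_NormedModule))].
Qed.

Lemma line_re_lim (c t : R) :
  1 < c -> 0 < t -> is_lim (fun T => line_re t T c) p_infty (2 * PI).
Proof.
intros Hc Ht; set (Q := 4 * c * exp (c * t) + 4 / t + 2).
assert (HL : is_lim (fun T => Q / T) p_infty 0).
{ replace (Finite 0) with (Rbar_mult Q 0) by (simpl; f_equal; ring).
  apply is_lim_scal_l, (is_lim_inv (fun T => T) p_infty p_infty); [apply is_lim_id | discriminate]. }
apply (is_lim_le_le_loc (fun T => 2 * PI - Q / T) (fun T => 2 * PI + Q / T)).
- exists 1; intros T HT; pose proof (line_re_bound t T c Ht HT Hc) as H; fold Q in H.
  apply Rabs_le_between in H; lra.
- assert (H := is_lim_minus' (fun _ => 2 * PI) _ _ _ _ (is_lim_const _ _) HL).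
  rewrite Rminus_0_r in H; exact H.
- assert (H := is_lim_plus' (fun _ => 2 * PI) _ _ _ _ (is_lim_const _ _) HL).
  rewrite Rplus_0_r in H; exact H.
Qed.

(** Induction on [m] by parts, the boundary terms vanishing by [line_power_lim]. Only [m = 0] needs
    the delicate estimate on [line_re]; there the imaginary part is odd in [y] and integrates to 0
    for every [T]. *)
Lemma line_power_integral (c t : R) (m : nat) :
  1 < c -> 0 < t ->
  exists L : R -> C, (forall T, is_RInt_C (line_power c t m) (- T) T (L T)) /\
    filterlim L (Rbar_locally p_infty)
      (locally (T := C_R_NormedModule) (RtoC (2 * PI * (t ^ m / INR (fact m))))).
Proof.
intros Hc Ht; induction m as [| m [L [HL1 HL2]]].
- exists (fun T => RtoC (line_re t T c)); split.
  + intros T; apply (is_RInt_ext (V := C_R_NormedModule) (fun y => (kernel_re t c y, kernel_im t c y))).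
    { intros y _; symmetry; apply line_power_0; lra. }
    assert (Him : ex_RInt (kernel_im t c) (- T) T)
      by (apply ex_RInt_continuous_all; intros y; apply kernel_im_continuous; lra).
    apply is_RInt_C_pair; simpl.
    * apply (RInt_correct (V := R_CompleteNormedModule)), ex_RInt_continuous_all.
      intros y; apply kernel_re_continuous; lra.
    * replace 0 with (RInt (kernel_im t c) (- T) T).
      { apply (RInt_correct (V := R_CompleteNormedModule)), Him. }
      apply RInt_odd_reflection; [exact Him |]; intros y.
      replace (- T + T - y) with (- y) by ring; unfold kernel_im.
      replace (- y * t) with (- (y * t)) by ring; rewrite cos_neg, sin_neg.
      pose proof (sum_sq_pos c y ltac:(lra)); field; nra.
  + apply filterlim_C; simpl; [| apply filterlim_const].
    replace (2 * PI * (1 / 1)) with (2 * PI) by field; apply line_re_lim; assumption.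
- pose proof (pos_INR m) as Hm.
  set (k := RtoC (/ (INR m + 1))).
  exists (fun T => k * (RtoC t * L T + Ci * (line_power c t m T + - (1) * line_power c t m (- T))))%C; split.
  + intros T.
    (* The inner [Ci * (...)] is the derivative of [line_power c t m]. The outer [Ci] makes the
       product [- t] times the [m]-th function plus [m + 1] times the next, so the [m]-th function
       cancels. *)
    apply (is_RInt_ext (V := C_R_NormedModule) (fun y => k * (RtoC t * line_power c t m y +
       Ci * (Ci * (RtoC t * line_power c t m y - RtoC (INR m + 1) * line_power c t (S m) y))))%C).
    { intros y _; unfold k; complex_eq.
      transitivity (RtoC (/ (INR m + 1)) * RtoC (INR m + 1) * line_power c t (S m) y)%C.
      - replace (Ci * (Ci * (RtoC t * line_power c t m y - RtoC (INR m + 1) * line_power c t (S m) y)))%C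
          with (Ci * Ci * (RtoC t * line_power c t m y - RtoC (INR m + 1) * line_power c t (S m) y))%C by ring.
        replace (Ci * Ci)%C with (- (1))%C by (unfold Ci, Cmult, RtoC, Copp; simpl; f_equal; ring).
        ring.
      - rewrite <- RtoC_mult, Rinv_l by lra; apply Cmult_1_l. }
    apply is_RInt_C_mult, is_RInt_C_plus; apply is_RInt_C_mult; [apply HL1 |].
    replace (line_power c t m T + - (1) * line_power c t m (- T))%C
      with (line_power c t m T - line_power c t m (- T))%C by ring.
    apply (is_RInt_C_derive (line_power c t m)).
    * intros y; apply line_power_derive; lra.
    * intros y; apply C_continuous_mult; [apply C_continuous_const |].
      apply C_continuous_minus; (apply C_continuous_mult;
        [apply C_continuous_const | apply line_power_continuous; lra]).
  + replace (RtoC (2 * PI * (t ^ S m / INR (fact (S m)))))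
      with (k * (RtoC t * RtoC (2 * PI * (t ^ m / INR (fact m))) + Ci * (0 + - (1) * 0)))%C.
    * apply filterlim_C_mult, filterlim_C_plus; apply filterlim_C_mult; [exact HL2 |].
      apply filterlim_C_plus; [| apply filterlim_C_mult].
      -- apply (filterlim_ext (fun T => line_power c t m (1 * T))); [intros; f_equal; ring |].
         apply line_power_lim; [exact Hc | apply Rabs_R1].
      -- apply (filterlim_ext (fun T => line_power c t m (-1 * T))); [intros; f_equal; ring |].
         apply line_power_lim; [exact Hc | rewrite Rabs_left; lra].
    * unfold k; transitivity (RtoC (/ (INR m + 1)) * (RtoC t * RtoC (2 * PI * (t ^ m / INR (fact m)))))%C; [ring |].
      rewrite <- !RtoC_mult, fact_simpl, mult_INR, S_INR; f_equal; simpl pow.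
      pose proof (INR_fact_lt_0 m); field; lra.
Qed.

(** * Integration along the vertical line *)

Definition C_RInt (f : R -> C) (a b : R) : C :=
  (RInt (fun y => fst (f y)) a b, RInt (fun y => snd (f y)) a b).

Lemma C_RInt_unique (f : R -> C) (a b : R) (l : C) : is_RInt_C f a b l -> C_RInt f a b = l.
Proof.
intros H; unfold C_RInt.
rewrite (is_RInt_unique (V := R_CompleteNormedModule) _ _ _ _ (is_RInt_C_fst _ _ _ _ H)).
rewrite (is_RInt_unique (V := R_CompleteNormedModule) _ _ _ _ (is_RInt_C_snd _ _ _ _ H)).
symmetry; apply surjective_pairing.
Qed.

Lemma C_RInt_correct (f : R -> C) (a b : R) :
  (forall y, C_continuous f y) -> is_RInt_C f a b (C_RInt f a b).
Proof.
intros H; destruct (ex_RInt_C f a b H) as [l Hl].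
rewrite (C_RInt_unique _ _ _ _ Hl); exact Hl.
Qed.

Lemma line_power_RInt_lim (c t : R) (m : nat) :
  1 < c -> 0 < t ->
  filterlim (fun T => C_RInt (line_power c t m) (- T) T) (Rbar_locally p_infty)
    (locally (T := C_R_NormedModule) (RtoC (2 * PI * (t ^ m / INR (fact m))))).
Proof.
intros Hc Ht; destruct (line_power_integral c t m Hc Ht) as [L [H1 H2]].
revert H2; apply filterlim_ext; intros T; symmetry; apply C_RInt_unique, H1.
Qed.

Definition line_sum (c t : R) (a : nat -> R) (M : nat) (y : R) : C :=
  @sum_n C_R_NormedModule (fun m => RtoC (a m) * line_power c t m y)%C M.

Definition line_sum_RInt (c t : R) (a : nat -> R) (M : nat) (T : R) : C :=
  @sum_n C_R_NormedModule (fun m => RtoC (a m) * C_RInt (line_power c t m) (- T) T)%C M.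

Lemma is_RInt_line_sum (c t : R) (a : nat -> R) (M : nat) (T : R) :
  0 < c -> is_RInt_C (line_sum c t a M) (- T) T (line_sum_RInt c t a M T).
Proof.
intros Hc.
assert (H : forall m, is_RInt_C (fun y => RtoC (a m) * line_power c t m y)%C (- T) T
                        (RtoC (a m) * C_RInt (line_power c t m) (- T) T)%C).
{ intros m; apply is_RInt_C_mult, C_RInt_correct; intros y; apply line_power_continuous, Hc. }
unfold line_sum, line_sum_RInt; induction M as [| M IH].
- rewrite sum_O; apply (is_RInt_ext (V := C_R_NormedModule)) with (2 := H 0%nat).
  intros y _; rewrite sum_O; reflexivity.
- rewrite sum_Sn; apply (is_RInt_ext (V := C_R_NormedModule)) with (2 := is_RInt_C_plus _ _ _ _ _ _ IH (H (S M))).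
  intros y _; rewrite sum_Sn; reflexivity.
Qed.

Lemma line_sum_RInt_lim (c t : R) (a : nat -> R) (M : nat) :
  1 < c -> 0 < t ->
  filterlim (line_sum_RInt c t a M) (Rbar_locally p_infty)
    (locally (T := C_R_NormedModule)
       (RtoC (2 * PI * sum_n (fun m => a m * (t ^ m / INR (fact m))) M))).
Proof.
intros Hc Ht.
assert (H : forall m, filterlim (fun T => RtoC (a m) * C_RInt (line_power c t m) (- T) T)%C
   (Rbar_locally p_infty) (locally (T := C_R_NormedModule) (RtoC (2 * PI * (a m * (t ^ m / INR (fact m))))))).
{ intros m; replace (RtoC (2 * PI * (a m * (t ^ m / INR (fact m)))))
    with (RtoC (a m) * RtoC (2 * PI * (t ^ m / INR (fact m))))%C
    by (rewrite <- RtoC_mult; f_equal; ring).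
  apply filterlim_C_mult, line_power_RInt_lim; assumption. }
unfold line_sum_RInt; induction M as [| M IH].
- rewrite sum_O; generalize (H 0%nat); apply filterlim_ext; intros T; rewrite sum_O; reflexivity.
- rewrite sum_Sn.
  replace (RtoC (2 * PI * plus (sum_n (fun m => a m * (t ^ m / INR (fact m))) M)
                                (a (S M) * (t ^ S M / INR (fact (S M))))))
    with (Cplus (RtoC (2 * PI * sum_n (fun m => a m * (t ^ m / INR (fact m))) M))
            (RtoC (2 * PI * (a (S M) * (t ^ S M / INR (fact (S M)))))))
    by (rewrite <- RtoC_plus; f_equal; unfold plus; cbn -[fact pow INR]; ring).
  generalize (filterlim_C_plus _ _ _ _ IH (H (S M))); apply filterlim_ext.
  intros T; rewrite sum_Sn; reflexivity.
Qed.

(** Interchange of the limits in [M] and [T]: the approximation error is uniform in [T], so one [M]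
    is fixed first and the three errors are each made less than [eps / 3]. *)
Lemma filterlim_uniform_approx (F : R -> C) (A : nat -> R -> C) (a : nat -> C) (V : C) (e : nat -> R) :
  (forall M T, 0 < T -> Cmod (F T - A M T) <= e M) -> is_lim_seq e 0 ->
  (forall M, filterlim (A M) (Rbar_locally p_infty) (locally (T := C_R_NormedModule) (a M))) ->
  filterlim a eventually (locally (T := C_R_NormedModule) V) ->
  filterlim F (Rbar_locally p_infty) (locally (T := C_R_NormedModule) V).
Proof.
intros HF He HA Ha; apply (filterlim_locally_ball_norm (U := C_R_NormedModule)); intros eps.
assert (Hp : 0 < eps / 3) by (pose proof (cond_pos eps); lra).
set (d := mkposreal _ Hp).
apply is_lim_seq_spec in He; destruct (He d) as [N1 HN1].
destruct (proj1 (filterlim_locally_ball_norm (U := C_R_NormedModule) _ _) Ha d) as [N2 HN2].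
set (N := max N1 N2); specialize (HN1 N ltac:(lia)); specialize (HN2 N ltac:(lia)).
assert (Hpos : Rbar_locally p_infty (fun T => 0 < T)) by (exists 0; trivial).
generalize (filter_and _ _ (proj1 (filterlim_locally_ball_norm (U := C_R_NormedModule) _ _) (HA N) d) Hpos).
apply filter_imp; intros T [H1 HT]; specialize (HF N T HT).
unfold ball_norm in *; rewrite norm_Cmod in *.
change (Cmod (A N T - a N) < eps / 3) in H1; change (Cmod (a N - V) < eps / 3) in HN2.
change (Cmod (F T - V) < eps); change (Rabs (e N - 0) < eps / 3) in HN1.
rewrite Rminus_0_r in HN1; pose proof (Rle_abs (e N)).
replace (F T - V)%C with (F T - A N T + ((A N T - a N) + (a N - V)))%C by ring.
pose proof (Cmod_triangle (F T - A N T) ((A N T - a N) + (a N - V))).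
pose proof (Cmod_triangle (A N T - a N) (a N - V)); lra.
Qed.

Lemma sum_n_geom_succ (q : R) (M : nat) :
  q <> 1 -> sum_n (fun m => q ^ S m) M = q / (1 - q) - q ^ (M + 2) / (1 - q).
Proof.
intros Hq; induction M as [| M IH].
- rewrite sum_O; simpl; field; lra.
- rewrite sum_Sn, IH.
  replace (S M + 2)%nat with (S (S (S M))) by lia; replace (M + 2)%nat with (S (S M)) by lia.
  unfold plus; simpl; field; lra.
Qed.


(** * The branch on the vertical line and the passage to the limit *)

Lemma branch_off_cut (c y : R) : 1 < c -> ~ on_cut (c, y).
Proof. intros Hc [_ H]; simpl in H; lra. Qed.

Lemma branch_continuous (S : C -> C) (c y : R) :
  is_sqrt_w2m1_branch S -> 1 < c -> C_continuous (fun y => S (c, y)) y.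
Proof.
intros [HS _] Hc.
pose proof (ex_derive_continuous (K := C_AbsRing) (V := C_NormedModule) _ _
              (HS _ (branch_off_cut c y Hc))) as H.
assert (K : forall eps : posreal, locally y (fun z => ball (M := C_R_NormedModule) (S (c, y)) eps (S (c, z)))).
{ intros eps; destruct (proj1 (filterlim_locally _ _) H eps) as [d Hd].
  exists d; intros z Hz; apply Hd.
  change (Cmod ((c, z) - (c, y)) < d)%R.
  replace ((c, z) - (c, y))%C with ((0, z - y) : C)
    by (unfold Cminus, Cplus, Copp; simpl; f_equal; ring).
  unfold Cmod; simpl; rewrite Rmult_0_l, Rplus_0_l, Rmult_1_r.
  change ((z - y) * (z - y)) with (Rsqr (z - y)); rewrite sqrt_Rsqr_abs; exact Hz. }
split; apply filterlim_locally; intros eps; generalize (K eps); apply filter_imp;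
  intros z [K1 K2]; assumption.
Qed.

Lemma branch_conj_root (S : C -> C) (w : C) :
  is_sqrt_w2m1_branch S -> ~ on_cut w -> ((w + S w) * (w - S w) = 1)%C.
Proof.
intros [_ [HS _]] Hw.
transitivity (w * w - S w * S w)%C; [ring | rewrite (HS w Hw); ring].
Qed.

Lemma C_continuous_Cmod (f : R -> C) (y : R) :
  C_continuous f y -> continuous (fun y => Cmod (f y)) y.
Proof.
intros [H1 H2]; unfold Cmod.
apply (continuous_comp (fun y => fst (f y) ^ 2 + snd (f y) ^ 2) sqrt).
- apply (continuous_plus (V := R_NormedModule) (fun y => fst (f y) ^ 2) (fun y => snd (f y) ^ 2)).
  + apply (continuous_comp (fun y => fst (f y)) (fun u => u ^ 2)); [exact H1 | continuity_by_derive].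
  + apply (continuous_comp (fun y => snd (f y)) (fun u => u ^ 2)); [exact H2 | continuity_by_derive].
- apply continuity_pt_filterlim, continuity_pt_sqrt; nra.
Qed.

(* On the line [Re w = c > 1] the modulus of [w - S w] cannot cross 1: at modulus 1
   also [|w + S w| = 1], so [|w| <= 1]. *)
Lemma branch_small_root (S : C -> C) (c y : R) :
  is_sqrt_w2m1_branch S -> 1 < c -> Cmod ((c, y) - S (c, y)) <= 1.
Proof.
intros HS Hc.
set (g := fun y => Cmod ((c, y) - S (c, y))).
assert (Hg : forall y, continuous g y).
{ intros z; apply C_continuous_Cmod, C_continuous_minus;
    [apply C_continuous_line | apply branch_continuous; assumption]. }
assert (Hprod : forall z, Cmod ((c, z) + S (c, z)) * g z = 1).
{ intros z; unfold g; rewrite <- Cmod_mult, (branch_conj_root S _ HS (branch_off_cut c z Hc)).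
  apply Cmod_1. }
assert (Hne : forall z, g z <> 1).
{ intros z Hz; pose proof (Hprod z) as Hp; rewrite Hz, Rmult_1_r in Hp.
  pose proof (Cmod_triangle ((c, z) + S (c, z)) ((c, z) - S (c, z))) as Ht.
  replace ((c, z) + S (c, z) + ((c, z) - S (c, z)))%C with (2 * (c, z))%C in Ht by ring.
  rewrite Cmod_mult, Cmod_R, Rabs_pos_eq in Ht by lra; unfold g in Hz; rewrite Hp, Hz in Ht.
  pose proof (Re_le_Cmod (c, z)) as K; simpl in K; pose proof (Rle_abs c); lra. }
(* At the real point [c] the branch has positive real part, so [|w + S w| > 1], and the product of
   the two moduli is 1. *)
assert (H0 : g 0 <= 1).
{ destruct HS as [_ [_ HS3]]; destruct (HS3 c Hc) as [Hi Hr].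
  pose proof (Hprod 0) as Hp; pose proof (Re_le_Cmod ((c, 0) + S (c, 0))) as K.
  change (RtoC c) with ((c, 0) : C) in Hr; simpl in K.
  change (fst (S (c, 0))) with (Re (S (c, 0))) in K.
  pose proof (Rle_abs (c + Re (S (c, 0)))).
  pose proof (Cmod_ge_0 ((c, 0) - S (c, 0))) as Hg0; fold (g 0) in Hg0; nra. }
fold (g y); destruct (Rle_lt_dec (g y) 1) as [H | H]; [exact H | exfalso].
destruct (IVT_gen g 0 y 1) as [z [_ Hz]].
- intros z; apply continuity_pt_filterlim, Hg.
- rewrite Rmin_left, Rmax_right by lra; lra.
- exact (Hne z Hz).
Qed.

Definition transform (x : C) : C := (Cexp (RtoC (/ 2) * (1 - x * x)) * x)%C.

(** With [x = w - S w], the equation of the branch gives [1 / (w + S w) = x] and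
    [x^2 = 2 w^2 - 2 w S w - 1]; the latter turns [(1 - x^2) / 2] into the given exponent. *)
Lemma integrand_eq (S : C -> C) (t : R) (w : C) :
  is_sqrt_w2m1_branch S -> ~ on_cut w ->
  integrand S t w = (Cexp (w * RtoC t) * transform (w - S w))%C.
Proof.
intros HS Hw; pose proof (branch_conj_root S w HS Hw) as H.
destruct HS as [_ [HS _]]; specialize (HS w Hw).
unfold integrand, transform.
replace (RtoC (/ 2) * (1 - (w - S w) * (w - S w)))%C with (w * S w - w * w + 1)%C.
- assert (Hn : (w + S w <> 0)%C).
  { intros K; rewrite K, Cmult_0_l in H; injection H; lra. }
  replace (w - S w)%C with (/ (w + S w))%C; [unfold Cdiv; ring |].
  transitivity (/ (w + S w) * ((w + S w) * (w - S w)))%C; [rewrite H; ring | field; exact Hn].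
- transitivity (RtoC (/ 2) * (2 * (w * S w - w * w + 1)))%C.
  + rewrite Cmult_assoc, <- RtoC_mult, Rinv_l by lra; ring.
  + f_equal; transitivity (1 - w * w + 2 * (w * S w) - (w * w - 1))%C; [ring | rewrite <- HS; ring].
Qed.

(** The remainder starts at [q^(M+2)] with [q = 1/|w|]. Two of these powers are kept as
    [1 / (c^2 + y^2)] for integrability along the line; the other [M] are bounded by [c^(-M)] for
    smallness. The numerator [c] in the last factor prepares the Poisson integral. *)
Lemma transform_approx (S : C -> C) (c t y : R) (M : nat) :
  is_sqrt_w2m1_branch S -> 1 < c ->
  Cmod (Cexp ((c, y) * RtoC t) * transform ((c, y) - S (c, y)) - line_sum c t jump_moment M y)
  <= exp (c * t) * (exp (/ 2) * exp 1) / (1 - / c) / c * (/ c) ^ M * (c / (c ^ 2 + y ^ 2)).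
Proof.
intros HS Hc; set (w := ((c, y) : C)); set (u := (/ w)%C); set (q := Cmod u).
assert (Hw : w <> 0%C) by (apply line_neq_0; lra).
assert (Hq : q = / sqrt (c ^ 2 + y ^ 2)) by (apply Cmod_inv_line; lra).
destruct (sqrt_line_ge c y ltac:(lra)) as [Hr _].
assert (Hc1 : 0 < / c < 1).
{ split; [apply Rinv_0_lt_compat; lra | rewrite <- Rinv_1; apply Rinv_lt_contravar; lra]. }
assert (Hqc : 0 < q <= / c).
{ rewrite Hq; split; [apply Rinv_0_lt_compat; lra | apply Rinv_le_contravar; lra]. }
assert (Hq2 : q * q = / (c ^ 2 + y ^ 2)).
{ rewrite Hq, <- Rinv_mult, sqrt_sqrt; [reflexivity | nra]. }
set (x := (w - S w)%C); set (D := exp (c * t) * (exp (/ 2) * exp 1)).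
assert (HD : 0 < D) by (repeat apply Rmult_lt_0_compat; apply exp_pos).
assert (Hx : (2 * w * x = 1 + x * x)%C).
{ unfold x; destruct HS as [_ [HS _]]; specialize (HS w (branch_off_cut c y Hc)).
  transitivity (2 * (w * w) - 2 * (w * S w))%C; [ring |].
  transitivity (1 + (w * w - 2 * (w * S w) + (w * w - 1)))%C; [ring | rewrite <- HS; ring]. }
pose proof (jump_moment_series u w x (Cinv_r w Hw) ltac:(fold q; lra) Hx
              (branch_small_root S c y HS Hc)) as Hs.
apply (is_series_C_mult (Cexp (w * RtoC t))) in Hs.
assert (Hgeo := is_series_Rmult_l D _ _ (is_series_geom_succ q ltac:(rewrite Rabs_pos_eq; lra))).
assert (Hb : forall m, @norm R_AbsRing C_R_NormedModule
    (Cexp (w * RtoC t) * (RtoC (jump_moment m) * Cpow u (Datatypes.S m)))%C <= D * q ^ Datatypes.S m).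
{ intros m; rewrite norm_Cmod, !Cmod_mult, Cmod_Cexp, Cmod_R, Cmod_Cpow; fold q.
  replace (Re (w * RtoC t)) with (c * t) by (simpl; ring).
  pose proof (jump_moment_bound m); pose proof (Rabs_pos (jump_moment m)).
  pose proof (pow_le q (Datatypes.S m) ltac:(lra)); pose proof (exp_pos (c * t)).
  unfold D; rewrite Rmult_assoc; apply Rmult_le_compat_l; [lra |].
  apply Rmult_le_compat_r; assumption. }
pose proof (series_tail_bound _ _ _ _ M Hb Hs Hgeo) as H; rewrite norm_Cmod in H.
replace (line_sum c t jump_moment M y) with (@sum_n C_R_NormedModule
    (fun m => Cexp (w * RtoC t) * (RtoC (jump_moment m) * Cpow u (Datatypes.S m)))%C M).
2:{ apply sum_n_ext; intros m; unfold line_power; fold w; fold u; complex_eq; ring. }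
apply Rle_trans with (1 := H).
assert (E : sum_n (fun m => D * q ^ Datatypes.S m) M = D * sum_n (fun m => q ^ Datatypes.S m) M)
  by exact (sum_n_mult_l (K := R_Ring) D _ M).
rewrite E, sum_n_geom_succ by lra.
replace (D * (q / (1 - q)) - D * (q / (1 - q) - q ^ (M + 2) / (1 - q)))
  with (D * (q ^ M * (q * q) * / (1 - q))) by (rewrite pow_add; field; lra).
rewrite Hq2; pose proof (sum_sq_pos c y ltac:(lra)) as Hp.
replace (D / (1 - / c) / c * (/ c) ^ M * (c / (c ^ 2 + y ^ 2)))
  with (D * ((/ c) ^ M * / (c ^ 2 + y ^ 2) * / (1 - / c))) by (field; repeat split; lra).
apply Rmult_le_compat_l; [lra |].
pose proof (Rinv_0_lt_compat _ Hp).
assert (0 <= q ^ M <= (/ c) ^ M) by (split; [apply pow_le; lra | apply pow_incr; lra]).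
assert (0 < / (1 - q) <= / (1 - / c)).
{ split; [apply Rinv_0_lt_compat; lra | apply Rinv_le_contravar; lra]. }
apply Rmult_le_compat; nra.
Qed.

Lemma transform_continuous (S : C -> C) (c t y : R) :
  is_sqrt_w2m1_branch S -> 1 < c ->
  C_continuous (fun y => Cexp ((c, y) * RtoC t) * transform ((c, y) - S (c, y)))%C y.
Proof.
intros HS Hc.
assert (Hx : C_continuous (fun y => (c, y) - S (c, y))%C y).
{ apply C_continuous_minus; [apply C_continuous_line | apply branch_continuous; assumption]. }
apply C_continuous_mult.
- apply C_continuous_Cexp, C_continuous_mult; [apply C_continuous_line | apply C_continuous_const].
- apply (C_continuous_mult (fun y => Cexp (RtoC (/ 2) * (1 - ((c, y) - S (c, y)) * ((c, y) - S (c, y)))))%C);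
    [| exact Hx].
  apply C_continuous_Cexp, C_continuous_mult; [apply C_continuous_const |].
  apply C_continuous_minus; [apply C_continuous_const | apply C_continuous_mult; exact Hx].
Qed.

Lemma transform_RInt_lim (S : C -> C) (c t : R) :
  is_sqrt_w2m1_branch S -> 1 < c -> 0 < t ->
  filterlim (fun T => C_RInt (fun y => Cexp ((c, y) * RtoC t) * transform ((c, y) - S (c, y)))%C (- T) T)
    (Rbar_locally p_infty)
    (locally (T := C_R_NormedModule)
       (RtoC (2 * PI * (/ PI * RInt (fun x => sin x * jump x * cosh (t * cos x)) 0 PI)))).
Proof.
intros HS Hc Ht.
set (D := exp (c * t) * (exp (/ 2) * exp 1) / (1 - / c) / c).
assert (Hc1 : 0 < / c < 1).
{ split; [apply Rinv_0_lt_compat; lra | rewrite <- Rinv_1; apply Rinv_lt_contravar; lra]. }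
assert (HD : 0 < D).
{ pose proof (exp_pos (c * t)); pose proof (exp_pos (/ 2)); pose proof (exp_pos 1).
  unfold D; repeat apply Rdiv_lt_0_compat; try lra; repeat apply Rmult_lt_0_compat; assumption. }
apply (filterlim_uniform_approx _ (line_sum_RInt c t jump_moment)
  (fun M => RtoC (2 * PI * sum_n (fun m => jump_moment m * (t ^ m / INR (fact m))) M)) _
  (fun M => D * PI * (/ c) ^ M)).
- intros M T HT; rewrite <- norm_Cmod.
  (* The Poisson integral of the pointwise bound stays below [PI] for every [T], which makes the
     error uniform. *)
  apply Rle_trans with (D * (/ c) ^ M * (PI - 2 * atan (c / T))).
  + apply (norm_RInt_le (V := C_R_NormedModule)
      (fun y => Cexp ((c, y) * RtoC t) * transform ((c, y) - S (c, y)) - line_sum c t jump_moment M y)%C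
      (fun y => D * (/ c) ^ M * (c / (c ^ 2 + y ^ 2))) (- T) T); [lra | | |].
    * intros y _; rewrite norm_Cmod; apply transform_approx; assumption.
    * apply (is_RInt_minus (V := C_R_NormedModule)).
      -- apply C_RInt_correct; intros y; apply transform_continuous; assumption.
      -- apply is_RInt_line_sum; lra.
    * apply (is_RInt_scal (V := R_NormedModule) _ _ _ (D * (/ c) ^ M)), RInt_poisson; lra.
  + pose proof (atan_le_id (c / T) ltac:(apply Rlt_le, Rdiv_lt_0_compat; lra)) as [K _].
    pose proof (pow_lt (/ c) M ltac:(lra)).
    replace (D * PI * (/ c) ^ M) with (D * (/ c) ^ M * PI) by ring.
    apply Rmult_le_compat_l; [nra | lra].
- replace (Finite 0) with (Rbar_mult (D * PI) 0) by (simpl; f_equal; ring).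
  apply is_lim_seq_scal_l, is_lim_seq_geom; rewrite Rabs_pos_eq; lra.
- intros M; apply line_sum_RInt_lim; assumption.
- apply filterlim_C; simpl; [| apply filterlim_const].
  apply (is_lim_seq_scal_l _ (2 * PI) (Finite _)), is_series_jump_exp.
Qed.

Theorem theorem1 (S : C -> C) (hS : is_sqrt_w2m1_branch S)
    (c : R) (hc : 1 < c) (t : R) (ht : 0 < t) :
  (forall n : nat, ex_series (inner1 t n)) /\
  (forall n : nat, ex_series (inner2 t n)) /\
  ex_series (outer1 t) /\
  ex_series (outer2 t) /\
  is_scriptI S c t
    (RtoC (2 * t * exp (- t) / sqrt PI * (Series (outer1 t) - Series (outer2 t)))).
Proof.
split; [intros n; eexists; apply is_series_inner1, ht |].
split; [intros n; eexists; apply is_series_inner2, ht |].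
split; [eexists; apply is_series_outer1, ht |].
split; [eexists; apply is_series_outer2, ht |].
rewrite outer_difference by exact ht.
pose proof (transform_RInt_lim S c t hS hc ht) as HL.
set (V := / PI * RInt _ 0 PI) in *.
(* On [w = c + iy] one has [dw = i dy]; this [i] and the [2 PI] of the line integrals cancel the
   prefactor [1 / (2 PI i)]. *)
exists (Ci * RtoC (2 * PI * V))%C; split.
- exists (fun T => Ci * C_RInt (fun y => Cexp ((c, y) * RtoC t) * transform ((c, y) - S (c, y))) (- T) T)%C.
  split; [| exact (filterlim_C_mult Ci _ _ HL)].
  intros T; apply is_RInt_C_mult.
  apply (is_RInt_ext (V := C_R_NormedModule) (fun y => Cexp ((c, y) * RtoC t) * transform ((c, y) - S (c, y)))%C).
  + intros y _; symmetry; apply integrand_eq; [exact hS | apply branch_off_cut, hc].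
  + apply C_RInt_correct; intros y; apply transform_continuous; assumption.
- assert (Hpi : RtoC PI <> 0%C) by (intros K; injection K; apply PI_neq0).
  assert (Hi : Ci <> 0%C) by (intros K; injection K; lra).
  rewrite !RtoC_mult; field; split; assumption.
Qed.
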